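(* Let $G$ be a simple graph on $n$ nodes with degeneracy $d$ and $H$ a simple graph on $k$ nodes. Then, for some computable function $f$, one can compute $\hom(H,G)$ in time $f(d,k)\cdot\tilde{O}(n^{\tau_1(H)})$, $\mathrm{sub}(H,G)$ in time $f(d,k)\cdot\tilde{O}(n^{\tau_2(H)})$, and $\mathrm{ind}(H,G)$ in time $f(d,k)\cdot\tilde{O}(n^{\tau(H)})$.
   Context: Degeneracy of $G$: smallest $d$ such that $G$ has an acyclic orientation with all out-degrees at most $d$. $\hom,\mathrm{sub},\mathrm{ind}$: numbers of homomorphisms, copies, and induced copies of $H$ in $G$. For a dag $P$: $S_P$ its sources; $V_P(u)$ the set of nodes reachable from $u$ (including $u$); $V_P(B)=\bigcup_{u\in B}V_P(u)$. A dag tree decomposition of $P$ is a rooted tree whose nodes (bags) are subsets of $S_P$ with union $S_P$, such that whenever bag $B$ lies on the tree path between bags $B_1,B_2$, $V_P(B_1)\cap V_P(B_2)\subseteq V_P(B)$; width = max bag size; $\tau(P)$ = minimum width. For undirected $H$: $\tau_1(H)=\max\tau(P)$ over all acyclic orientations $P$ of $H$; $\tau_2(H)=\max\tau_1(H/\theta)$ over all equivalence relations $\theta$ on $V_H$, where $H/\theta$ identifies equivalent nodes and removes loops and multiple edges; $\tau(H)=\tau_3(H)=\max\tau_2(H')$ over all graphs $H'$ on $V_H$ with $E_{H'}\supseteq E_H$ (including $H$). Conventions: $k=O(1)$; $\tilde O$ hides $\mathrm{poly}(k)$ and $\mathrm{polylog}(ndk)$ factors. *)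

(* Defs.v *)
From HB Require Import structures.
From mathcomp Require Import all_boot boolp.

Set Implicit Arguments.
Unset Strict Implicit.
Unset Printing Implicit Defensive.

(** * Simple graphs, dags and counts *)

Record sgraph (V : finType) := SGraph {
  edges : {set {set V}};
  _ : [forall e in edges, #|e| == 2] }.

HB.instance Definition _ (V : finType) := [isSub for @edges V].
HB.instance Definition _ (V : finType) := [Finite of sgraph V by <:].

(* [x != y] is automatic, since every edge has two elements. *)
Definition adj (V : finType) (H : sgraph V) (x y : V) : bool :=
  [set x; y] \in edges H.

Section GraphOfRel.
Variables (V : finType) (r : rel V).

Definition rel_edges : {set {set V}} :=
  [set [set p.1; p.2] | p in [set q : V * V | (q.1 != q.2) && r q.1 q.2]].

Lemma rel_edgesP : [forall e in rel_edges, #|e| == 2].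
Proof.
apply/forall_inP => e /imsetP [[x y]]; rewrite inE => /andP [xy _] -> /=.
by rewrite cards2 xy.
Qed.

(* Symmetrizes [r], discards its loops and merges parallel edges. *)
Definition graph_of_rel : sgraph V := SGraph rel_edgesP.

End GraphOfRel.

(* A set of ordered pairs is used both as a set of arcs and as a relation. *)
Definition arc (V : finType) (D : {set V * V}) : rel V :=
  fun x y => (x, y) \in D.

Section Orientations.
Variable V : finType.
Implicit Types (H : sgraph V) (D : {set V * V}).

Definition orientation H D : bool :=
  [forall x, forall y, (adj H x y == (arc D x y || arc D y x))
                       && ~~ (arc D x y && arc D y x)].

Definition acyclic D : bool :=
  [forall x, forall y, arc D x y ==> ~~ connect (arc D) y x].

Definition acyclic_orientation H D : bool := orientation H D && acyclic D.

Definition outdeg D (u : V) : nat := #|[set v | arc D u v]|.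

Definition degenerate H (d : nat) : bool :=
  [exists D, acyclic_orientation H D && [forall u, outdeg D u <= d]].

Lemma adj_sym H x y : adj H x y = adj H y x.
Proof. by rewrite /adj setUC. Qed.

Lemma adj_irr H x : adj H x x = false.
Proof.
apply/negP => /(forall_inP (valP H)).
by rewrite setUid cards1.
Qed.

Lemma acyclic_orientation_ex H : exists D, acyclic_orientation H D.
Proof.
pose D := [set p | adj H p.1 p.2 && (enum_rank p.1 < enum_rank p.2)].
have arcE x y : arc D x y = adj H x y && (enum_rank x < enum_rank y).
  by rewrite /arc inE.
exists D; apply/andP; split.
  apply/'forall_forallP => x y; rewrite !arcE (adj_sym H y x).
  case E: (adj H x y) => //=.
  case: ltngtP => //= /ord_inj /enum_rank_inj xy.
  by rewrite xy adj_irr in E.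
apply/'forall_forallP => x y; apply/implyP; rewrite arcE => /andP [_ xy].
apply/negP => /connectP [p pth xE].
suff : enum_rank y <= enum_rank (last y p) by rewrite -xE leqNgt xy.
elim: p y pth {xy xE} => //= z p IH y /andP [].
by rewrite arcE => /andP [_ /ltnW yz] /IH; apply: leq_trans.
Qed.

Lemma degenerate_ex H : exists d, degenerate H d.
Proof.
have [D DH] := acyclic_orientation_ex H.
by exists #|V|; apply/existsP; exists D; rewrite DH; apply/forallP => u;
  rewrite max_card.
Qed.

Definition degeneracy H : nat := ex_minn (degenerate_ex H).

End Orientations.

Section Counts.
Variables (V W : finType) (H : sgraph V) (G : sgraph W).

Definition hom : nat :=
  #|[set phi : {ffun V -> W} |
      [forall u, forall v, adj H u v ==> adj G (phi u) (phi v)]]|.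

(* Subgraphs [(U, F)] of [G] that are isomorphic to [H]: an injection [phi]
   carries the nodes of [H] onto [U] and its edges onto [F]. *)
Definition sub : nat :=
  #|[set S : {set W} * {set {set W}} | (S.2 \subset edges G) &&
      [exists phi : {ffun V -> W},
        [&& injectiveb phi, S.1 == phi @: [set: V]
          & S.2 == [set phi @: (e : {set V}) | e in edges H]]]]|.

(* Node sets [U] such that the induced subgraph [G[U]] is isomorphic to [H]. *)
Definition ind : nat :=
  #|[set U : {set W} | [exists phi : {ffun V -> W},
      [&& injectiveb phi, U == phi @: [set: V]
        & [forall u, forall v, adj H u v == adj G (phi u) (phi v)]]]]|.

End Counts.

(** * Dag tree decompositions *)

Section DagTree.
Variables (V : finType) (P : {set V * V}).

Definition sources : {set V} := [set u | [forall v, ~~ arc P v u]].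

Definition reach (u : V) : {set V} := [set v | connect (arc P) u v].

Definition reachs (B : {set V}) : {set V} := \bigcup_(u in B) reach u.

Record dag_tree_decomposition := DagTreeDecomposition {
  node : finType;
  tree : sgraph node;
  root : node;
  bag : node -> {set V};
  tree_connected : forall s t, connect (adj tree) s t;
  (* a cycle of size two just traverses one edge back and forth *)
  tree_acyclic : forall c : seq node, ucycle (adj tree) c -> size c <= 2;
  bag_sources : forall t, bag t \subset sources;
  bag_cover : \bigcup_t bag t = sources;
  bag_path : forall (s : node) (p : seq node),
    path (adj tree) s p -> uniq (s :: p) ->
    forall t, t \in s :: p ->
    reachs (bag s) :&: reachs (bag (last s p)) \subset reachs (bag t) }.

Definition width (T : dag_tree_decomposition) : nat :=
  \max_(t : node T) #|bag t|.

Lemma single_bag_decomposition :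
  exists T : dag_tree_decomposition, width T = #|sources|.
Proof.
have uniq_unit (s : seq unit) : uniq s -> size s <= 1.
  by case: s => [|[] [|[] s]].
have conn s t : connect (adj (graph_of_rel (fun _ _ : unit => true))) s t.
  by case: s; case: t; apply: connect0.
exists (@DagTreeDecomposition unit _ tt (fun=> sources) conn
  (fun c h => leq_trans (uniq_unit c (proj2 (andP h))) (leqnSn 1))
  (fun=> subxx _) (big_pred1 tt (fun i => let: tt := i in erefl))
  (fun _ _ _ _ _ _ => subsetIl _ _)).
by rewrite /width (big_pred1 tt) //; case.
Qed.

Lemma width_ex :
  exists w, `[< exists T : dag_tree_decomposition, width T = w >].
Proof. by exists #|sources|; apply/asboolP/single_bag_decomposition. Qed.

Definition dag_treewidth : nat := ex_minn width_ex.

End DagTree.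

Section Quotient.
Variables (V : finType) (H : sgraph V) (theta : {set V * V}).

Definition eq_classes : {set {set V}} :=
  equivalence_partition (arc theta) [set: V].

Definition quotient_graph : sgraph {B : {set V} | B \in eq_classes} :=
  graph_of_rel (fun A B : {B : {set V} | B \in eq_classes} =>
    [exists x in val A, exists y in val B, adj H x y]).

End Quotient.

Definition tau1 (V : finType) (H : sgraph V) : nat :=
  \max_(P : {set V * V} | acyclic_orientation H P) dag_treewidth P.

Definition tau2 (V : finType) (H : sgraph V) : nat :=
  \max_(theta : {set V * V} | `[< equivalence_rel (arc theta) >])
    tau1 (quotient_graph H theta).

Definition tau3 (V : finType) (H : sgraph V) : nat :=
  \max_(H' : sgraph V | edges H \subset edges H') tau2 H'.

(** * Random access machines with logarithmic cost *)

(* The memory consists of arrays named by numbers, with one cell for every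
   natural index.  Array names occur only as constants, so that a program uses
   finitely many arrays; interleaving them in a single memory costs a constant
   factor.  A scalar variable is the cell of index 0 of an array. *)
Definition store := nat -> nat -> nat.

Definition update (s : store) (a i x : nat) : store :=
  fun b j => if (b == a) && (j == i) then x else s b j.

Inductive binop := Add | Sub | Mul | Div.

Definition binop_fun (o : binop) : nat -> nat -> nat :=
  match o with Add => addn | Sub => subn | Mul => muln | Div => divn end.

Inductive expr :=
  | Const of nat
  | Get of nat & expr
  | Op of binop & expr & expr.

Inductive cmd :=
  | Skip
  | Assign of nat & expr & expr
  | Seq of cmd & cmd
  | If of expr & cmd & cmd
  | While of expr & cmd.

Definition bitlen (x : nat) : nat := (trunc_log 2 x).+1.

Fixpoint eval (s : store) (e : expr) : nat :=
  match e with
  | Const x => x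
  | Get a e1 => s a (eval s e1)
  | Op o e1 e2 => binop_fun o (eval s e1) (eval s e2)
  end.

(* Each subexpression is charged the bit length of its value, so that every
   operation pays for its operands, its result and the address it accesses. *)
Fixpoint cost (s : store) (e : expr) : nat :=
  bitlen (eval s e) +
  match e with
  | Const _ => 0
  | Get _ e1 => cost s e1
  | Op _ e1 e2 => cost s e1 + cost s e2
  end.

(* [exec c s s' t]: started in [s], [c] halts in [s'] after time [t]. *)
Inductive exec : cmd -> store -> store -> nat -> Prop :=
  | ExecSkip s : exec Skip s s 1
  | ExecAssign s a ei ex :
      exec (Assign a ei ex) s (update s a (eval s ei) (eval s ex))
           (cost s ei + cost s ex)
  | ExecSeq s1 s2 s3 c1 c2 t1 t2 :
      exec c1 s1 s2 t1 -> exec c2 s2 s3 t2 -> exec (Seq c1 c2) s1 s3 (t1 + t2)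
  | ExecIfTrue s s' e c1 c2 t :
      eval s e != 0 -> exec c1 s s' t -> exec (If e c1 c2) s s' (cost s e + t)
  | ExecIfFalse s s' e c1 c2 t :
      eval s e = 0 -> exec c2 s s' t -> exec (If e c1 c2) s s' (cost s e + t)
  | ExecWhileTrue s1 s2 s3 e c t1 t2 :
      eval s1 e != 0 -> exec c s1 s2 t1 -> exec (While e c) s2 s3 t2 ->
      exec (While e c) s1 s3 (cost s1 e + t1 + t2)
  | ExecWhileFalse s e c :
      eval s e = 0 -> exec (While e c) s s (cost s e).

(* The input is written in array 0; all other cells initially hold 0. *)
Definition init (w : seq nat) : store :=
  fun a i => if a == 0 then nth 0 w i else 0.

(* The output is read in cell 0 of array 1. *)
Definition outputs (c : cmd) (w : seq nat) (y t : nat) : Prop :=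
  exists s, exec c (init w) s t /\ s 1 0 = y.

Definition computable2 (f : nat -> nat -> nat) : Prop :=
  exists c, forall x y, exists t, outputs c [:: x; y] (f x y) t.

(** * Counting problems *)

Definition adjacency_lists (n : nat) (G : sgraph 'I_n) (l : 'I_n -> seq 'I_n) :=
  forall u, perm_eq (l u) (enum [pred v | adj G u v]).

Definition encode (n : nat) (l : 'I_n -> seq 'I_n) : seq nat :=
  n :: flatten [seq size (l u) :: [seq val v | v <- l u] | u <- enum 'I_n].

(* A single program computes [count H G] from any adjacency lists of [H] and
   [G], in time f(d,k) * O~(n^(e H)), where O~ stands for a factor
   C * poly(k) * polylog(ndk).  The shifts by one and [maxn 1 n] are there for
   the cases where n, d or k is zero. *)
Definition counts_in_time (f : nat -> nat -> nat)
    (e : forall k : nat, sgraph 'I_k -> nat)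
    (count : forall k n : nat, sgraph 'I_k -> sgraph 'I_n -> nat) : Prop :=
  exists (p : cmd) (C c : nat),
  forall (k : nat) (H : sgraph 'I_k) (n : nat) (G : sgraph 'I_n)
         (lH : 'I_k -> seq 'I_k) (lG : 'I_n -> seq 'I_n),
    adjacency_lists H lH -> adjacency_lists G lG ->
    let d := degeneracy G in
    exists2 t, outputs p (encode lH ++ encode lG) (count k n H G) t &
      t <= f d k * (C * k.+1 ^ c * bitlen (n.+1 * d.+1 * k.+1) ^ c
                    * maxn 1 n ^ e k H).

(* Main.v *)
(* Repeatedly remove the vertices of G that have few remaining neighbours.  The
   order of removal orients G acyclically with out-degrees O(d), although d is not
   known: the threshold is raised only when a pass removes less than half of the
   remaining vertices, which cannot happen any more once it is 4d.  A homomorphism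
   pulls this orientation back to an acyclic orientation of H.  Inclusion-exclusion
   over the pairs of nodes of H that are identified, and over the non-edges of H
   that are sent to edges, turns each of the three numbers (for sub and ind, times
   the number of automorphisms of H) into a signed sum over pairs (O, S) of the
   number of maps that send the arcs O to arcs and are constant on the pairs in S.
   The pairs with a directed cycle contribute nothing; for the others O modulo S is
   an acyclic orientation of a quotient of a supergraph of H, so its dag treewidth
   is at most the exponent of the theorem.  Growing the tree of a decomposition
   node by node lists the bags in such a way that each bag meets all the previous
   ones, in terms of reachable nodes, inside a single previous one.  A dynamic
   program running through the bags from last to first then counts the maps.  The
   restriction of a map to the nodes reachable from a bag of size b is determined
   by the images of the b sources, for which there are n^b choices, and by a walk of
   length at most k along arcs for each reachable node, for which the number of
   choices depends on d and k only.

   The algorithm is written in a loop language.  Its expressions distinguish small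
   values, bounded in terms of d and k, from values polynomial in n; as iterations
   inside an expression run a small number of times, evaluating it takes time
   f(d,k) log n. *)

(* The bound has to hold under a bit cost, for one program that gets H as an input. Everything that
   depends on H alone, in particular a bag sequence of least width for each query, is therefore
   found by exhaustive search and even recomputed at every use; this only enlarges f. Correctness is
   separated from speed: a structured language is compiled to the machine once and for all, and a
   syntactic discipline on expressions yields their time bounds, so that only the outer loops have
   to be counted by hand. Among these, the peeling takes a number of rounds linear in d and log n,
   each linear in n for fixed d. Such linear terms are affordable because all widths are positive
   when k > 0; for k = 0 the exponent is 0 and a pass over G is excluded. Since the degeneracy is
   unknown and loops have fixed bounds, the number of rounds is fixed in terms of n, and the rounds
   that remain after the last removal must cost almost nothing. All numbers are natural, so signs
   appear as two separate sums, subtracted at the end. Finally f is computable because the language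
   itself can evaluate it. *)
Require Import Defs.
From mathcomp Require Import all_boot.
From mathcomp Require Import boolp.
From mathcomp Require Import zify.

Set Implicit Arguments.
Unset Strict Implicit.
Unset Printing Implicit Defensive.

(** * A language with bounded iteration *)

(* Variables are de Bruijn indices.  The last argument of [Iter] is the body, in
   which 0 is the number of the step and 1 the accumulator; the first argument of
   [Call] is evaluated in the environment formed by the other four alone. *)
Inductive fexp :=
  | Var of nat
  | Cst of nat
  | Rd of nat & fexp
  | Bin of binop & fexp & fexp
  | Iter of fexp & fexp & fexp
  | Call of fexp & fexp & fexp & fexp & fexp.

Fixpoint fev (st : store) (env : seq nat) (e : fexp) : nat :=
  match e with
  | Var i => nth 0 env i
  | Cst x => x
  | Rd a e1 => st a (fev st env e1)
  | Bin o e1 e2 => binop_fun o (fev st env e1) (fev st env e2)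
  | Iter eb ei es =>
      iteri (fev st env eb) (fun j acc => fev st [:: j, acc & env] es)
            (fev st env ei)
  | Call f a b c d =>
      fev st [:: fev st env a; fev st env b; fev st env c; fev st env d] f
  end.

(** An upper bound, not the exact cost of the compiled code: the constants leave room for register
    copies, loop tests and counter updates. *)
Fixpoint fco (st : store) (env : seq nat) (e : fexp) : nat :=
  match e with
  | Var _ | Cst _ => 2
  | Rd _ e1 => fco st env e1 + bitlen (fev st env e1) + 2
  | Bin _ e1 e2 => fco st env e1 + fco st env e2
                   + bitlen (fev st env e1) + bitlen (fev st env e2) + 3
  | Iter eb ei es =>
      let b := fev st env eb in
      let acc j := iteri j (fun j x => fev st [:: j, x & env] es)
                         (fev st env ei) in
      fco st env eb + fco st env ei
      + \sum_(j < b) (fco st [:: val j, acc j & env] es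
                     + bitlen (acc j.+1) + 5 * bitlen b + 7)
      + 3 * bitlen b + 6
  | Call f a b c d =>
      fco st env a + fco st env b + fco st env c + fco st env d
      + fco st [:: fev st env a; fev st env b; fev st env c; fev st env d] f
      + 2
  end + bitlen (fev st env e).

(* The arrays from [nuser] on are the registers of the compiled code. *)
Definition nuser := 20.
Definition reg (p : nat) := nuser + p.
Definition rget p := Get (reg p) (Const 0).
Definition rset p e := Assign (reg p) (Const 0) e.

(* [rho] lists the registers of the variables; the value is put in register [p],
   and only registers from [p] on are overwritten. *)
Fixpoint fcomp (rho : seq nat) (p : nat) (e : fexp) : cmd :=
  match e with
  | Var i => rset p (if i < size rho then rget (nth 0 rho i) else Const 0)
  | Cst x => rset p (Const x)
  | Rd a e1 => Seq (fcomp rho p e1) (rset p (Get a (rget p)))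
  | Bin o e1 e2 => Seq (fcomp rho p e1) (Seq (fcomp rho p.+1 e2)
                     (rset p (Op o (rget p) (rget p.+1))))
  | Iter eb ei es =>
      Seq (fcomp rho p eb) (Seq (fcomp rho p.+2 ei) (Seq (rset p.+1 (Const 0))
      (Seq (While (Op Defs.Sub (rget p) (rget p.+1))
              (Seq (fcomp [:: p.+1, p.+2 & rho] p.+3 es)
              (Seq (rset p.+2 (rget p.+3))
                   (rset p.+1 (Op Add (rget p.+1) (Const 1))))))
           (rset p (rget p.+2)))))
  | Call f a b c d =>
      Seq (fcomp rho p a) (Seq (fcomp rho p.+1 b) (Seq (fcomp rho p.+2 c)
      (Seq (fcomp rho p.+3 d)
      (Seq (fcomp [:: p; p.+1; p.+2; p.+3] p.+4 f) (rset p (rget p.+4))))))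
  end.

(** Source expressions that read only below [nuser] never see the registers, which the compiled code
    may therefore change freely. *)
Fixpoint wfa (e : fexp) : bool :=
  match e with
  | Var _ | Cst _ => true
  | Rd a e1 => (a < nuser) && wfa e1
  | Bin _ e1 e2 => wfa e1 && wfa e2
  | Iter eb ei es => [&& wfa eb, wfa ei & wfa es]
  | Call f a b c d => [&& wfa f, wfa a, wfa b, wfa c & wfa d]
  end.

Definition agree (s st : store) := forall a i, a < nuser -> s a i = st a i.

(** The registers of the variables lie below p, so code that overwrites only registers from p on
    leaves the environment intact. *)
Definition holds (s : store) (p : nat) (rho env : seq nat) :=
  size rho = size env /\
  forall i, i < size rho ->
    nth 0 rho i < p /\ s (reg (nth 0 rho i)) 0 = nth 0 env i.

Definition keeps (s s' : store) (p : nat) :=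
  forall q, q < p -> s' (reg q) 0 = s (reg q) 0.

Lemma keeps_trans s1 s2 s3 p q : p <= q ->
  keeps s1 s2 p -> keeps s2 s3 q -> keeps s1 s3 p.
Proof. by move=> pq k1 k2 r rp; rewrite k2 ?k1 //; apply: leq_trans pq. Qed.

Lemma keepsW s1 s2 p q : p <= q -> keeps s1 s2 q -> keeps s1 s2 p.
Proof. by move=> pq k r rp; rewrite k //; apply: leq_trans pq. Qed.

Lemma holds_keeps s s' p q rho env : p <= q ->
  holds s p rho env -> keeps s s' p -> holds s' q rho env.
Proof.
move=> pq [sz h] k; split=> // i /h [lp <-].
by rewrite k //; split=> //; apply: leq_trans pq.
Qed.

Lemma updateE s a i x b j :
  update s a i x b j = if (b == a) && (j == i) then x else s b j.
Proof. by []. Qed.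

Definition rupd s p x := update s (reg p) 0 x.

Lemma rupd_reg s p x q :
  rupd s p x (reg q) 0 = if q == p then x else s (reg q) 0.
Proof. by rewrite /rupd updateE /reg eqn_add2l andbT. Qed.

Lemma agree_rupd s st p x : agree s st -> agree (rupd s p x) st.
Proof.
move=> h a i au; rewrite /rupd updateE -h //.
by case: (a =P reg p) => // E; move: au; rewrite E /reg ltnNge leq_addr.
Qed.

Lemma keeps_rupd s p q x : p <= q -> keeps s (rupd s q x) p.
Proof. by move=> pq r rp; rewrite rupd_reg; case: eqP => // E; lia. Qed.

Lemma bitlen_gt0 x : 0 < bitlen x. Proof. by []. Qed.

Lemma bitlen_mono x y : x <= y -> bitlen x <= bitlen y.
Proof. by move=> h; rewrite /bitlen ltnS leq_trunc_log. Qed.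

Lemma eval_rget s p : eval s (rget p) = s (reg p) 0. Proof. by []. Qed.

Lemma cost_rget s p : cost s (rget p) = bitlen (s (reg p) 0) + 1.
Proof. by []. Qed.

Lemma exec_rset s p e :
  exec (rset p e) s (rupd s p (eval s e)) (cost s e + 1).
Proof. by rewrite addnC; apply: (ExecAssign s (reg p) (Const 0) e). Qed.

Lemma bitlen_fco st env e : bitlen (fev st env e) <= fco st env e.
Proof. by case: e => *; rewrite [fco _ _ _]/= leq_addl. Qed.

Lemma nth_holds s p rho env i :
  holds s p rho env -> i < size rho ->
  s (reg (nth 0 rho i)) 0 = nth 0 env i.
Proof. by case=> _ h /h []. Qed.

Lemma fcomp_ok e rho p env st s :
  wfa e -> agree s st -> holds s p rho env ->
  exists s' t, [/\ exec (fcomp rho p e) s s' t, t <= fco st env e,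
    agree s' st, keeps s s' p & s' (reg p) 0 = fev st env e].
Proof.
elim: e rho p env s => [i|x|a e IH|o e1 IH1 e2 IH2|eb IHb ei IHi es IHs
    |f IHf a IHa b IHb c IHc d IHd] rho p env s.
- move=> _ ag h /=; rewrite /bitlen.
  have := nth_holds h; case: ltnP => [lti /(_ i lti) E|ge _].
    exists (rupd s p (eval s (rget (nth 0 rho i)))); eexists; split.
    + exact: exec_rset.
    + by rewrite cost_rget E /bitlen; lia.
    + exact: agree_rupd.
    + exact: keeps_rupd.
    + by rewrite rupd_reg eqxx eval_rget.
  exists (rupd s p (eval s (Const 0))); eexists; split.
  + exact: exec_rset.
  + by rewrite nth_default; [|case: h => <-].
  + exact: agree_rupd.
  + exact: keeps_rupd.
  + by rewrite rupd_reg eqxx nth_default //; case: h => <-.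
- move=> _ ag h /=.
  exists (rupd s p (eval s (Const x))); eexists; split.
  + exact: exec_rset.
  + by rewrite /=; lia.
  + exact: agree_rupd.
  + exact: keeps_rupd.
  + by rewrite rupd_reg eqxx.
- move=> /= /andP [au we] ag h.
  have [s1 [t1 [x1 c1 a1 k1 v1]]] := IH _ _ _ _ we ag h.
  do 2 eexists; split; first by apply: ExecSeq x1 (exec_rset _ _ _).
  + rewrite /= v1 (a1 a _ au).
    by have -> : bitlen 0 = 1 by []; lia.
  + exact: agree_rupd.
  + by apply: (keeps_trans (leqnn _) k1); apply: keeps_rupd.
  + by rewrite rupd_reg eqxx /= v1 a1.
- move=> /= /andP [w1 w2] ag h.
  have [s1 [t1 [x1 c1 a1 k1 v1]]] := IH1 _ _ _ _ w1 ag h.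
  have h1 := holds_keeps (leqnSn p) h k1.
  have [s2 [t2 [x2 c2 a2 k2 v2]]] := IH2 _ _ _ _ w2 a1 h1.
  do 2 eexists; split.
  + by apply: ExecSeq x1 (ExecSeq x2 (exec_rset _ _ _)).
  + by rewrite /= v2 k2 // v1; have -> : bitlen 0 = 1 by []; lia.
  + exact: agree_rupd.
  + apply: (keeps_trans (leqnn _) k1).
    apply: (keeps_trans (leqnn _) (keepsW (leqnSn p) k2)); exact: keeps_rupd.
  + by rewrite rupd_reg eqxx /= v2 k2 // v1.
- move=> /= /and3P [wb wi ws] ag h.
  have [s1 [t1 [x1 c1 a1 k1 v1]]] := IHb _ _ _ _ wb ag h.
  have h1 : holds s1 p.+2 rho env by apply: (holds_keeps _ h k1); lia.
  have [s2 [t2 [x2 c2 a2 k2 v2]]] := IHi _ _ _ _ wi a1 h1.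
  set b := fev st env eb in v1 *.
  pose acc j := iteri j (fun j x => fev st [:: j, x & env] es) (fev st env ei).
  pose body := Seq (fcomp [:: p.+1, p.+2 & rho] p.+3 es)
    (Seq (rset p.+2 (rget p.+3)) (rset p.+1 (Op Add (rget p.+1) (Const 1)))).
  pose Y j := fco st [:: j, acc j & env] es
                     + bitlen (acc j.+1) + 5 * bitlen b + 7.
  (* Registers p, p+1 and p+2 hold the bound, the counter and the accumulator; the induction is on
     the number r of steps left. *)
  have loop r : forall j s0, j + r = b -> agree s0 st -> holds s0 p rho env ->
      s0 (reg p) 0 = b -> s0 (reg p.+1) 0 = j -> s0 (reg p.+2) 0 = acc j ->
      exists s' t, [/\ exec (While (Op Defs.Sub (rget p) (rget p.+1)) body) s0 s' t,
        t <= \sum_(j <= i < b) Y i + 3 * bitlen b + 2,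
        agree s' st, keeps s0 s' p & s' (reg p.+2) 0 = acc b].
    elim: r => [|r IHr] j s0 jr ag0 h0 vb vj va.
      exists s0; eexists; split; first by apply: ExecWhileFalse; rewrite /= vb vj; lia.
      + rewrite /= vb vj; have -> : j = b by lia.
        have := bitlen_mono (leq_subr b b); have -> : bitlen 0 = 1 by []; lia.
      + by [].
      + by move=> q.
      + by rewrite va; congr acc; lia.
    have ha : holds s0 p.+3 [:: p.+1, p.+2 & rho] [:: j, acc j & env].
      case: h0 => sz h0; split=> [|[|[|i]]] /=; first by rewrite sz.
      - by split=> //; lia.
      - by split=> //; lia.
      - by move=> /h0 [l0 v0]; split=> //; lia.
    have [s3 [t3 [x3 c3 a3 k3 v3]]] := IHs _ _ _ _ ws ag0 ha.
    set s4 := rupd s3 p.+2 (eval s3 (rget p.+3)).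
    set s5 := rupd s4 p.+1 (eval s4 (Op Add (rget p.+1) (Const 1))).
    have v4 : s4 (reg p.+1) 0 = j.
      by rewrite /s4 rupd_reg ifF; [rewrite k3 // | apply/eqP; lia].
    have k05 : keeps s0 s5 p.
      move=> q qp; rewrite /s5 rupd_reg ifF; last by apply/eqP; lia.
      rewrite /s4 rupd_reg ifF; last by apply/eqP; lia.
      by apply: k3; lia.
    have v5b : s5 (reg p) 0 = b.
      rewrite /s5 rupd_reg ifF; last by apply/eqP; lia.
      rewrite /s4 rupd_reg ifF; last by apply/eqP; lia.
      by rewrite k3 //; lia.
    have v5j : s5 (reg p.+1) 0 = j.+1.
      by rewrite /s5 rupd_reg eqxx /= v4; lia.
    have v5a : s5 (reg p.+2) 0 = acc j.+1.
      rewrite /s5 rupd_reg ifF; last by apply/eqP; lia.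
      by rewrite /s4 rupd_reg eqxx /= v3.
    have a5 : agree s5 st by do 2 apply: agree_rupd.
    have h5 : holds s5 p rho env by apply: (holds_keeps (leqnn p) h0 k05).
    have [s6 [t6 [x6 c6 a6 k6 v6]]] := IHr j.+1 s5 ltac:(lia) a5 h5 v5b v5j v5a.
    exists s6; eexists; split.
    + apply: ExecWhileTrue; last exact: x6.
        by rewrite /= vb vj; lia.
      by apply: ExecSeq x3 (ExecSeq (exec_rset _ _ _) (exec_rset _ _ _)).
    + rewrite big_ltn; last by lia.
      rewrite /= vb vj -/s4 v4 v3 -/(acc j.+1) /Y.
      have -> : fev st [:: j, acc j & env] es = acc j.+1 by [].
      have -> : bitlen 0 = 1 by []; have -> : bitlen 1 = 1 by [].
      have B1 := bitlen_mono (leq_subr j b).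
      have B2 : bitlen j <= bitlen b by apply: bitlen_mono; lia.
      have B3 : bitlen (j + 1) <= bitlen b by apply: bitlen_mono; lia.
      move: c3 c6; rewrite /Y.
      set SS := \sum_(_ <= _ < _) _; move: (fco _ _ es) => F c3 c6; lia.
    + by [].
    + by apply: (keeps_trans (leqnn _) k05 k6).
    + by [].
  set s3 := rupd s2 p.+1 (eval s2 (Const 0)).
  have k03 : keeps s s3 p.
    move=> q qp; rewrite /s3 rupd_reg ifF; last by apply/eqP; lia.
    by rewrite k2 ?k1 //; lia.
  have [s4 [t4 [x4 c4 a4 k4 v4]]] := loop b 0 s3 ltac:(lia) (agree_rupd _ _ a2)
    (holds_keeps (leqnn p) h k03)
    ltac:(rewrite /s3 rupd_reg ifF; [by rewrite k2 //; lia | by apply/eqP; lia])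
    ltac:(by rewrite /s3 rupd_reg eqxx)
    ltac:(rewrite /s3 rupd_reg ifF; [by rewrite v2 | by apply/eqP; lia]).
  do 2 eexists; split.
  + apply: ExecSeq x1 (ExecSeq x2 (ExecSeq (exec_rset _ _ _)
      (ExecSeq x4 (exec_rset _ _ _)))).
  + rewrite cost_rget v4 -/(acc b) -/b.
    have -> : \sum_(j < b) (fco st [:: val j, acc j & env] es
       + bitlen (acc j.+1) + 5 * bitlen b + 7) = \sum_(0 <= j < b) Y j.
      by rewrite big_mkord.
    rewrite /=; have -> : bitlen 0 = 1 by []; lia.
  + exact: agree_rupd.
  + apply: (keeps_trans (leqnn _) k03); apply: (keeps_trans (leqnn _) k4).
    exact: keeps_rupd.
  + by rewrite rupd_reg eqxx eval_rget v4.
- move=> /= /and5P [wf wa wb wc wd] ag h.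
  have [s1 [t1 [x1 c1 a1 k1 v1]]] := IHa _ _ _ _ wa ag h.
  have h1 : holds s1 p.+1 rho env by apply: (holds_keeps _ h k1); lia.
  have [s2 [t2 [x2 c2 a2 k2 v2]]] := IHb _ _ _ _ wb a1 h1.
  have h2 : holds s2 p.+2 rho env by apply: (holds_keeps _ h1 k2); lia.
  have [s3 [t3 [x3 c3 a3 k3 v3]]] := IHc _ _ _ _ wc a2 h2.
  have h3 : holds s3 p.+3 rho env by apply: (holds_keeps _ h2 k3); lia.
  have [s4 [t4 [x4 c4 a4 k4 v4]]] := IHd _ _ _ _ wd a3 h3.
  have h4 : holds s4 p.+4 [:: p; p.+1; p.+2; p.+3]
    [:: fev st env a; fev st env b; fev st env c; fev st env d].
    split=> // -[|[|[|[|//]]]] _ /=.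
    + by split; [lia | rewrite k4 ?k3 ?k2 //; lia].
    + by split; [lia | rewrite k4 ?k3 //; lia].
    + by split; [lia | rewrite k4 //; lia].
    + by split; [lia | ].
  have [s5 [t5 [x5 c5 a5 k5 v5]]] := IHf _ _ _ _ wf a4 h4.
  do 2 eexists; split.
  + by apply: ExecSeq x1 (ExecSeq x2 (ExecSeq x3 (ExecSeq x4
      (ExecSeq x5 (exec_rset _ _ _))))).
  + by rewrite cost_rget v5; lia.
  + exact: agree_rupd.
  + move=> q qp; rewrite rupd_reg ifF; last by apply/eqP; lia.
    by rewrite k5 ?k4 ?k3 ?k2 ?k1 //; lia.
  + by rewrite rupd_reg eqxx eval_rget.
Qed.

(** * Commands of the loop language and their compilation *)

Inductive fcmd :=
  | Put of nat & fexp & fexp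
  | Then of fcmd & fcmd
  | For of fexp & fcmd.

Fixpoint cden (env : seq nat) (c : fcmd) (st : store) : store :=
  match c with
  | Put a e1 e2 => update st a (fev st env e1) (fev st env e2)
  | Then c1 c2 => cden env c2 (cden env c1 st)
  | For e c1 => iteri (fev st env e) (fun j s => cden (j :: env) c1 s) st
  end.

Fixpoint cco (env : seq nat) (c : fcmd) (st : store) : nat :=
  match c with
  | Put _ e1 e2 => fco st env e1 + fco st env e2 + bitlen (fev st env e1)
                   + bitlen (fev st env e2) + 2
  | Then c1 c2 => cco env c1 st + cco env c2 (cden env c1 st)
  | For e c1 =>
      fco st env e + \sum_(j < fev st env e)
        (cco (val j :: env) c1 (iteri j (fun j s => cden (j :: env) c1 s) st)
         + 5 * bitlen (fev st env e) + 5) + 3 * bitlen (fev st env e) + 4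
  end.

Fixpoint compc (rho : seq nat) (p : nat) (c : fcmd) : cmd :=
  match c with
  | Put a e1 e2 => Seq (fcomp rho p e1) (Seq (fcomp rho p.+1 e2)
                     (Assign a (rget p) (rget p.+1)))
  | Then c1 c2 => Seq (compc rho p c1) (compc rho p c2)
  | For e c1 => Seq (fcomp rho p e) (Seq (rset p.+1 (Const 0))
      (While (Op Defs.Sub (rget p) (rget p.+1))
        (Seq (compc (p.+1 :: rho) p.+2 c1)
             (rset p.+1 (Op Add (rget p.+1) (Const 1))))))
  end.

Fixpoint wfac (c : fcmd) : bool :=
  match c with
  | Put a e1 e2 => [&& a < nuser, wfa e1 & wfa e2]
  | Then c1 c2 => wfac c1 && wfac c2
  | For e c1 => wfa e && wfac c1
  end.

Lemma agree_update s st a i x : agree s st -> agree (update s a i x) (update st a i x).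
Proof. by move=> h b j bu; rewrite !updateE h. Qed.

Lemma keeps_update s a i x p : a < nuser -> keeps s (update s a i x) p.
Proof.
move=> au q _; rewrite updateE; case: eqP => // E; move: au.
by rewrite -E /reg ltnNge leq_addr.
Qed.

Lemma compc_ok c rho p env st s :
  wfac c -> agree s st -> holds s p rho env ->
  exists s' t, [/\ exec (compc rho p c) s s' t, t <= cco env c st,
    agree s' (cden env c st) & keeps s s' p].
Proof.
elim: c rho p env st s => [a e1 e2|c1 IH1 c2 IH2|e c1 IH] rho p env st s.
- move=> /= /and3P [au w1 w2] ag h.
  have [s1 [t1 [x1 d1 a1 k1 v1]]] := fcomp_ok w1 ag h.
  have h1 := holds_keeps (leqnSn p) h k1.
  have [s2 [t2 [x2 d2 a2 k2 v2]]] := fcomp_ok w2 a1 h1.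
  have E1 : s2 (reg p) 0 = fev st env e1 by rewrite k2.
  exists (update s2 a (fev st env e1) (fev st env e2)); eexists; split.
  + apply: ExecSeq x1 (ExecSeq x2 _); rewrite -E1 -v2 -!eval_rget.
    exact: ExecAssign.
  + by rewrite !cost_rget E1 v2; lia.
  + exact: agree_update.
  + apply: (keeps_trans (leqnn _) k1).
    by apply: (keeps_trans (leqnn _) (keepsW (leqnSn p) k2)); apply: keeps_update.
- move=> /= /andP [w1 w2] ag h.
  have [s1 [t1 [x1 d1 a1 k1]]] := IH1 _ _ _ _ _ w1 ag h.
  have [s2 [t2 [x2 d2 a2 k2]]] := IH2 _ _ _ _ _ w2 a1 (holds_keeps (leqnn p) h k1).
  exists s2; eexists; split; first by apply: ExecSeq x1 x2.
  + by lia.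
  + by [].
  + exact: (keeps_trans (leqnn _) k1 k2).
- move=> /= /andP [w1 w2] ag h.
  have [s1 [t1 [x1 d1 a1 k1 v1]]] := fcomp_ok w1 ag h.
  set b := fev st env e in v1 *.
  pose stj j := iteri j (fun j s => cden (j :: env) c1 s) st.
  pose body := Seq (compc (p.+1 :: rho) p.+2 c1)
             (rset p.+1 (Op Add (rget p.+1) (Const 1))).
  pose Y j := cco (j :: env) c1 (stj j) + 5 * bitlen b + 5.
  have loop r : forall j s0, j + r = b -> agree s0 (stj j) -> holds s0 p rho env ->
      s0 (reg p) 0 = b -> s0 (reg p.+1) 0 = j ->
      exists s' t, [/\ exec (While (Op Defs.Sub (rget p) (rget p.+1)) body) s0 s' t,
        t <= \sum_(j <= i < b) Y i + 3 * bitlen b + 2,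
        agree s' (stj b) & keeps s0 s' p].
    elim: r => [|r IHr] j s0 jr ag0 h0 vb vj.
      exists s0; eexists; split; first by apply: ExecWhileFalse; rewrite /= vb vj; lia.
      + rewrite /= vb vj; have -> : j = b by lia.
        have := bitlen_mono (leq_subr b b); have -> : bitlen 0 = 1 by []; lia.
      + by have -> : b = j by lia.
      + by move=> q.
    have ha : holds s0 p.+2 (p.+1 :: rho) (j :: env).
      case: h0 => sz h0; split=> [|[|i]] /=; first by rewrite sz.
      - by split=> //; lia.
      - by move=> /h0 [l0 v0]; split=> //; lia.
    have [s3 [t3 [x3 d3 a3 k3]]] := IH _ _ _ _ _ w2 ag0 ha.
    set s5 := rupd s3 p.+1 (eval s3 (Op Add (rget p.+1) (Const 1))).
    have v4 : s3 (reg p.+1) 0 = j by rewrite k3 //; lia.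
    have k05 : keeps s0 s5 p.
      move=> q qp; rewrite /s5 rupd_reg ifF; last by apply/eqP; lia.
      by apply: k3; lia.
    have v5b : s5 (reg p) 0 = b.
      rewrite /s5 rupd_reg ifF; last by apply/eqP; lia.
      by rewrite k3 //; lia.
    have v5j : s5 (reg p.+1) 0 = j.+1.
      by rewrite /s5 rupd_reg eqxx /= v4; lia.
    have a5 : agree s5 (stj j.+1) by apply: agree_rupd.
    have h5 : holds s5 p rho env by apply: (holds_keeps (leqnn p) h0 k05).
    have [s6 [t6 [x6 d6 a6 k6]]] := IHr j.+1 s5 ltac:(lia) a5 h5 v5b v5j.
    exists s6; eexists; split.
    + apply: ExecWhileTrue; last exact: x6.
        by rewrite /= vb vj; lia.
      by apply: ExecSeq x3 (exec_rset _ _ _).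
    + rewrite big_ltn; last by lia.
      rewrite /= vb vj v4 /Y.
      have -> : bitlen 0 = 1 by []; have -> : bitlen 1 = 1 by [].
      have B1 := bitlen_mono (leq_subr j b).
      have B2 : bitlen j <= bitlen b by apply: bitlen_mono; lia.
      have B3 : bitlen (j + 1) <= bitlen b by apply: bitlen_mono; lia.
      move: d3 d6; rewrite /Y.
      set SS := \sum_(_ <= _ < _) _; move: (cco _ _ _) => F d3 d6; lia.
    + by [].
    + by apply: (keeps_trans (leqnn _) k05 k6).
  set s3 := rupd s1 p.+1 (eval s1 (Const 0)).
  have k03 : keeps s s3 p.
    move=> q qp; rewrite /s3 rupd_reg ifF; last by apply/eqP; lia.
    by rewrite k1 //; lia.
  have [s4 [t4 [x4 d4 a4 k4]]] := loop b 0 s3 ltac:(lia) (agree_rupd _ _ a1)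
    (holds_keeps (leqnn p) h k03)
    ltac:(rewrite /s3 rupd_reg ifF; [by [] | by apply/eqP; lia])
    ltac:(by rewrite /s3 rupd_reg eqxx).
  do 2 eexists; split.
  + by apply: ExecSeq x1 (ExecSeq (exec_rset _ _ _) x4).
  + have -> : \sum_(j < b) (cco (val j :: env) c1 (stj j) + 5 * bitlen b + 5)
       = \sum_(0 <= j < b) Y j by rewrite big_mkord.
    rewrite /=; have -> : bitlen 0 = 1 by []; lia.
  + by [].
  + exact: (keeps_trans (leqnn _) k03 k4).
Qed.

Definition program (c : fcmd) : cmd := compc [::] 0 c.

Lemma program_outputs c w : wfac c ->
  exists2 t, outputs (program c) w (cden [::] c (init w) 1 0) t
    & t <= cco [::] c (init w).
Proof.
move=> wc.
have [s' [t [x le ag _]]] : exists s' t, [/\ exec (compc [::] 0 c) (init w) s' t,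
    t <= cco [::] c (init w), agree s' (cden [::] c (init w)) & keeps (init w) s' 0].
  by apply: compc_ok.
by exists t => //; exists s'; split=> //; apply: ag.
Qed.

(** * Time bounds from a two-sorted discipline *)

(* [true] is the sort of small values, which are bounded in terms of d and k alone. *)
Definition smallarr : nat -> bool := fun a => (a == 2) || (a == 3).

(** A difference or a quotient is bounded by its first operand and takes its sort. Thus a minimum
    written as [fMin] is small as soon as its first argument is. *)
Fixpoint srt (G : seq bool) (e : fexp) : bool :=
  match e with
  | Var i => nth true G i
  | Cst _ => true
  | Rd a _ => smallarr a
  | Bin Defs.Sub e1 _ | Bin Div e1 _ => srt G e1
  | Bin _ e1 e2 => srt G e1 && srt G e2
  | Iter _ ei es => srt G ei && srt [:: true, true & G] es
  | Call f a b c d => srt [:: srt G a; srt G b; srt G c; srt G d] f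
  end.

(** Iteration counts must be small. An accumulator is taken as small when this is self-consistent:
    the start is small, and so is the body under the assumption that the accumulator is. *)
Fixpoint wfs (G : seq bool) (e : fexp) : bool :=
  match e with
  | Var _ | Cst _ => true
  | Rd _ e1 => wfs G e1
  | Bin _ e1 e2 => wfs G e1 && wfs G e2
  | Iter eb ei es => [&& srt G eb, wfs G eb, wfs G ei
      & wfs [:: true, srt G ei && srt [:: true, true & G] es & G] es]
  | Call f a b c d => [&& wfs G a, wfs G b, wfs G c, wfs G d
      & wfs [:: srt G a; srt G b; srt G c; srt G d] f]
  end.

Lemma leq_exp2rW x y e : x <= y -> x ^ e <= y ^ e.
Proof. by case: e => // e h; rewrite leq_exp2r. Qed.

(** Bounds a small accumulator after b steps: a step may turn a bound x into [T x], and the summand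
    x keeps the bounds increasing. *)
Definition itsmall (T : nat -> nat) (b i : nat) := iter b (fun x => x + T x) i.

(** One function plays three roles: for [m] bounding the small inputs and [M] the others, it bounds
    small values, the exponent of [M] in arbitrary values, and the factor of [bitlen M] in the
    cost. *)
Fixpoint tb (e : fexp) (m : nat) : nat :=
  match e with
  | Var _ => m + 3
  | Cst x => m + x + 3
  | Rd _ e1 => 2 * tb e1 m + m + 5
  | Bin _ e1 e2 => tb e1 m * tb e2 m + 3 * (tb e1 m + tb e2 m) + 5
  | Iter eb ei es =>
      let b := tb eb m in let i := tb ei m in
      let A := itsmall (tb es) b (m + b + i) in
      let t := tb es A in
      let E := i * t ^ b in
      A + 6 * b + 2 * i + (b + 1) * (t * E + E + 5 * b + 15 + t) + 6 + E
  | Call f a b c d =>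
      let t := tb a m + tb b m + tb c m + tb d m in
      t + 2 * (t * tb f (m + t)) + 2
  end.

Lemma leq_itsmall T T' b b' i i' : (forall x y, x <= y -> T x <= T' y) ->
  b <= b' -> i <= i' -> itsmall T b i <= itsmall T' b' i'.
Proof.
move=> hT bb ii; rewrite /itsmall -(subnK bb) iterD.
have: iter b (fun x => x + T x) i <= iter b (fun x => x + T' x) i'.
  by elim: b {bb} => //= r IH; apply: leq_add => //; apply: hT.
move: (iter b _ i') => x; elim: (b' - b) => //= r IH.
by move=> h; apply: leq_trans (IH h) _; apply: leq_addr.
Qed.

Lemma tb_gt0 e m : 0 < tb e m.
Proof. by case: e => *; rewrite /=; lia. Qed.

Lemma leq_tb e m m' : m <= m' -> tb e m <= tb e m'.
Proof.
elim: e m m' => [i|x|a e IH|o e1 IH1 e2 IH2|eb IHb ei IHi es IHs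
    |f IHf a IHa b IHb c IHc d IHd] m m' mm /=.
- by rewrite leq_add2r.
- by rewrite !leq_add2r.
- by have := IH _ _ mm; lia.
- have h1 := IH1 _ _ mm; have h2 := IH2 _ _ mm.
  by have := leq_mul h1 h2; lia.
- have hb := IHb _ _ mm; have hi := IHi _ _ mm.
  set A := itsmall _ _ _; set A' := itsmall _ _ (m' + _ + _).
  have hA : A <= A' by apply: leq_itsmall => //; rewrite !leq_add.
  set t := tb es _; set t' := tb es A'.
  have ht : t <= t' by apply: IHs.
  have hE : tb ei m * t ^ tb eb m <= tb ei m' * t' ^ tb eb m'.
    apply: leq_mul => //; apply: (@leq_trans (t' ^ tb eb m)); first exact: leq_exp2rW.
    by apply: leq_pexp2l => //; apply: tb_gt0.
  have htE := leq_mul ht hE.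
  have hl : (tb eb m + 1) * (t * (tb ei m * t ^ tb eb m) + tb ei m * t ^ tb eb m
      + 5 * tb eb m + 15 + t) <=  (tb eb m' + 1) * (t' * (tb ei m' * t' ^ tb eb m')
      + tb ei m' * t' ^ tb eb m' + 5 * tb eb m' + 15 + t').
    by apply: leq_mul; lia.
  lia.
- have h1 := IHa _ _ mm; have h2 := IHb _ _ mm.
  have h3 := IHc _ _ mm; have h4 := IHd _ _ mm.
  set t := _ + tb d m; set t' := _ + tb d m'.
  have ht : t <= t' by rewrite /t /t'; lia.
  have hf : tb f (m + t) <= tb f (m' + t') by apply: IHf; lia.
  by have := leq_mul ht hf; lia.
Qed.

Lemma ltn_bitlen x : x < 2 ^ bitlen x.
Proof.
case: x => // x; rewrite /bitlen.
by have /andP [] := trunc_log_bounds (isT : 1 < 2) (isT : 0 < x.+1).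
Qed.

Lemma bitlen_leq x n : 0 < n -> x < 2 ^ n -> bitlen x <= n.
Proof.
case: x => [|x] n0 h; first exact: n0.
rewrite /bitlen -(@ltn_exp2l 2) //; apply: leq_ltn_trans h.
by have /andP [] := trunc_log_bounds (isT : 1 < 2) (isT : 0 < x.+1).
Qed.

Lemma bitlen_exp M t : 0 < t -> bitlen (M ^ t) <= t * bitlen M.
Proof.
move=> t0; apply: bitlen_leq; first by rewrite muln_gt0 t0.
by rewrite mulnC expnM ltn_exp2r // ltn_bitlen.
Qed.

Definition bnd (m M : nat) (st : store) :=
  forall a i, st a i <= if smallarr a then m else M.

Definition envok (G : seq bool) (env : seq nat) (m M : nat) :=
  forall i, nth 0 env i <= if nth true G i then m else M.

Lemma leq_expM M x y : 1 < M -> x <= y -> M ^ x <= M ^ y.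
Proof. by move=> M2; rewrite leq_exp2l. Qed.

Lemma leq_self_expM M x : 1 < M -> x <= M ^ x.
Proof. by move=> M2; apply: ltnW; apply: ltn_expl. Qed.

Lemma bitlen_val M v t : 1 < M -> 0 < t -> v <= M ^ t -> bitlen v <= t * bitlen M.
Proof. by move=> M2 t0 h; apply: leq_trans (bitlen_mono h) (bitlen_exp _ t0). Qed.

Lemma envok_cons G env m M (s : bool) x :
  x <= (if s then m else M) -> envok G env m M -> envok (s :: G) (x :: env) m M.
Proof. by move=> hx h [|i] //=; apply: h. Qed.

Lemma envokW G env m M m' M' : m <= m' -> M <= M' ->
  envok G env m M -> envok G env m' M'.
Proof.
move=> mm MM h i; apply: leq_trans (h i) _; by case: ifP.
Qed.

Lemma bndW m M m' M' st : m <= m' -> M <= M' -> bnd m M st -> bnd m' M' st.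
Proof. by move=> mm MM h a i; apply: leq_trans (h a i) _; case: ifP. Qed.

(** Values stay polynomial in [M] with an exponent depending on [m] only, so every bit length, and
    with it the cost, is at most such a factor times [bitlen M]. *)
Lemma tb_ok e G env st m M : 1 < M -> wfs G e -> bnd m M st -> envok G env m M ->
  [/\ fev st env e <= M ^ tb e m, srt G e -> fev st env e <= tb e m
    & fco st env e <= tb e m * bitlen M].
Proof.
elim: e G env m M => [i|x|a e IH|o e1 IH1 e2 IH2|eb IHb ei IHi es IHs
    |f IHf a IHa b IHb c IHc d IHd] G env m M M2.
- move=> _ hs he; have hv : fev st env (Var i) <= M ^ m.+1.
    apply: leq_trans (he i) _; case: ifP => _.
      by apply: leq_trans (leq_self_expM _ M2) (leq_expM M2 (leqnSn m)).
    by rewrite -{1}(expn1 M); apply: leq_expM.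
  split.
  + by apply: leq_trans hv (leq_expM M2 _); rewrite /=; lia.
  + by move=> /= si; have := he i; rewrite si; lia.
  + rewrite /= -/(fev st env (Var i)); have := bitlen_val M2 (ltn0Sn m) hv.
    by have := bitlen_gt0 M; lia.
- move=> _ hs he; have hv : x <= M ^ x.+1.
    exact: leq_trans (leq_self_expM _ M2) (leq_expM M2 (leqnSn x)).
  split.
  + by apply: leq_trans hv (leq_expM M2 _); rewrite /=; lia.
  + by move=> _ /=; lia.
  + rewrite /=; have := bitlen_val M2 (ltn0Sn x) hv.
    by have := bitlen_gt0 M; lia.
- move=> /= w hs he; have [v _ k] := IH G env m M M2 w hs he.
  have hv : st a (fev st env e) <= M ^ m.+1.
    apply: leq_trans (hs _ _) _; case: ifP => _.
      by apply: leq_trans (leq_self_expM _ M2) (leq_expM M2 (leqnSn m)).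
    by rewrite -{1}(expn1 M); apply: leq_expM.
  split.
  + by apply: leq_trans hv (leq_expM M2 _); lia.
  + by move=> sa; have := hs a (fev st env e); rewrite sa; lia.
  + have := bitlen_val M2 (ltn0Sn m) hv.
    have := bitlen_val M2 (tb_gt0 e m) v.
    by have := bitlen_gt0 M; lia.
- move=> /= /andP [w1 w2] hs he.
  have [v1 s1 k1] := IH1 G env m M M2 w1 hs he.
  have [v2 s2 k2] := IH2 G env m M M2 w2 hs he.
  have b1 := bitlen_val M2 (tb_gt0 e1 m) v1.
  have b2 := bitlen_val M2 (tb_gt0 e2 m) v2.
  have g1 := tb_gt0 e1 m; have g2 := tb_gt0 e2 m.
  have G1 : 1 < M ^ tb e1 m by rewrite -(exp1n (tb e1 m)) ltn_exp2r.
  have G2 : 1 < M ^ tb e2 m by rewrite -(exp1n (tb e2 m)) ltn_exp2r.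
  set v := binop_fun _ _ _.
  have hv : v <= M ^ (tb e1 m + tb e2 m).
    rewrite /v expnD; case: o {v} => /=; last 1 [idtac].
    + by apply: leq_trans (leq_add v1 v2) _; nia.
    + by apply: leq_trans (leq_subr _ _) _; nia.
    + exact: leq_mul.
    + by apply: leq_trans (leq_div _ _) _; nia.
  split.
  + by apply: leq_trans hv (leq_expM M2 _); lia.
  + rewrite /v; case: o {v hv} => /=.
    * by move=> /andP [/s1 ? /s2 ?]; lia.
    * by move=> /s1 ?; lia.
    * by move=> /andP [/s1 h1 /s2 h2]; have := leq_mul h1 h2; lia.
    * by move=> /s1 h1; apply: leq_trans (leq_div _ _) _; lia.
  + have := bitlen_val M2 (_ : 0 < tb e1 m + tb e2 m) hv.
    by move/(_ ltac:(lia)); have := bitlen_gt0 M; nia.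
- move=> /= /and4P [sb wb wi ws] hs he.
  have {IHb} [vb /(_ sb) sb' kb] := IHb G env m M M2 wb hs he.
  have {IHi} [vi si ki] := IHi G env m M M2 wi hs he.
  have gb := tb_gt0 eb m; have gi := tb_gt0 ei m.
  set b0 := fev st env eb in vb sb' kb *; set b := tb eb m in vb sb' kb gb *.
  set i := tb ei m in vi si ki gi *.
  set s := srt G ei && _ in ws *.
  set A := itsmall _ _ _; set t := tb es _.
  pose acc j := iteri j (fun j x => fev st [:: j, x & env] es) (fev st env ei).
  pose Aj j := iter j (fun x => x + tb es x) (m + b + i).
  have Amono j j' : j <= j' -> Aj j <= Aj j'.
    move=> jj; rewrite -(subnK jj) /Aj iterD; elim: (j' - j) => //= r IH.
    by apply: leq_trans IH _; apply: leq_addr.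
  have A0 j : m + b + i <= Aj j by apply: (Amono 0).
  have tA j : j <= b -> tb es (Aj j) <= t.
    by move=> jb; apply: leq_tb; apply: Amono.
  have gt : 0 < t by apply: tb_gt0.
  have Emono j j' : j <= j' -> i * t ^ j <= i * t ^ j'.
    by move=> jj; rewrite leq_mul2l leq_pexp2l // orbT.
  (* The induction hypothesis for the body is applied with [M ^ (i * t ^ j)] in place of [M] and
     [Aj j] in place of [m]: each step multiplies the exponent by at most t. *)
  have key j : j <= b0 -> acc j <= M ^ (i * t ^ j) /\ (s -> acc j <= Aj j)
      /\ (j < b0 -> fco st [:: j, acc j & env] es <= t * (i * t ^ b) * bitlen M).
    have step j' : j' < b0 -> acc j' <= M ^ (i * t ^ j') -> (s -> acc j' <= Aj j') ->
      [/\ fev st [:: j', acc j' & env] es <= (M ^ (i * t ^ j')) ^ tb es (Aj j'),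
          srt [:: true, s & G] es -> fev st [:: j', acc j' & env] es
            <= tb es (Aj j')
        & fco st [:: j', acc j' & env] es
            <= tb es (Aj j') * bitlen (M ^ (i * t ^ j'))].
      move=> jb hM hS.
      have g : 0 < i * t ^ j' by rewrite muln_gt0 gi expn_gt0 gt.
      have MM : M <= M ^ (i * t ^ j') by rewrite -{1}(expn1 M); apply: leq_expM.
      have := A0 j' => A0j.
      apply: IHs => //; first by apply: leq_trans M2 MM.
        by apply: bndW hs => //; lia.
      apply: envok_cons; first by lia.
      apply: envok_cons; first by case: ifP => // /hS; lia.
      by apply: envokW he => //; lia.
    have cst j' : j' < b0 -> acc j' <= M ^ (i * t ^ j') -> (s -> acc j' <= Aj j') ->
        fco st [:: j', acc j' & env] es <= t * (i * t ^ b) * bitlen M.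
      move=> jb hM hS; have [_ _ h] := step _ jb hM hS.
      have g : 0 < i * t ^ j' by rewrite muln_gt0 gi expn_gt0 gt.
      apply: leq_trans h _; rewrite -mulnA; apply: leq_mul; first by apply: tA; lia.
      apply: leq_trans (bitlen_exp _ g) _; apply: leq_mul => //; apply: Emono; lia.
    elim: j => [_|j IHj jb].
      have h0 : acc 0 <= M ^ (i * t ^ 0) by rewrite muln1.
      have h1 : s -> acc 0 <= Aj 0.
        by case/andP=> /si h _; apply: leq_trans h _; apply: leq_addl.
      by do 2 split=> //; move=> l; apply: cst.
    have [hM [hS _]] := IHj ltac:(lia).
    have [q1 q2 q3] := step j ltac:(lia) hM hS.
    have h0 : acc j.+1 <= M ^ (i * t ^ j.+1).
      apply: leq_trans q1 _; rewrite -expnM; apply: leq_expM => //.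
      by rewrite expnSr mulnA leq_mul2l tA ?orbT //; lia.
    have h1 : s -> acc j.+1 <= Aj j.+1.
      move=> es1; have /andP [_ es2] := es1; rewrite es1 in q2.
      by apply: leq_trans (q2 es2) _; apply: leq_addl.
    by do 2 split=> //; move=> l; apply: cst.
  clear IHs hs he; set E := i * t ^ b.
  have gE : 0 < E by rewrite muln_gt0 gi expn_gt0 gt.
  have [fM [fS _]] := key b0 (leqnn _); rewrite -/(acc b0).
  have EE : i * t ^ b0 <= E by apply: Emono.
  have hv : acc b0 <= M ^ E by apply: leq_trans fM (leq_expM M2 EE).
  have bl j : j <= b0 -> bitlen (acc j) <= E * bitlen M.
    move=> jb; apply: bitlen_val => //; have [h _] := key j jb.
    by apply: leq_trans h (leq_expM M2 (Emono _ _ _)); lia.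
  have blb : bitlen b0 <= b.+1.
    apply: leq_trans (bitlen_mono sb') _; apply: bitlen_leq => //.
    by apply: leq_trans (ltn_expl b (isT : 1 < 2)) _; rewrite leq_exp2l.
  split.
  + apply: leq_trans hv (leq_expM M2 _); lia.
  + move=> /fS h; apply: leq_trans h _; apply: leq_trans (Amono _ _ sb') _.
    by rewrite -/A /A /itsmall -/(Aj b); lia.
  + set SS := \sum_(_ < _) _.
    have hSS : SS <= b * (t * E * bitlen M + E * bitlen M + 5 * b.+1 + 7).
      apply: (@leq_trans (\sum_(j < b0) (t * E * bitlen M + E * bitlen M + 5 * b.+1 + 7))).
        apply: leq_sum => j _; have [_ [_ /(_ (ltn_ord j)) hc]] := key j (ltnW (ltn_ord j)).
        have := bl j.+1 (ltn_ord j); move: hc; rewrite -/E -/(acc j) -/(acc j.+1) /=.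
        move: (fco _ _ es) => F; lia.
      by rewrite sum_nat_const card_ord leq_mul2r sb' orbT.
    have := bl b0 (leqnn _).
    have B := bitlen_gt0 M.
    have : 5 * b.+1 + 7 <= (5 * b + 12) * bitlen M by nia.
    have : 3 * bitlen b0 + 6 <= (3 * b + 9) * bitlen M by nia.
    move: hSS; rewrite -/(acc b0).
    move: (bitlen (acc b0)) => X1 hSS h1 h2 h3.
    have : SS <= b * (t * E  + E  + 5 * b + 12) * bitlen M.
      apply: leq_trans hSS _; rewrite -[leqRHS]mulnA leq_mul2l; apply/orP; right.
      by rewrite !mulnDl; lia.
    move=> h4; move: (t * E) h4 => tE h4.
    have : SS <= (b * (tE + E + 5 * b + 15 + t)) * bitlen M.
      by apply: leq_trans h4 _; rewrite leq_mul2r leq_mul2l; lia.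
    have -> : (b + 1) * (tE + E + 5 * b + 15 + t) =
         b * (tE + E + 5 * b + 15 + t) + (tE + E + 5 * b + 15 + t) by rewrite mulnDl mul1n.
    move: (b * _) => Z h5.
    suff : SS + fco st env eb + fco st env ei + 3 * bitlen b0 + 6 + X1 <=
      (Z + b + i + 3 * b + 9 + E) * bitlen M.
      move=> h6; apply: leq_trans (_ : _ <= _) (leq_trans h6 _).
        by rewrite (addnC (_ + _) SS) addnA.
      rewrite leq_mul2r; apply/orP; right; lia.
    clear -h1 h3 h5 kb ki hSS; rewrite !mulnDl; lia.
- move=> /= /and5P [wa wb wc wd wf] hs he.
  have {IHa wa} [va sa ka] := IHa G env m M M2 wa hs he.
  have {IHb wb} [vb sb kb] := IHb G env m M M2 wb hs he.
  have {IHc wc} [vc sc kc] := IHc G env m M M2 wc hs he.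
  have {IHd wd} [vd sd kd] := IHd G env m M M2 wd hs he.
  set t := _ + tb d m.
  have [ta tb' tc td] : [/\ tb a m <= t, tb b m <= t, tb c m <= t & tb d m <= t].
    by rewrite /t; clear; split; lia.
  have tt : 0 < t := leq_trans (tb_gt0 a m) ta.
  (* The callee receives arguments up to [M ^ t], so its induction hypothesis is used with this
     larger base. *)
  have MM : M <= M ^ t by rewrite -{1}(expn1 M); apply: leq_expM.
  have arg x (s : bool) T : x <= M ^ T -> (s -> x <= T) -> T <= t ->
      x <= if s then m + t else M ^ t.
    move=> xM xs Tt; case: ifP => [/xs xT|_]; last exact: leq_trans xM (leq_expM M2 Tt).
    exact: leq_trans xT (leq_trans Tt (leq_addl m t)).
  have [||vf sf kf] := IHf [:: srt G a; srt G b; srt G c; srt G d]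
    [:: fev st env a; fev st env b; fev st env c; fev st env d] (m + t) (M ^ t)
    (leq_trans M2 MM) wf.
  + exact: bndW (leq_addr t m) MM hs.
  + apply: envok_cons (arg _ _ _ va sa ta) _; apply: envok_cons (arg _ _ _ vb sb tb') _.
    apply: envok_cons (arg _ _ _ vc sc tc) _; apply: envok_cons (arg _ _ _ vd sd td) _.
    by move=> i; rewrite nth_nil.
  have hv : fev st [:: fev st env a; fev st env b; fev st env c; fev st env d] f
     <= M ^ (t * tb f (m + t)) by rewrite expnM.
  have tf : 0 < t * tb f (m + t) by rewrite muln_gt0 tt tb_gt0.
  have hc : fco st env a + fco st env b + fco st env c + fco st env d <= t * bitlen M.
    by rewrite /t !mulnDl; apply: leq_add kd; apply: leq_add kc; apply: leq_add.
  have hb := bitlen_val M2 tf hv.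
  have ff : tb f (m + t) <= t * tb f (m + t) by rewrite leq_pmull.
  have bf : tb f (m + t) * bitlen (M ^ t) <= t * tb f (m + t) * bitlen M.
    by rewrite [t * _]mulnC -mulnA leq_mul2l bitlen_exp ?orbT.
  have B := bitlen_gt0 M.
  move: ff hv sf kf hc hb bf; set F := fev _ _ f; clearbody F.
  move: (fco st env a + _ + _ + _) => X; move: (fco st _ f) => Y.
  move: (tb f (m + t)) tf => W; move: (t * W) => Z; move: (W * bitlen _) => W' _.
  clear -M2 B => ff hv sf kf hc hb bf; split.
  + by apply: leq_trans hv (leq_expM M2 _); lia.
  + by move=> /sf; lia.
  + rewrite !mulnDl; lia.
Qed.

(** * Functions definable in the language, for the computability of the time factor *)

Definition pr (g : nat -> nat) :=
  exists2 e, wfa e & forall st x env, fev st (x :: env) e = g x.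

Lemma pr_id : pr id.
Proof. by exists (Var 0). Qed.

Lemma pr_cst c : pr (fun=> c).
Proof. by exists (Cst c). Qed.

Lemma pr_bin o g h : pr g -> pr h -> pr (fun x => binop_fun o (g x) (h x)).
Proof.
move=> [e we he] [e' we' he']; exists (Bin o e e'); first by rewrite /= we.
by move=> st x env /=; rewrite he he'.
Qed.

Lemma pr_add g h : pr g -> pr h -> pr (fun x => g x + h x).
Proof. exact: pr_bin Add _ _. Qed.

Lemma pr_mul g h : pr g -> pr h -> pr (fun x => g x * h x).
Proof. exact: pr_bin Mul _ _. Qed.

Lemma pr_comp g h : pr g -> pr h -> pr (fun x => g (h x)).
Proof.
move=> [e we he] [e' we' he'].
exists (Call e e' (Cst 0) (Cst 0) (Cst 0)); first by rewrite /= we we'.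
by move=> st x env /=; rewrite he he'.
Qed.

Lemma pr_iter b g i : pr b -> pr g -> pr i -> pr (fun x => iter (b x) g (i x)).
Proof.
move=> [eb wb hb] [eg wg hg] [ei wi hi].
exists (Iter eb ei (Call eg (Var 1) (Cst 0) (Cst 0) (Cst 0))).
  by rewrite /= wb wi wg.
move=> st x env /=; rewrite hb hi /=.
by elim: (b x) => //= n ->; rewrite hg.
Qed.

Lemma fev_call st env f a b c d : fev st env (Call f a b c d) =
  fev st [:: fev st env a; fev st env b; fev st env c; fev st env d] f.
Proof. by []. Qed.

Definition fPow := Iter (Var 1) (Cst 1) (Bin Mul (Var 1) (Var 2)).

Lemma fev_pow st b e env : fev st [:: b, e & env] fPow = b ^ e.
Proof. by rewrite /=; elim: e => //= e ->; rewrite expnSr. Qed.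

Lemma pr_exp g h : pr g -> pr h -> pr (fun x => g x ^ h x).
Proof.
move=> [e we he] [e' we' he'].
exists (Call fPow e e' (Cst 0) (Cst 0)); first by rewrite /= we we'.
by move=> st x env; rewrite fev_call fev_pow he he'.
Qed.

Lemma pr_ext g h : g =1 h -> pr g -> pr h.
Proof. by move=> E [e we he]; exists e => // st x env; rewrite he E. Qed.

(** For a fixed expression, [tb] unfolds into finitely many sums, products, powers, iterations and
    compositions. *)
Lemma pr_tb e : pr (tb e).
Proof.
elim: e => [i|x|a e IH|o e1 IH1 e2 IH2|eb IHb ei IHi es IHs
    |f IHf a IHa b IHb c IHc d IHd] /=;
  repeat first [exact: pr_id | exact: pr_cst | assumption | apply: pr_exp
    | apply: (pr_iter IHb) | apply: pr_add | apply: pr_mul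
    | apply: (pr_comp IHf) | apply: (pr_comp IHs)].
Qed.

(** The two parameters are merged into their sum, at the price of a larger bound, so that functions
    of one argument suffice. *)
Lemma computable_pr g : pr g -> computable2 (fun d k => g (d + k)).
Proof.
move=> [e we he].
pose c := Put 1 (Cst 0) (Call e (Bin Add (Rd 0 (Cst 0)) (Rd 0 (Cst 1)))
  (Cst 0) (Cst 0) (Cst 0)).
exists (program c) => x y.
have [|t ot _] := @program_outputs c [:: x; y]; first by rewrite /= we.
by exists t; move: ot; rewrite [cden _ _ _ _ _]/= he /init.
Qed.

(** * Logic and bounded operators by arithmetic *)

(** Truth values are 0 and 1, and truncated subtraction supplies negation and comparisons. There is
    no branching: [fIf] evaluates both alternatives. *)
Definition fNot a := Bin Defs.Sub (Cst 1) a.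
Definition fAnd a b := Bin Mul a b.
Definition fOr a b := fNot (fAnd (fNot a) (fNot b)).
Definition fImp a b := fNot (fAnd a (fNot b)).
Definition fLe a b := fNot (Bin Defs.Sub a b).
Definition fLt a b := fLe (Bin Add a (Cst 1)) b.
Definition fEq a b := fNot (Bin Add (Bin Defs.Sub a b) (Bin Defs.Sub b a)).
Definition fIf c a b := Bin Add (Bin Mul c a) (Bin Mul (fNot c) b).
Definition fMin a b := Bin Defs.Sub a (Bin Defs.Sub a b).
Definition fMod a b := Bin Defs.Sub a (Bin Mul (Bin Div a b) b).
Definition fAll b p := Iter b (Cst 1) (fAnd (Var 1) p).
Definition fEx b p := fNot (fAll b (fNot p)).
Definition fSum b e := Iter b (Cst 0) (Bin Add (Var 1) e).
Definition fProd b e := Iter b (Cst 1) (Bin Mul (Var 1) e).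
Definition fMax b e := Iter b (Cst 0) (Bin Add (Var 1) (Bin Defs.Sub e (Var 1))).
Definition fPick b p := Iter b (Cst 0) (fIf p (Var 0) (Var 1)).
Definition fCall3 f a b c := Call f a b c (Cst 0).
Definition fCall2 f a b := Call f a b (Cst 0) (Cst 0).
Definition fCall1 f a := Call f a (Cst 0) (Cst 0) (Cst 0).

Section Derived.
Variables (st : store) (env : seq nat).
Local Notation ev := (fev st env).

Lemma fev_not a (p : bool) : ev a = p -> ev (fNot a) = ~~ p.
Proof. by move=> /= ->; case: p. Qed.

Lemma fev_and a b (p q : bool) : ev a = p -> ev b = q -> ev (fAnd a b) = p && q.
Proof. by move=> /= -> ->; case: p; case: q. Qed.

Lemma fev_or a b (p q : bool) : ev a = p -> ev b = q -> ev (fOr a b) = p || q.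
Proof. by move=> /= -> ->; case: p; case: q. Qed.

Lemma fev_imp a b (p q : bool) : ev a = p -> ev b = q -> ev (fImp a b) = (p ==> q).
Proof. by move=> /= -> ->; case: p; case: q. Qed.

Lemma fev_le a b : ev (fLe a b) = (ev a <= ev b).
Proof. by rewrite /=; lia. Qed.

Lemma fev_lt a b : ev (fLt a b) = (ev a < ev b).
Proof. by rewrite fev_le /= addn1. Qed.

Lemma fev_eq a b : ev (fEq a b) = (ev a == ev b).
Proof. by rewrite /=; lia. Qed.

Lemma fev_if c a b (p : bool) : ev c = p -> ev (fIf c a b) = if p then ev a else ev b.
Proof. by move=> /= ->; case: p => /=; lia. Qed.

Lemma fev_min a b : ev (fMin a b) = minn (ev a) (ev b).
Proof. by rewrite /=; lia. Qed.

Lemma fev_mod a b : ev (fMod a b) = ev a %% ev b.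
Proof. by rewrite /= {1}(divn_eq (ev a) (ev b)) addKn. Qed.

Lemma fev_all eb p b (P : nat -> bool) : ev eb = b ->
  (forall j acc, j < b -> fev st [:: j, acc & env] p = P j) ->
  ev (fAll eb p) = [forall j : 'I_b, P j].
Proof.
move=> /= -> h.
suff H n : n <= b -> iteri n (fun j acc => acc * fev st [:: j, acc & env] p) 1
    = all P (iota 0 n).
  rewrite H //; congr nat_of_bool; apply/allP/forallP => [H1 j|H1 j].
    by apply: H1; rewrite mem_iota /= ltn_ord.
  by rewrite mem_iota /= => jb; apply: (H1 (Ordinal jb)).
elim: n => // n IH nb; rewrite -[in RHS]addn1 iotaD all_cat /= IH ?(ltnW nb) //.
by rewrite h // andbT; case: (all _ _); case: (P n).
Qed.

Lemma fev_ex eb p b (P : nat -> bool) : ev eb = b ->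
  (forall j acc, j < b -> fev st [:: j, acc & env] p = P j) ->
  ev (fEx eb p) = [exists j : 'I_b, P j].
Proof.
move=> hb h; rewrite (@fev_not _ [forall j : 'I_b, ~~ P j]) ?negb_forall.
  by congr nat_of_bool; apply: eq_existsb => j; rewrite negbK.
by apply: (fev_all (P := fun j => ~~ P j) hb) => j acc jb /=; rewrite h //; case: (P j).
Qed.

Lemma fev_sum eb e b (F : nat -> nat) : ev eb = b ->
  (forall j acc, j < b -> fev st [:: j, acc & env] e = F j) ->
  ev (fSum eb e) = \sum_(j < b) F j.
Proof.
move=> /= -> h.
suff H n : n <= b -> iteri n (fun j acc => acc + fev st [:: j, acc & env] e) 0
    = \sum_(j < n) F j by apply: H.
elim: n => [|n IH] nb; first by rewrite big_ord0.
by rewrite big_ord_recr /= IH ?(ltnW nb) // h.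
Qed.

Lemma fev_prod eb e b (F : nat -> nat) : ev eb = b ->
  (forall j acc, j < b -> fev st [:: j, acc & env] e = F j) ->
  ev (fProd eb e) = \prod_(j < b) F j.
Proof.
move=> /= -> h.
suff H n : n <= b -> iteri n (fun j acc => acc * fev st [:: j, acc & env] e) 1
    = \prod_(j < n) F j by apply: H.
elim: n => [|n IH] nb; first by rewrite big_ord0.
by rewrite big_ord_recr /= IH ?(ltnW nb) // h.
Qed.

Lemma fev_max eb e b (F : nat -> nat) : ev eb = b ->
  (forall j acc, j < b -> fev st [:: j, acc & env] e = F j) ->
  ev (fMax eb e) = \max_(j < b) F j.
Proof.
move=> /= -> h.
suff H n : n <= b -> iteri n (fun j acc => acc + (fev st [:: j, acc & env] e - acc)) 0
    = \max_(j < n) F j by apply: H.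
elim: n => [|n IH] nb; first by rewrite big_ord0.
by rewrite big_ord_recr /= IH ?(ltnW nb) // h // maxnE.
Qed.

(* The last index below [b] satisfying [p], or 0 if there is none. *)
Definition pick_below (b : nat) (p : nat -> bool) : nat :=
  iteri b (fun j acc => if p j then j else acc) 0.

Lemma fev_pick eb p b (P : nat -> bool) : ev eb = b ->
  (forall j acc, j < b -> fev st [:: j, acc & env] p = P j) ->
  ev (fPick eb p) = pick_below b P.
Proof.
move=> /= -> h; rewrite /pick_below.
suff H n : n <= b -> iteri n (fun j acc => fev st [:: j, acc & env] p * j
   + (1 - fev st [:: j, acc & env] p) * acc) 0
    = iteri n (fun j acc => if P j then j else acc) 0 by apply: H.
elim: n => [|n IH] // nb.
rewrite /= IH ?(ltnW nb) // h //.
by case: (P n) => /=; lia.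
Qed.

End Derived.

Lemma pick_belowP b (p : nat -> bool) :
  (exists2 x, x < b & p x) -> pick_below b p < b /\ p (pick_below b p).
Proof.
rewrite /pick_below; elim: b => [[//]|b IH] [x xb px] /=.
case: ifP => // npb; have [|h ph] := IH; last by split=> //; apply: ltnW.
exists x => //; move: xb; rewrite ltnS leq_eqVlt => /orP [/eqP E|//].
by rewrite E npb in px.
Qed.

(** * Digits *)

Definition dig (b x i : nat) : nat := (x %/ b ^ i) %% b.

Lemma dig0 b x : dig b x 0 = x %% b.
Proof. by rewrite /dig expn0 divn1. Qed.

Lemma digS b x i : dig b x i.+1 = dig b (x %/ b) i.
Proof. by rewrite /dig expnS divnMA. Qed.

Lemma ltn_dig b x i : 0 < b -> dig b x i < b.
Proof. exact: ltn_pmod. Qed.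

Lemma dig_inj b l x y : x < b ^ l -> y < b ^ l ->
  (forall i, i < l -> dig b x i = dig b y i) -> x = y.
Proof.
case: b => [|b].
  case: l => [|l]; last by rewrite exp0n.
  by rewrite expn0 !ltnS !leqn0 => /eqP -> /eqP ->.
elim: l x y => [|l IH] x y; first by rewrite expn0 !ltnS !leqn0 => /eqP -> /eqP ->.
move=> xl yl h; rewrite (divn_eq x b.+1) (divn_eq y b.+1).
have := h 0 isT; rewrite !dig0 => ->; congr (_ * _ + _).
by apply: IH => [||i il]; rewrite ?ltn_divLR // -?expnSr // -!digS h.
Qed.

Lemma dig_addl b a c l i : 0 < b -> i < l -> dig b (a * b ^ l + c) i = dig b c i.
Proof.
move=> b0 il; rewrite /dig -(subnK (ltnW il)) expnD mulnA divnMDl ?expn_gt0 ?b0 //.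
by rewrite -(subnSK il) expnSr mulnA modnMDl.
Qed.

Definition undig (b l : nat) (g : nat -> nat) : nat := \sum_(i < l) g i * b ^ i.

Lemma undigS b l g : undig b l.+1 g = g 0 + b * undig b l (fun i => g i.+1).
Proof.
rewrite /undig big_ord_recl expn0 muln1 big_distrr; congr (_ + _) => /=.
by apply: eq_bigr => i _; rewrite /bump add1n expnS; lia.
Qed.

Lemma ltn_undig b l g : (forall i, i < l -> g i < b) -> undig b l g < b ^ l.
Proof.
elim: l g => [|l IH] g h; first by rewrite /undig big_ord0.
rewrite undigS; have := IH (fun i => g i.+1) (fun i il => h i.+1 il).
have := h 0 isT; rewrite expnS; move: (undig _ _ _) => u h0 h1; nia.
Qed.

Lemma dig_undig b l g i : (forall i, i < l -> g i < b) -> i < l ->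
  dig b (undig b l g) i = g i.
Proof.
elim: l g i => // l IH g i h il; rewrite undigS.
have g0 := h 0 isT; have b0 : 0 < b by apply: leq_trans g0.
have mm : (g 0 + b * undig b l (fun i => g i.+1)) %% b = g 0.
  by rewrite mulnC addnC modnMDl modn_small.
case: i il => [|i] il; first by rewrite dig0 mm.
rewrite digS addnC mulnC divnMDl // divn_small // addn0 IH // => j jl; exact: h.
Qed.

(** Reindexing along the digit expansion, a bijection between the numbers below [b ^ l] and the
    functions into ['I_b]. The summand [P] takes natural numbers because the program sees digits
    without a bound attached. *)
Lemma sum_digits b l (F : {ffun 'I_l -> 'I_b} -> nat) (P : {ffun 'I_l -> nat} -> nat) :
  (forall g : {ffun 'I_l -> 'I_b}, P [ffun i => val (g i)] = F g) ->
  \sum_(x < b ^ l) P [ffun i : 'I_l => dig b x i] = \sum_g F g.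
Proof.
move=> PF.
pose code (g : {ffun 'I_l -> 'I_b}) := undig b l (fun i => oapp (fun j => val (g j)) 0 (insub i)).
have gb (g : {ffun 'I_l -> 'I_b}) i : i < l -> oapp (fun j => val (g j)) 0 (insub i) < b.
  by move=> il; rewrite insubT /= ltn_ord.
have cl g : code g < b ^ l by apply: ltn_undig => i; apply: gb.
have dc (g : {ffun 'I_l -> 'I_b}) (i : 'I_l) : dig b (code g) i = g i.
  by rewrite dig_undig ?valK //=; apply: gb.
rewrite (reindex (fun g => Ordinal (cl g))) /=.
  by apply: eq_bigr => g _; rewrite -PF; congr P; apply/ffunP => i; rewrite !ffunE dc.
(* For b = 0 the existence of x forces l = 0, and then there is no i. *)
have b0 (x : 'I_(b ^ l)) (i : 'I_l) : dig b x i < b.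
  apply: ltn_dig; move: (leq_ltn_trans (leq0n x) (ltn_ord x)) (ltn_ord i).
  by rewrite expn_gt0 => /orP [//|/eqP l0]; rewrite [X in _ < X]l0.
exists (fun x : 'I_(b ^ l) => [ffun i => Ordinal (b0 x i)]) => [g _|x _].
  by apply/ffunP => i; rewrite ffunE; apply: val_inj; rewrite /= dc.
apply: val_inj; rewrite /=; apply: (dig_inj (cl _) (ltn_ord x)) => i il.
by rewrite -[i]/(val (Ordinal il)) dc ffunE.
Qed.

(** * Counting solutions along a running-intersection order *)

Section Join.
Variables (k n m : nat) (X : nat -> {set 'I_k}) (par : nat -> nat).
(* The value 0 stands for an undefined image. *)
Local Notation map := {ffun 'I_k -> 'I_n.+1}.
Variable R : nat -> map -> bool.

Definition supp (phi : map) : {set 'I_k} := [set v | phi v != ord0].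
Definition rst (Y : {set 'I_k}) (phi : map) : map :=
  [ffun v => if v \in Y then phi v else ord0].
Definition upto (i : nat) : {set 'I_k} := \bigcup_(j < i) X j.
(** The interface of bag i: the nodes whose values are already fixed by earlier bags. *)
Definition sep (i : nat) : {set 'I_k} := X i :&: upto i.

(* [f] is fuel: the children [l] of the bag [i] come after [i]. *)
Fixpoint table (f i : nat) (sigma : map) : nat :=
  if f is f'.+1 then
    \sum_(phi | R i phi && (rst (sep i) phi == sigma))
      \prod_(l < m | (i < l) && (par l == i)) table f' l (rst (sep l) phi)
  else 0.

(** Under the hypotheses below, the number of ways to assign the bags of the subtree at i
    consistently with the values [sigma] on the interface of i. *)
Definition tab (i : nat) := table (m - i) i.

Lemma table_fuel f g i sigma : i < m -> m - i <= f -> m - i <= g ->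
  table f i sigma = table g i sigma.
Proof.
elim: f g i sigma => [|f IH] [|g] i sigma im fi gi; try by lia.
rewrite /=; apply: eq_bigr => phi _; apply: eq_bigr => l /andP [il _].
by apply: IH; have := ltn_ord l; lia.
Qed.

Lemma tabE i sigma : i < m -> tab i sigma =
  \sum_(phi | R i phi && (rst (sep i) phi == sigma))
      \prod_(l < m | (i < l) && (par l == i)) tab l (rst (sep l) phi).
Proof.
move=> im; rewrite /tab; case E : (m - i) => [|f]; first by lia.
rewrite [LHS]/=; apply: eq_bigr => phi _; apply: eq_bigr => l /andP [il _].
by apply: table_fuel; have := ltn_ord l; lia.
Qed.

(** Crude, but the exponent of n+1 depends only on k, the number m of bags and the fuel; hence table
    entries have O(log n) bits for fixed k. *)
Lemma table_le f i sigma : table f i sigma <= (n.+1 ^ k) ^ (m.+1 ^ f).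
Proof.
elim: f i sigma => [|f IH] i sigma //=.
set Y := (n.+1 ^ k) ^ (m.+1 ^ f).
have Y0 : 0 < Y by rewrite !expn_gt0.
have h (P : pred 'I_m) (F : 'I_m -> nat) : (forall l, F l <= Y) ->
    \prod_(l < m | P l) F l <= Y ^ m.
  move=> FY; rewrite -[m in X in _ <= X]card_ord -prod_nat_const.
  by rewrite big_mkcond; apply: leq_prod => l _; case: (P l).
apply: (@leq_trans (\sum_(phi : map) Y ^ m)).
  rewrite big_mkcond; apply: leq_sum => phi _; case: ifP => // _.
  by apply: h => l; apply: IH.
rewrite sum_nat_const card_ffun !card_ord /Y.
have : 0 < n.+1 ^ k by rewrite expn_gt0.
move: (n.+1 ^ k) => x x0; rewrite -expnM -expnS leq_pexp2l //.
by rewrite expnSr mulnS -add1n leq_add2r expn_gt0.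
Qed.

Hypothesis R_supp : forall i phi, R i phi -> supp phi = X i.
Hypothesis par_lt : forall i, 0 < i < m -> par i < i.
Hypothesis sep_par : forall i, 0 < i < m -> sep i \subset X (par i).

Lemma upto_sub i j : i < j -> X i \subset upto j.
Proof. by move=> ij; apply: (bigcup_sup (Ordinal ij)). Qed.

Lemma uptoS i : upto i.+1 = upto i :|: X i.
Proof. by rewrite /upto big_ord_recr. Qed.

Lemma rst_rst (Y Z : {set 'I_k}) phi : Y \subset Z -> rst Y (rst Z phi) = rst Y phi.
Proof.
move=> /subsetP YZ; apply/ffunP => v; rewrite !ffunE.
by case: ifP => // /YZ ->.
Qed.

Lemma supp_rst Y phi : supp (rst Y phi) = Y :&: supp phi.
Proof.
apply/setP => v; rewrite !inE !ffunE; case: ifP => //=; by rewrite eqxx.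
Qed.

Lemma rst_id (Y : {set 'I_k}) phi : supp phi \subset Y -> rst Y phi = phi.
Proof.
move=> /subsetP sY; apply/ffunP => v; rewrite ffunE; case: ifPn => // nv.
by apply/esym/eqP; apply: contraNT nv => nz; apply: sY; rewrite inE.
Qed.

(** Solutions on the first i bags; being undefined elsewhere makes them comparable as maps on all
    nodes. *)
Definition sol (i : nat) (psi : map) : bool :=
  (supp psi == upto i) && [forall j : 'I_i, R j (rst (X j) psi)].

(* Invariant of the count: it does not depend on [i]. *)
Definition stage (i : nat) : nat :=
  \sum_(psi | sol i psi)
    \prod_(l < m | (i <= l) && (par l < i)) tab l (rst (sep l) psi).

(** The bags l with [i <= l] and [par l < i] are pending, each summarised by its table. Adding bag i
    expands its table: by running intersection a solution on the earlier bags extends by any local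
    solution that agrees with it on [sep i], and the children of i become pending. *)
Lemma stage_step i : 0 < i < m -> stage i.+1 = stage i.
Proof.
move=> /[dup] i0m /andP [i0 im]; rewrite /stage.
rewrite (partition_big (rst (upto i)) (sol i)) /=; last first.
  move=> psi /andP [/eqP sp /forallP Rp]; apply/andP; split.
    by rewrite supp_rst sp uptoS; apply/eqP/setIidPl; apply: subsetUl.
  apply/forallP => j; rewrite rst_rst; last by apply: upto_sub.
  exact: (Rp (widen_ord (leqnSn i) j)).
apply: eq_bigr => psi0 /andP [/eqP sp0 /forallP R0].
rewrite (bigD1 (Ordinal im)) /=; last by rewrite leqnn par_lt.
transitivity (\sum_(psi | sol i.+1 psi && (rst (upto i) psi == psi0))
   (\prod_(l < m | (i < l) && (par l == i)) tab l (rst (sep l) psi)) *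
   (\prod_(l < m | (i < l) && (par l < i)) tab l (rst (sep l) psi0))).
  apply: eq_bigr => psi /andP [_ /eqP <-].
  rewrite (bigID (fun l : 'I_m => par l == i)) /=; congr (_ * _).
    by apply: eq_bigl => l; case: eqP => [->|_]; rewrite ?ltnSn ?andbT ?andbF.
  rewrite (eq_bigl (fun l : 'I_m => (i < l) && (par l < i))); last first.
    by move=> l /=; rewrite -andbA; congr (_ && _); lia.
  apply: eq_bigr => l /andP [il pl]; rewrite rst_rst //.
  apply: subset_trans (sep_par _) (upto_sub pl).
  by rewrite ltn_ord andbT; lia.
rewrite -big_distrl /=; congr (_ * _); last first.
  by apply: eq_bigl => l; rewrite -val_eqE /=; lia.
rewrite tabE //.
(* Inverse to the restriction to bag i: keep [psi0] where it is defined and take [phi] on the new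
   nodes. *)
pose glue (phi : map) : map := [ffun v => if v \in upto i then psi0 v else phi v].
have glueX phi : R i phi -> rst (sep i) phi = rst (sep i) psi0 ->
    rst (X i) (glue phi) = phi.
  move=> Rp E; apply/ffunP => v; rewrite !ffunE; case: ifPn => vX.
    case: ifPn => // vU; have /ffunP /(_ v) := E; rewrite !ffunE.
    by rewrite inE vX vU /= => <-.
  apply/esym/eqP; apply: contraNT vX => nz.
  by rewrite -(R_supp Rp) inE.
rewrite (reindex_onto glue (rst (X i))) /=; last first.
  move=> psi /andP [/andP [/eqP sp /forallP Rp] /eqP E]; apply/ffunP => v.
  rewrite !ffunE -E !ffunE; case: (boolP (v \in upto i)) => // vU; case: ifPn => // vX.
  apply/esym/eqP; apply: contraT => nz.
  have : v \in supp psi by rewrite inE.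
  by rewrite sp uptoS inE (negbTE vU) (negbTE vX).
have sX0 : rst (upto i) psi0 = psi0 by apply: rst_id; rewrite sp0.
have gU phi : rst (upto i) (glue phi) = psi0.
  by rewrite -sX0; apply/ffunP => v; rewrite !ffunE; case: ifP => // ->.
apply: eq_big => [phi|phi].
  rewrite gU eqxx andbT.
  apply/idP/idP => [/andP [/andP [_ /forallP Rg] /eqP gE]|/andP [Rp /eqP E]].
    have := Rg ord_max; rewrite /= gE => Rp; rewrite Rp /=.
    rewrite -gE rst_rst; last by apply: subsetIl.
    by rewrite -(gU phi) rst_rst //; apply: subsetIr.
  have gX := glueX _ Rp E; rewrite gX eqxx andbT; apply/andP; split.
    apply/eqP/setP => v; rewrite uptoS !inE ffunE; case: ifPn => vU /=.
      by rewrite -sp0 inE in vU; rewrite vU.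
    by rewrite -(R_supp Rp) inE.
  apply/forallP => j; case: (ltngtP j i) => [ji|ij|ji]; last by rewrite ji gX.
    rewrite -(rst_rst (glue phi) (upto_sub ji)) gU.
    exact: (R0 (Ordinal ji)).
  by have := ltn_ord j; lia.
move=> /andP [_ /eqP gE]; apply: eq_bigr => l /andP [il /eqP pl].
rewrite -[in RHS]gE rst_rst // -pl; apply: sep_par.
by rewrite ltn_ord andbT; lia.
Qed.

(** In [stage m] nothing is pending, so it counts the solutions; in [stage 1] the pending bags are
    the children of bag 0, which gives the recursion for [tab 0]. *)
Lemma count_join : 0 < m -> upto m = setT ->
  #|[set psi | sol m psi]| = tab 0 [ffun=> ord0].
Proof.
move=> m0 Um.
have sm : #|[set psi | sol m psi]| = stage m.
  rewrite /stage -sum1_card; apply: eq_big => [psi|psi _]; first by rewrite inE.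
  by rewrite big_pred0 // => l; rewrite leqNgt ltn_ord.
have ind r : r < m -> stage (m - r) = stage m.
  elim: r => [|r IH] rm; first by rewrite subn0.
  rewrite -IH; last by lia.
  have -> : m - r = (m - r.+1).+1 by lia.
  by rewrite stage_step //; lia.
rewrite sm -(ind m.-1) ?prednK //; have -> : m - m.-1 = 1 by lia.
have U1 : upto 1 = X 0 by rewrite /upto big_ord1.
rewrite tabE // /stage; apply: eq_big => [psi|psi _].
  have S0 : sep 0 = set0 by rewrite /sep /upto big_ord0 setI0.
  have -> : rst (sep 0) psi == [ffun=> ord0].
    by apply/eqP/ffunP => v; rewrite !ffunE S0 inE.
  rewrite andbT /sol U1; apply/andP/idP => [[/eqP sp /forallP /(_ ord0)]|R0].
    by rewrite /= rst_id ?sp.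
  rewrite (R_supp R0) eqxx; split=> //; apply/forallP => j; rewrite ord1 /=.
  by rewrite rst_id // (R_supp R0).
by apply: eq_bigl => l; rewrite ltnS leqn0.
Qed.

End Join.

(** * Running-intersection orders from dag tree decompositions *)

(** Among the nodes above w take one that reaches the most: a predecessor of it would reach strictly
    more, by acyclicity. *)
Lemma source_above (W : finType) (P : {set W * W}) (w : W) :
  acyclic P -> exists2 u, u \in sources P & connect (Defs.arc P) u w.
Proof.
move=> aP; case: (@arg_maxnP _ w (fun u => connect (Defs.arc P) u w)
  (fun u => #|reach P u|)); first exact: connect0.
move=> u uw umax; exists u => //; rewrite inE; apply/forallP => v.
apply/negP => vu.
have vw : connect (Defs.arc P) v w := connect_trans (connect1 vu) uw.
have := umax _ vw; apply/negP; rewrite -ltnNge; apply: proper_card.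
apply/properP; split.
  by apply/subsetP => x; rewrite !inE; apply: connect_trans (connect1 vu).
exists v; rewrite !inE ?connect0 //.
by have /'forall_forallP /(_ v u) := aP; rewrite vu.
Qed.

Section Order.
Variables (V : finType) (D : rel V).

(** A variant of [reachs] for an arbitrary relation: it will be applied to arcs together with
    identifications, so that the program never forms a quotient. *)
Definition reachD (B : {set V}) : {set V} :=
  [set v | [exists b in B, connect D b v]].

Lemma reachD0 : reachD set0 = set0.
Proof. by apply/setP => v; rewrite !inE; apply/existsP => -[b]; rewrite inE. Qed.

(* Newest bag first. *)
Fixpoint rip (L : seq {set V}) : Prop :=
  if L is x :: L' then
    rip L' /\ (L' = [::] \/ exists2 p, p \in L' &
      forall j, j \in L' -> reachD x :&: reachD j \subset reachD p)
  else True.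

Definition cover_of (L : seq {set V}) : {set V} := \bigcup_(x <- L) reachD x.

(* A bag that adds no new vertex can be dropped, so few bags suffice. *)
Lemma rip_reduce L : rip L -> exists L', [/\ rip L',
  size L' <= #|cover_of L'|.+1, {subset L' <= L}
  & forall x, x \in L -> exists2 y, y \in L' & reachD x \subset reachD y].
Proof.
elim: L => [|x L IH] /=; first by move=> _; exists [::].
move=> [rL xL]; have [L' [rL' sz sub cov]] := IH rL.
case: xL => [E|[p pL hp]].
  (* The first bag is kept even if it reaches nothing, whence the successor in the bound on the
     size. *)
  exists [:: x]; subst L; split=> //=; first by split=> //; left.
  by move=> y yx; exists y.
have [p' p'L pp'] := cov p pL.
have [xp'|xp'] := boolP (reachD x \subset reachD p').
  exists L'; split=> //; first by move=> y /sub yL; rewrite inE yL orbT.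
  move=> y; rewrite inE => /predU1P [->|/cov //].
  by exists p'.
have h j : j \in L' -> reachD x :&: reachD j \subset reachD p'.
  by move=> /sub /hp s; apply: subset_trans s pp'.
exists (x :: L'); split=> /=.
- by split=> //; right; exists p'.
- rewrite ltnS; apply: leq_trans sz _.
  rewrite /cover_of big_cons; apply: proper_card; apply/properP.
  split; first exact: subsetUr.
  (* A vertex reached from x but not from p' is reached from no bag of L', since x meets them only
     inside p'. *)
  have /subsetPn [v vx vp'] := xp'; exists v; first by rewrite inE vx.
  apply/negP; rewrite /cover_of bigcup_seq => /bigcupP [j jL vj].
  by case/negP: vp'; apply: (subsetP (h j jL)); rewrite inE vx.
- by move=> y; rewrite !inE => /predU1P [->|/sub ->]; rewrite ?eqxx ?orbT.
- move=> y; rewrite inE => /predU1P [->|/cov [z zL yz]].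
    by exists x => //; rewrite inE eqxx.
  by exists z => //; rewrite inE zL orbT.
Qed.

Lemma rip_nth L i : rip L -> 0 < i < size L -> exists2 p, p < i &
  forall j, j < i -> reachD (nth set0 (rev L) i) :&: reachD (nth set0 (rev L) j)
    \subset reachD (nth set0 (rev L) p).
Proof.
elim: L => [|x L IH] /=; first by lia.
move=> [rL xL] /andP [i0 iL]; rewrite rev_cons.
have [il|li] := ltnP i (size L).
  have [|p pi hp] := IH rL; first by rewrite i0.
  exists p => // j ji; rewrite !nth_rcons size_rev il (ltn_trans ji il) (ltn_trans pi il).
  exact: hp.
have {iL li} iL : i = size L by lia.
case: xL => [E|[p pL hp]]; first by move: i0; rewrite iL E.
have pr : p \in rev L by rewrite mem_rev.
exists (index p (rev L)); first by rewrite iL -size_rev index_mem.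
move=> j ji; rewrite !nth_rcons size_rev iL ltnn eqxx -iL ji.
rewrite iL -(size_rev L) index_mem pr nth_index //; apply: hp.
by rewrite -mem_rev mem_nth // size_rev -iL.
Qed.

(** The form of decomposition that the program searches for: a sequence of fixed length, without a
    tree, whose running intersection can be tested directly. *)
Definition is_cert (m : nat) (B : nat -> {set V}) : Prop :=
  \bigcup_(i < m) reachD (B i) = setT /\
  forall i, 0 < i < m -> exists2 p, p < i &
    reachD (B i) :&: \bigcup_(j < i) reachD (B j) \subset reachD (B p).

Lemma rip_cert L w : rip L -> (forall v, exists2 x, x \in L & v \in reachD x) ->
  (forall x, x \in L -> #|x| <= w) ->
  exists2 B, is_cert #|V|.+1 B & forall i, #|B i| <= w.
Proof.
move=> /rip_reduce [L' [rL sz sub cov]] all hw.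
have szk : size L' <= #|V|.+1.
  by apply: leq_trans sz _; rewrite ltnS max_card.
exists (nth set0 (rev L')); last first.
  move=> i; have [il|li] := ltnP i (size L'); last by rewrite nth_default ?cards0 ?size_rev.
  by apply: hw; apply: sub; rewrite -mem_rev mem_nth ?size_rev.
split.
  apply/setP => v; rewrite inE; apply/bigcupP.
  have [x /cov [y yL /subsetP xy] /xy vy] := all v.
  have yr : y \in rev L' by rewrite mem_rev.
  have iy : index y (rev L') < #|V|.+1.
    by apply: leq_trans szk; rewrite -size_rev index_mem.
  by exists (Ordinal iy) => //=; rewrite nth_index.
move=> i /andP [i0 im]; have [il|li] := ltnP i (size L'); last first.
  (* Positions beyond the list hold empty bags, which reach nothing and can have any parent. *)
  by exists 0 => //; rewrite nth_default ?size_rev // reachD0 set0I sub0set.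
have [|p pi hp] := @rip_nth L' i rL; first by rewrite i0.
exists p => //; apply/subsetP => v; rewrite inE => /andP [vi /bigcupP [j _ vj]].
by apply: (subsetP (hp j (ltn_ord j))); rewrite inE vi.
Qed.

End Order.

Lemma path_crossing (T : finType) (e : rel T) (S : pred T) a p :
  path e a p -> S a -> ~~ S (last a p) -> exists u v, [/\ S u, ~~ S v & e u v].
Proof.
elim: p a => [|b p IH] a /=; first by move=> _ ->.
move=> /andP [ab pb] Sa; have [Sb|nSb] := boolP (S b); first exact: IH.
by move=> _; exists a, b.
Qed.

Section FromDecomposition.
Variables (V W : finType) (D : rel V) (P : {set W * W}) (pi : V -> W).
Hypothesis pi_surj : forall w, exists v, pi v = w.
Hypothesis connect_pi : forall x y, connect D x y = connect (Defs.arc P) (pi x) (pi y).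
Hypothesis aP : acyclic P.
Variable T : dag_tree_decomposition P.

Let pre (w : W) : V := sval (cid (pi_surj w)).

Lemma preK w : pi (pre w) = w.
Proof. by rewrite /pre; case: cid. Qed.

Let lift (t : node T) : {set V} := pre @: bag t.

Lemma reach_lift t v : (v \in reachD D (lift t)) = (pi v \in reachs P (bag t)).
Proof.
rewrite inE; apply/existsP/bigcupP => [[b /andP [/imsetP [w wt ->]]]|[w wt]].
  by rewrite connect_pi preK => c; exists w => //; rewrite inE.
by rewrite inE => c; exists (pre w); rewrite imset_f //= connect_pi preK.
Qed.

(** A node x outside the current set but adjacent to some u in it is added. Every old j is joined to
    u inside the set, so the path from x to j passes through u, and [bag_path] puts the intersection
    inside bag u. *)
Lemma grow_rip m : m <= #|node T| -> exists s : seq (node T), [/\ uniq s, size s = m,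
  rip D (map lift s) & forall a b, a \in s -> b \in s -> exists p,
    [/\ path (adj (tree T)) a p, last a p = b & {subset p <= s}]].
Proof.
elim: m => [|m IH] mle; first by exists [::].
have [s [us sz rs cs]] := IH (ltnW mle).
have [t ts] : exists t, t \notin s.
  apply/existsP; rewrite -negb_forall; apply/negP => /forallP h.
  have /card_uniqP E := us; move: mle; rewrite -sz -E ltnNge => /negP; apply.
  by apply: subset_leq_card; apply/subsetP => x _; apply: h.
case: s us sz rs cs ts => [|a s] us sz rs cs ts.
  exists [:: Defs.root T]; split=> //=; first by rewrite -sz.
    by split=> //; left.
  move=> x y; rewrite !inE => /eqP -> /eqP ->; exists [::]; split=> //.
have /connectP [q pq tq] := @tree_connected _ _ T a t.
have [|u [x [us' xs ux]]] := path_crossing (S := mem (a :: s)) pq (mem_head _ _).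
  by rewrite -tq.
rewrite -[mem _ _]/(_ \in _) in us'; rewrite -[mem _ _]/(_ \in _) in xs.
set s1 := a :: s in us sz rs cs ts us' xs *.
have xu : adj (tree T) x u by rewrite adj_sym.
exists (x :: s1); split.
- by rewrite cons_uniq xs.
- by rewrite -sz.
- split=> //; right; exists (lift u); first exact: map_f.
  move=> _ /mapP [j js ->].
  have [p [pp lp sp]] := cs u j us' js.
  (* [bag_path] speaks of paths without repetitions; x stays off the shortened path because that
     lies in the old set. *)
  case: (shortenP pp) lp => p' pp' up' sub' lp.
  have upath : uniq (x :: u :: p').
    rewrite cons_uniq up' andbT inE negb_or; apply/andP; split.
      by apply: contraNneq xs => ->.
    by apply: contraNN xs => /sub' /sp.
  have := @bag_path _ _ T x (u :: p') _ upath u _.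
  rewrite /= xu pp' lp inE mem_head orbT => /(_ isT isT) /subsetP h.
  apply/subsetP => v; rewrite inE !reach_lift => /andP [vx vj].
  by apply: h; rewrite inE vx.
- have toall b : b \in s1 -> exists p, [/\ path (adj (tree T)) x p, last x p = b
      & {subset p <= x :: s1}].
    move=> bs; have [p [pp lp sp]] := cs u b us' bs.
    exists (u :: p); rewrite /= xu; split=> // z.
    by rewrite inE => /predU1P [->|/sp zs]; rewrite inE ?us' ?zs orbT.
  have fromall b : b \in s1 -> exists p, [/\ path (adj (tree T)) b p, last b p = x
      & {subset p <= x :: s1}].
    move=> bs; have [p [pp lp sp]] := cs b u bs us'.
    exists (rcons p x); rewrite rcons_path lp ux pp last_rcons; split=> // z.
    by rewrite mem_rcons inE => /predU1P [->|/sp zs]; rewrite inE ?eqxx ?zs ?orbT.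
  move=> b c; rewrite [b \in _]inE [c \in _]inE => /predU1P [->|bs] /predU1P [->|cs'].
  + by exists [::].
  + exact: toall.
  + exact: fromall.
  + have [p [pp lp sp]] := cs b c bs cs'; exists p; split=> // z /sp zs.
    by rewrite inE zs orbT.
Qed.

Lemma decomposition_cert :
  exists2 B, is_cert D #|V|.+1 B & forall i, #|B i| <= width T.
Proof.
have [s [us sz rs _]] := grow_rip (leqnn _).
have alls t : t \in s.
  have /card_uniqP E := us; have : [set x in s] == setT.
    by rewrite eqEcard subsetT cardsT -sz -E cardsE /=.
  by move/eqP/setP/(_ t); rewrite !inE.
apply: (rip_cert rs).
  move=> v; have [u us' uv] := source_above (pi v) aP.
  have : u \in \bigcup_t bag (d:=T) t by rewrite bag_cover.
  move=> /bigcupP [t _ ut]; exists (lift t); first by apply: map_f; apply: alls.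
  by rewrite reach_lift; apply/bigcupP; exists u => //; rewrite inE.
move=> _ /mapP [t _ ->]; apply: leq_trans (leq_imset_card _ _) _.
by rewrite /width (bigD1 t) //= leq_maxl.
Qed.

End FromDecomposition.

(** Lifts a decomposition along the projection [pi] of a quotient. The identity serves for
    homomorphisms, the projection to classes in the other cases. *)
Lemma treewidth_cert (V W : finType) (D : rel V) (P : {set W * W}) (pi : V -> W) :
  (forall w, exists v, pi v = w) ->
  (forall x y, connect D x y = connect (Defs.arc P) (pi x) (pi y)) ->
  acyclic P ->
  exists2 B, is_cert D #|V|.+1 B & forall i, #|B i| <= dag_treewidth P.
Proof.
move=> surj conn aP; rewrite /dag_treewidth; case: ex_minnP => w /asboolP [T <-] _.
exact: decomposition_cert surj conn aP T.
Qed.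

(** * Automorphisms and copies *)

Section Copies.
Variables (V W : finType) (H : sgraph V) (G : sgraph W).

Definition auts : {set {ffun V -> V}} :=
  [set s : {ffun V -> V} | injectiveb s &&
    [forall u, forall v, adj H u v == adj H (s u) (s v)]].

Definition ihom (phi : {ffun V -> W}) : bool :=
  injectiveb phi && [forall u, forall v, adj H u v ==> adj G (phi u) (phi v)].

Definition iemb (phi : {ffun V -> W}) : bool :=
  injectiveb phi && [forall u, forall v, adj H u v == adj G (phi u) (phi v)].

Definition fcomp_map (phi : {ffun V -> W}) (s : {ffun V -> V}) : {ffun V -> W} :=
  [ffun v => phi (s v)].

Lemma auts_gt0 : 0 < #|auts|.
Proof.
apply/card_gt0P; exists [ffun v => v]; rewrite inE; apply/andP; split.
  by apply/injectiveP => x y; rewrite !ffunE.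
by apply/'forall_forallP => x y; rewrite !ffunE.
Qed.

(** The fibres of f on A are orbits of the automorphisms, which act freely because the maps in A are
    injective; so each fibre has as many elements as there are automorphisms. *)
Lemma card_orbits (T : finType) (A : {set {ffun V -> W}}) (f : {ffun V -> W} -> T) :
  (forall phi, phi \in A -> injective phi) ->
  (forall phi0 phi, phi0 \in A -> reflect (exists2 s, s \in auts & phi = fcomp_map phi0 s)
     ((phi \in A) && (f phi == f phi0))) ->
  #|A| = #|f @: A| * #|auts|.
Proof.
move=> Ainj orb; rewrite -sum1_card (partition_big f (mem (f @: A))) /=; last first.
  by move=> phi pA; apply: imset_f.
rewrite -sum_nat_const; apply: eq_bigr => _ /imsetP [phi0 p0 ->].
rewrite sum1_card -(@card_imset _ _ (fcomp_map phi0)); last first.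
  move=> s t /ffunP E; apply/ffunP => v; have := E v; rewrite !ffunE.
  exact: Ainj.
apply: eq_card => phi; rewrite -[in LHS]topredE /=.
by apply/orb/imsetP => // -[s sa ->]; exists s.
Qed.

Lemma edge_pair (e : {set V}) : e \in edges H -> exists x y, x != y /\ e = [set x; y].
Proof.
by move=> eH; have /forall_inP /(_ _ eH) /cards2P := valP H.
Qed.

Lemma mem_image_edges (phi : {ffun V -> W}) u v : injective phi ->
  ([set phi u; phi v] \in [set phi @: (e : {set V}) | e in edges H]) = adj H u v.
Proof.
move=> ip; apply/imsetP/idP => [[e eH E]|h]; last first.
  by exists [set u; v]; rewrite // imsetU !imset_set1.
suff E' : e = [set u; v] by rewrite /adj -E'.
by apply: (imset_inj ip); rewrite -E imsetU !imset_set1.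
Qed.

Lemma ffun_factor (phi0 phi : {ffun V -> W}) : injective phi0 -> injective phi ->
  phi @: [set: V] = phi0 @: [set: V] ->
  exists2 s : {ffun V -> V}, injective s & phi = fcomp_map phi0 s.
Proof.
move=> i0 i1 E.
have h u : exists x, phi0 x == phi u.
  have : phi u \in phi @: [set: V] by apply: imset_f.
  by rewrite E => /imsetP [x _ ->]; exists x.
pose s := [ffun u => xchoose (h u)].
have sE u : phi0 (s u) = phi u by rewrite ffunE; apply/eqP/(xchooseP (h u)).
exists s; last by apply/ffunP => u; rewrite ffunE sE.
by move=> u v /(congr1 phi0); rewrite !sE => /i1.
Qed.

Lemma aut_image s : s \in auts -> s @: [set: V] = [set: V].
Proof.
rewrite inE => /andP [/injectiveP si _]; apply/eqP.
by rewrite eqEcard subsetT (card_imset _ si) leqnn.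
Qed.

Lemma comp_image phi0 s : s \in auts -> fcomp_map phi0 s @: [set: V] = phi0 @: [set: V].
Proof.
move=> sa; rewrite -{2}(aut_image sa) -imset_comp; apply: eq_imset => v.
by rewrite ffunE.
Qed.

Lemma comp_inj (phi0 : {ffun V -> W}) s : injective phi0 -> s \in auts -> injective (fcomp_map phi0 s).
Proof.
move=> i0; rewrite inE => /andP [/injectiveP si _] x y; rewrite !ffunE.
by move=> /i0 /si.
Qed.

Lemma count_induced : #|[set phi | iemb phi]| = ind H G * #|auts|.
Proof.
pose f (phi : {ffun V -> W}) := phi @: [set: V].
have inj phi : phi \in [set phi | iemb phi] -> injective phi.
  by rewrite inE => /andP [/injectiveP].
rewrite (@card_orbits _ _ f) //.
  congr (_ * _); rewrite /ind; apply: eq_card => U; rewrite !inE.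
  apply/imsetP/existsP => [[phi]|[phi /and3P [ip /eqP -> he]]].
    rewrite inE => /andP [ip he] ->; exists phi; by rewrite ip he eqxx.
  by exists phi; rewrite // inE; apply/andP.
move=> phi0 phi p0; have i0 := inj _ p0; move: p0; rewrite inE => /andP [_ h0].
apply: (iffP andP) => [[pA /eqP fE]|[s sa ->]].
  have ip := inj _ pA; move: pA; rewrite inE => /andP [_ h1].
  have [s si E] := ffun_factor i0 ip fE; exists s => //.
  rewrite inE; apply/andP; split; first exact/injectiveP.
  apply/'forall_forallP => u v.
  have /'forall_forallP /(_ u v) /eqP -> := h1; rewrite E !ffunE.
  by have /'forall_forallP /(_ (s u) (s v)) /eqP -> := h0.
split; last by rewrite /f comp_image.
rewrite inE; apply/andP; split; first by apply/injectiveP/comp_inj.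
apply/'forall_forallP => u v; rewrite !ffunE.
have /'forall_forallP /(_ (s u) (s v)) /eqP <- := h0.
by move: sa; rewrite inE => /andP [_ /'forall_forallP].
Qed.

Lemma count_copies : #|[set phi | ihom phi]| = sub H G * #|auts|.
Proof.
pose f (phi : {ffun V -> W}) := (phi @: [set: V], [set phi @: (e : {set V}) | e in edges H]).
have inj phi : phi \in [set phi | ihom phi] -> injective phi.
  by rewrite inE => /andP [/injectiveP].
have homE (phi : {ffun V -> W}) : injective phi ->
    ([set phi @: (e : {set V}) | e in edges H] \subset edges G) =
    [forall u, forall v, adj H u v ==> adj G (phi u) (phi v)].
  move=> ip; apply/subsetP/'forall_forallP => [h u v|h _ /imsetP [e eH ->]].
    by apply/implyP => a; apply: h; rewrite mem_image_edges.
  have [x [y [xy E]]] := edge_pair eH; subst e.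
  by rewrite imsetU !imset_set1; apply: (implyP (h x y)); apply: eH.
rewrite (@card_orbits _ _ f) //.
  congr (_ * _); rewrite /Defs.sub; apply: eq_card => -[U F]; rewrite !inE /=.
  apply/imsetP/andP => [[phi]|[FG /existsP [phi /and3P [/injectiveP ip /eqP UE /eqP FE]]]].
    rewrite inE => /andP [/injectiveP ip he] [-> ->]; rewrite homE //; split=> //.
    by apply/existsP; exists phi; apply/and3P; split=> //; apply/injectiveP.
  exists phi; last by rewrite UE FE.
  by rewrite inE; apply/andP; split; [apply/injectiveP | rewrite -homE // -FE].
move=> phi0 phi p0; have i0 := inj _ p0; move: p0; rewrite inE => /andP [_ h0].
apply: (iffP andP) => [[pA /eqP [fE FE]]|[s sa ->]].
  have ip := inj _ pA; move: pA; rewrite inE => /andP [_ h1].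
  have [s si E] := ffun_factor i0 ip fE; exists s => //.
  rewrite inE; apply/andP; split; first exact/injectiveP.
  apply/'forall_forallP => u v; rewrite -(mem_image_edges _ _ ip) FE E !ffunE.
  by rewrite mem_image_edges.
have sE u v : adj H (s u) (s v) = adj H u v.
  by move: sa; rewrite inE => /andP [_ /'forall_forallP /(_ u v) /eqP].
have si : injective s by move: sa; rewrite inE => /andP [/injectiveP].
split.
  rewrite inE; apply/andP; split; first by apply/injectiveP/comp_inj.
  apply/'forall_forallP => u v; rewrite !ffunE -sE.
  exact: (('forall_forallP h0) (s u) (s v)).
rewrite /f comp_image // xpair_eqE eqxx /=.
have ic := comp_inj i0 sa; apply/eqP.
(* An automorphism sends edges to edges injectively, hence permutes the finite set of edges. *)
have sEd : [set s @: (e : {set V}) | e in edges H] = edges H.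
  apply/eqP; rewrite eqEcard card_imset ?leqnn ?andbT; last exact: imset_inj.
  apply/subsetP => _ /imsetP [e eH ->]; have [x [y [xy E]]] := edge_pair eH.
  by rewrite E imsetU !imset_set1 -[_ \in _]/(adj H (s x) (s y)) sE /adj -E.
rewrite -{2}sEd -imset_comp; apply: eq_imset => e /=.
by rewrite -imset_comp; apply: eq_imset => v; rewrite /= ffunE.
Qed.

End Copies.

(** * Orientations with identifications *)

Section Queries.
Variables (k : nat) (H : sgraph 'I_k).
Implicit Types (O S : {set 'I_k * 'I_k}).

(** Identified nodes are joined in both directions, so reachability here is reachability in the
    quotient. *)
Definition stepOS O S : rel 'I_k :=
  fun x y => [|| (x, y) \in O, (x, y) \in S | (y, x) \in S].

(* Mode 0 asks for homomorphisms, 1 for injective ones, 2 for embeddings as induced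
   subgraphs. *)
Definition okOS (mode : nat) O S : bool :=
  [forall x, forall y, [&& ((x, y) \in O) ==> ~~ connect (stepOS O S) y x,
     adj H x y ==> ((x, y) \in O) || ((y, x) \in O),
     (mode < 2) ==> ((x, y) \in O) ==> adj H x y
   & ((x, y) \in S) ==> (x < y) && (0 < mode)]].

Definition adjset : {set 'I_k * 'I_k} := [set p | adj H p.1 p.2].

(** The sign of inclusion-exclusion: a factor -1 for every identified pair and for every arc of O on
    a non-edge of H. *)
Definition oddOS O S : bool := odd (#|S| + #|O :\: adjset|).

Section Count.
Variables (n : nat) (G : sgraph 'I_n) (out : rel 'I_n) (rank : 'I_n -> nat).
Hypothesis out_adj : forall u v, adj G u v = out u v || out v u.
Hypothesis out_rank : forall u v, out u v -> rank u < rank v.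

Definition satOS O S (phi : {ffun 'I_k -> 'I_n}) : bool :=
  [forall x, forall y, (((x, y) \in O) ==> out (phi x) (phi y)) &&
                       (((x, y) \in S) ==> (phi x == phi y))].

Definition good (mode : nat) (phi : {ffun 'I_k -> 'I_n}) : bool :=
  if mode is 0 then [forall u, forall v, adj H u v ==> adj G (phi u) (phi v)]
  else if mode is 1 then ihom H G phi else iemb H G phi.

(** Once some map satisfies the pair, acyclicity is automatic: ranks of images increase strictly
    along O and are constant along S. *)
Lemma okOS_sat mode O S phi : satOS O S phi ->
  okOS mode O S = [forall x, forall y, [&&
     adj H x y ==> ((x, y) \in O) || ((y, x) \in O),
     (mode < 2) ==> ((x, y) \in O) ==> adj H x y
   & ((x, y) \in S) ==> (x < y) && (0 < mode)]].
Proof.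
move=> /'forall_forallP sat; apply: eq_forallb => x; apply: eq_forallb => y.
suff -> : ((x, y) \in O) ==> ~~ connect (stepOS O S) y x by [].
apply/implyP => xy; apply/negP => /connectP [p pp xE].
have : rank (phi x) < rank (phi y).
  by apply: out_rank; have /andP [/implyP h _] := sat x y; apply: h.
rewrite xE ltnNge => /negP; apply.
elim: p y pp {xy xE} => //= z p IH y /andP [yz pz].
apply: leq_trans (IH z pz); have /andP [h1 h2] := sat y z; have /andP [_ h3] := sat z y.
case/or3P: yz => h; first by rewrite ltnW // out_rank // (implyP h1).
  by rewrite (eqP (implyP h2 h)).
by rewrite (eqP (implyP h3 h)).
Qed.

Definition tog (e : 'I_k * 'I_k) (A : {set 'I_k * 'I_k}) :=
  if e \in A then A :\ e else e |: A.

Lemma in_tog e A x : (x \in tog e A) = (x \in A) (+) (x == e).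
Proof.
rewrite /tog; case: ifP => eA; rewrite !inE; case: eqP => [->|_] //=;
  by rewrite ?eA ?addbF ?addbT.
Qed.

Lemma togK e : involutive (tog e).
Proof. by move=> A; apply/setP => x; rewrite !in_tog -addbA addbb addbF. Qed.

Lemma odd_tog e A : odd #|tog e A| = ~~ odd #|A|.
Proof.
rewrite /tog; case: ifP => eA; last by rewrite cardsU1 eA.
by rewrite (cardsD1 e A) eA /= negbK.
Qed.

(* Toggling an identified pair, or a non-edge of H sent to an edge, is a
   sign-reversing involution, available unless phi is good. *)
Lemma signed_count mode (phi : {ffun 'I_k -> 'I_n}) : mode < 3 ->
  #|[set p | [&& okOS mode p.1 p.2, ~~ oddOS p.1 p.2 & satOS p.1 p.2 phi]]| =
  #|[set p | [&& okOS mode p.1 p.2, oddOS p.1 p.2 & satOS p.1 p.2 phi]]|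
    + good mode phi.
Proof.
move=> m3.
pose A := [set p : 'I_k * 'I_k | out (phi p.1) (phi p.2)].
pose Z := [set p : 'I_k * 'I_k | [&& p.1 < p.2, phi p.1 == phi p.2 & 0 < mode]].
have antiA x y : (x, y) \in A -> (y, x) \in A -> false.
  by rewrite !inE /= => /out_rank h1 /out_rank h2; lia.
pose ishom := [forall u, forall v, adj H u v ==> adj G (phi u) (phi v)].
(* For fixed [phi] the contributing pairs form a box: O contains all edges of H as directed by [phi]
   and perhaps, in mode 2, some non-edges sent to arcs; S is any set of pairs that [phi]
   identifies. *)
pose Q (p : {set 'I_k * 'I_k} * {set 'I_k * 'I_k}) := [&& ishom,
  A :&: adjset \subset p.1, p.1 \subset (if mode < 2 then A :&: adjset else A)
  & p.2 \subset Z].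
have QE p : okOS mode p.1 p.2 && satOS p.1 p.2 phi = Q p.
  case: p => O S /=; apply/andP/and4P => [[ok sat]|[hom1 AO OA SZ]].
    move: (ok); rewrite (okOS_sat mode sat) => /'forall_forallP okk.
    move/'forall_forallP: (sat) => satt.
    have OA : O \subset A.
      by apply/subsetP => -[x y] xy; rewrite inE /=; have /andP [/implyP ->] := satt x y.
    split.
    - apply/'forall_forallP => x y; apply/implyP => a.
      have /and3P [/implyP /(_ a) + _ _] := okk x y.
      move=> /orP [] xy; rewrite out_adj.
        by have /andP [/implyP -> //] := satt x y.
      by have /andP [/implyP ->] := satt y x; rewrite ?orbT.
    - apply/subsetP => -[x y]; rewrite inE [_ \in adjset]inE /= => /andP [xyA a].
      have /and3P [/implyP /(_ a) + _ _] := okk x y.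
      case/orP => // /(subsetP OA) yxA; by have := antiA _ _ xyA yxA.
    - case: ifP => m2 //; rewrite subsetI OA /=; apply/subsetP => -[x y] xy.
      rewrite inE /=; have /and3P [_ + _] := okk x y.
      by rewrite m2 xy.
    - apply/subsetP => -[x y] xy; rewrite inE /=.
      have /and3P [_ _] := okk x y; rewrite xy /= => /andP [-> ->].
      by have /andP [_ /implyP ->] := satt x y.
  have OA' : O \subset A by apply: subset_trans OA _; case: ifP => // _; apply: subsetIl.
  have sat : satOS O S phi.
    apply/'forall_forallP => x y; apply/andP; split; apply/implyP => h.
      by have := subsetP OA' _ h; rewrite inE.
    by have := subsetP SZ _ h; rewrite inE => /and3P [].
  split=> //; rewrite (okOS_sat mode sat); apply/'forall_forallP => x y.
  apply/and3P; split.
  - apply/implyP => a; have := ('forall_forallP hom1) x y; rewrite a out_adj /=.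
    have a' : adj H y x by rewrite adj_sym.
    by case/orP => o; apply/orP; [left|right]; apply: (subsetP AO); rewrite !inE /= o.
  - apply/implyP => m2; apply/implyP => h; move: OA; rewrite m2 => /subsetP /(_ _ h).
    by rewrite !inE => /andP [].
  - by apply/implyP => /(subsetP SZ); rewrite inE => /and3P [-> _ ->].
have setE (b : bool) : #|[set p | [&& okOS mode p.1 p.2, oddOS p.1 p.2 == b & satOS p.1 p.2 phi]]|
    = #|[set p | Q p && (oddOS p.1 p.2 == b)]|.
  by apply: eq_card => p; rewrite !inE -QE andbAC andbA.
have -> : #|[set p | [&& okOS mode p.1 p.2, ~~ oddOS p.1 p.2 & satOS p.1 p.2 phi]]|
    = #|[set p | Q p && (oddOS p.1 p.2 == false)]|.
  by rewrite -setE; apply: eq_card => p; rewrite !inE; case: oddOS.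
have -> : #|[set p | [&& okOS mode p.1 p.2, oddOS p.1 p.2 & satOS p.1 p.2 phi]]|
    = #|[set p | Q p && (oddOS p.1 p.2 == true)]|.
  by rewrite -setE; apply: eq_card => p; rewrite !inE; case: oddOS.
have toggle (f : {set 'I_k * 'I_k} * {set 'I_k * 'I_k} -> {set 'I_k * 'I_k} * {set 'I_k * 'I_k}) :
    involutive f -> (forall p, Q p -> Q (f p)) ->
    (forall p, oddOS (f p).1 (f p).2 = ~~ oddOS p.1 p.2) ->
    #|[set p | Q p && (oddOS p.1 p.2 == false)]| = #|[set p | Q p && (oddOS p.1 p.2 == true)]|.
  move=> fK fQ fo; rewrite -(card_imset _ (inv_inj fK)); apply: eq_card => p.
  have QfE q : Q (f q) = Q q by apply/idP/idP => [/fQ|/fQ //]; rewrite fK.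
  apply/imsetP/idP => [[q]|].
    by rewrite !inE => /andP [qq /eqP o] ->; rewrite QfE qq fo o.
  by rewrite inE => /andP [qq /eqP o]; exists (f p); rewrite ?fK // inE QfE qq fo o.
(* No pair contributes unless [phi] is a homomorphism. *)
have [hm|nh] := boolP ishom; last first.
  have g0 : good mode phi = false.
    apply/negP; rewrite /good; case: mode m3 {Z Q QE setE toggle} => [|[|_]] _.
    - exact/negP.
    - by move=> /andP [_]; apply/negP.
    - move=> /andP [_ /'forall_forallP h]; case/negP: nh; apply/'forall_forallP => u v.
      by rewrite (eqP (h u v)) implybb.
  rewrite g0 addn0.
  by rewrite !eq_card0 // => p; rewrite !inE /Q (negbTE nh).
(* A map that identifies a pair s is cancelled by toggling s in S. *)
have [Z0|[s sZ]] := set_0Vmem Z; last first.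
  have -> : good mode phi = false.
    apply/negP; rewrite /good; move: sZ; rewrite inE.
    case: mode m3 {Z Q QE setE toggle} => [|m] m3; first by rewrite !andbF.
    move=> /and3P [ss /eqP E _] g.
    have : injectiveb phi by case: m {m3} g => [|m] /andP [].
    by move=> /injectiveP /(_ _ _ E) sE; rewrite sE ltnn in ss.
  rewrite addn0; apply: (toggle (fun p => (p.1, tog s p.2))).
  - by case=> O S /=; rewrite togK.
  - move=> [O S] /and4P [h1 h2 h3 h4]; apply/and4P; split=> //=.
    apply/subsetP => x; rewrite in_tog; case: eqP => [->//|_]; rewrite addbF.
    exact: (subsetP h4).
  - by move=> [O S]; rewrite /oddOS /= !oddD odd_tog; do 2 case: odd.
(* In mode 2, a map that sends a non-edge e to an arc is cancelled by toggling e in O. *)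
have [AE|[e eA]] := set_0Vmem (if mode < 2 then set0 else A :\: adjset); last first.
  have m2 : (mode < 2) = false by move: eA; case: ifP => //; rewrite inE.
  rewrite m2 inE in eA; have /andP [enE eA'] := eA.
  have -> : good mode phi = false.
    apply/negP; rewrite /good; case: mode m2 m3 {Z Q QE setE toggle Z0 eA} => [|[|m]] // _ _.
    move=> /andP [_ /'forall_forallP /(_ e.1 e.2) /eqP E].
    by move: enE; rewrite inE E out_adj; move: eA'; rewrite inE => ->.
  rewrite addn0; apply: (toggle (fun p => (tog e p.1, p.2))).
  - by case=> O S /=; rewrite togK.
  - move=> [O S]; rewrite /Q m2 /= => /and4P [h1 h2 h3 h4]; apply/and4P; split=> //=.
      apply/subsetP => x xA; rewrite in_tog (subsetP h2) //; case: eqP => // xe.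
      by move: xA; rewrite xe inE (negbTE enE) andbF.
    apply/subsetP => x; rewrite in_tog; case: eqP => [->//|_]; rewrite addbF.
    exact: (subsetP h3).
  - move=> [O S]; rewrite /oddOS /= !oddD.
    have -> : tog e O :\: adjset = tog e (O :\: adjset).
      apply/setP => x; rewrite in_setD !in_tog in_setD; case: eqP => [->|_]; last by rewrite !addbF.
      by rewrite enE /=.
    by rewrite odd_tog; do 2 case: odd.
have YE : (if mode < 2 then A :&: adjset else A) = A :&: adjset.
  move: AE; case: ifP => // _ AE; apply/setP => x; rewrite in_setI.
  by have := in_set0 x; rewrite -AE in_setD; case: (x \in A); case: (x \in adjset).
(* For the remaining maps the box is a single pair, with an even sign. *)
have uniqQ p : Q p = (p == (A :&: adjset, set0)).
  case: p => O S; rewrite /Q hm YE Z0 /= xpair_eqE subset0 [O == _]eqEsubset andbA.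
  by rewrite [(_ \subset O) && _]andbC.
have o0 : oddOS (A :&: adjset) set0 = false.
  by rewrite /oddOS cards0 setDE -setIA setICr setI0 cards0.
have -> : good mode phi.
  have zin : 0 < mode -> injectiveb phi.
    move=> m0; apply/injectiveP => x y E; apply: val_inj => /=.
    have Zn (u v : 'I_k) : u < v -> phi u == phi v -> false.
      by move=> h1 h2; have := in_set0 (u, v); rewrite -Z0 inE h1 h2 m0.
    by case: (ltngtP x y) => // h; [have := Zn x y h | have := Zn y x h]; rewrite E eqxx => /(_ isT).
  rewrite /good; case: mode m3 AE zin {Z Q QE setE toggle Z0 YE uniqQ} => [|[|m]] m3 AE zin //.
    by rewrite /ihom zin.
  rewrite /iemb zin //=; apply/'forall_forallP => u v; apply/eqP; apply/idP/idP.
    exact/implyP/('forall_forallP hm u v).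
  have inA x y : out (phi x) (phi y) -> adj H x y.
    move=> o; have := in_set0 (x, y); rewrite -AE !inE /= o andbT.
    by move/negbT; rewrite negbK.
  by rewrite out_adj => /orP [/inA|/inA] //; rewrite adj_sym.
rewrite addn1 (_ : [set p | _ && (_ == true)] = set0); last first.
  by apply/setP => p; rewrite !inE uniqQ; case: eqP => // ->; rewrite o0.
rewrite cards0 (_ : [set p | _ && _] = [set (A :&: adjset, set0)]) ?cards1 //.
by apply/setP => p; rewrite !inE uniqQ; case: eqP => // ->; rewrite o0.
Qed.

Definition countOS O S : nat := #|[set phi | satOS O S phi]|.

(** The signed sum is stated in natural numbers, with the odd terms on the other side; it comes from
    summing [signed_count] over all maps. *)
Lemma count_queries mode : mode < 3 ->
  \sum_(p | okOS mode p.1 p.2 && ~~ oddOS p.1 p.2) countOS p.1 p.2 =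
  \sum_(p | okOS mode p.1 p.2 && oddOS p.1 p.2) countOS p.1 p.2
    + #|[set phi | good mode phi]|.
Proof.
move=> m3.
have ex (P : pred ({set 'I_k * 'I_k} * {set 'I_k * 'I_k})) :
    \sum_(p | P p) countOS p.1 p.2 =
    \sum_(phi : {ffun 'I_k -> 'I_n}) #|[set p | P p && satOS p.1 p.2 phi]|.
  under eq_bigr do rewrite /countOS -sum1dep_card.
  rewrite (exchange_big_dep predT) //=; apply: eq_bigr => phi _.
  by rewrite sum1dep_card.
have -> : #|[set phi | good mode phi]| = \sum_phi good mode phi.
  by rewrite -sum1dep_card big_mkcond; apply: eq_bigr => phi _; case: good.
rewrite !ex -big_split /=.
apply: eq_bigr => phi _.
transitivity (#|[set p | [&& okOS mode p.1 p.2, ~~ oddOS p.1 p.2 & satOS p.1 p.2 phi]]|).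
  by apply: eq_card => p; rewrite !inE andbA.
rewrite signed_count //; congr (_ + _).
by apply: eq_card => p; rewrite !inE andbA.
Qed.

End Count.

End Queries.

(** * The dag behind a query and its width *)

Section Widths.
Variables (k : nat) (H : sgraph 'I_k) (O S : {set 'I_k * 'I_k}).

Let D := stepOS O S.
Hypothesis O_acyclic : forall x y, (x, y) \in O -> ~~ connect D y x.

Lemma acyclic_cert w : S = set0 ->
  (forall P, acyclic_orientation H P -> dag_treewidth P <= w) ->
  (forall x y, adj H x y = ((x, y) \in O) || ((y, x) \in O)) ->
  exists2 B, is_cert D k.+1 B & forall i, #|B i| <= w.
Proof.
move=> S0 hw adjO.
have DO : connect D =2 connect (Defs.arc O).
  by apply: eq_connect => x y; rewrite /D /stepOS S0 !inE !orbF.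
have aO : acyclic O.
  by apply/'forall_forallP => x y; apply/implyP => h; rewrite -DO; apply: O_acyclic.
have oO : acyclic_orientation H O.
  rewrite /acyclic_orientation aO andbT; apply/'forall_forallP => x y.
  rewrite adjO eqxx /=; apply/negP => /andP [xy yx].
  by have := O_acyclic xy; rewrite (connect1 _) // /D /stepOS -[_ \in O]/(Defs.arc O y x) yx.
have [B cB wB] := treewidth_cert (D := D) (pi := id) (fun w => ex_intro _ w erefl) DO aO.
exists B; first by rewrite card_ord in cB.
by move=> i; apply: leq_trans (wB i) (hw _ oO).
Qed.

(** S is merely a set of pairs; the quotient is by the equivalence relation that it generates. *)
Let eqS : rel 'I_k := connect (fun x y => ((x, y) \in S) || ((y, x) \in S)).
Let theta : {set 'I_k * 'I_k} := [set p | eqS p.1 p.2].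

Lemma theta_equiv : equivalence_rel (Defs.arc theta).
Proof.
have symS : connect_sym (fun x y => ((x, y) \in S) || ((y, x) \in S)).
  by apply: sym_connect_sym => x y; rewrite orbC.
move=> x y z; rewrite /Defs.arc !inE /eqS /=; split; first exact: connect0.
by move=> xy; apply: same_connect.
Qed.

Local Notation cls := {B : {set 'I_k} | B \in eq_classes theta}.

Lemma cls_mem x : pblock (eq_classes theta) x \in eq_classes theta.
Proof.
have /and3P [/eqP cov _ _] : partition (eq_classes theta) [set: 'I_k].
  by apply: equivalence_partitionP => x' y z _ _ _; apply: theta_equiv.
by apply: pblock_mem; rewrite cov inE.
Qed.

Let pi (x : 'I_k) : cls := Sub (pblock (eq_classes theta) x) (cls_mem x).

Lemma mem_pi x y : (y \in val (pi x)) = eqS x y.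
Proof.
rewrite /= pblock_equivalence_partition //; first by rewrite /Defs.arc inE.
by move=> x' y' z _ _ _; apply: theta_equiv.
Qed.

Lemma eqS_pi x y : eqS x y -> pi x = pi y.
Proof.
move=> xy; apply: val_inj; apply/setP => z; rewrite !mem_pi.
have := theta_equiv x y z; rewrite /Defs.arc !inE /= => -[_]; exact.
Qed.

Lemma pi_surj (A : cls) x : x \in val A -> pi x = A.
Proof.
move=> xA; apply: val_inj => /=.
have /and3P [_ tr _] : partition (eq_classes theta) [set: 'I_k].
  by apply: equivalence_partitionP => x' y z _ _ _; apply: theta_equiv.
exact: def_pblock tr (valP A) xA.
Qed.

Lemma cls_pick (A : cls) : exists x, x \in val A.
Proof.
have /and3P [_ _ n0] : partition (eq_classes theta) [set: 'I_k].
  by apply: equivalence_partitionP => x' y z _ _ _; apply: theta_equiv.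
apply/set0Pn; apply: contraNneq n0 => <-; exact: (valP A).
Qed.

Let P : {set cls * cls} :=
  [set p : cls * cls | [exists x in val p.1, exists y in val p.2, (x, y) \in O]].

Lemma PP (A B : cls) : reflect (exists x y, [/\ pi x = A, pi y = B & (x, y) \in O])
  (Defs.arc P A B).
Proof.
rewrite /Defs.arc inE; apply: (iffP existsP).
  move=> [x /andP [xA /existsP [y /andP [yB xy]]]]; exists x, y.
  by split=> //; apply: pi_surj.
move=> [x [y [<- <- xy]]]; exists x; rewrite mem_pi /eqS connect0.
by apply/existsP; exists y; rewrite mem_pi /eqS connect0.
Qed.

Lemma eqS_D x y : eqS x y -> connect D x y.
Proof.
apply: connect_sub => a b h; apply: connect1; rewrite /D /stepOS.
by case/orP: h => ->; rewrite ?orbT.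
Qed.

Lemma pi_eqS x y : pi x = pi y -> eqS x y.
Proof. by move=> E; rewrite -mem_pi E mem_pi /eqS connect0. Qed.

Lemma connect_pi x y : connect D x y = connect (Defs.arc P) (pi x) (pi y).
Proof.
apply/idP/idP => /connectP [p pp E].
  elim: p x pp E => [|z p IH] x /=; first by move=> _ ->.
  move=> /andP [xz pz] E; apply: connect_trans (IH z pz E).
  case/or3P: xz => h; first by apply: connect1; apply/PP; exists x, z.
    by rewrite (@eqS_pi x z) //; apply: connect1; rewrite /= h.
  by rewrite (@eqS_pi x z) //; apply: connect1; rewrite /= h orbT.
elim: p x pp E => [|C p IH] x /=; first by move=> _ /esym /pi_eqS /eqS_D.
move=> /andP [/PP [u [v [ux vC uv]]] pC] E.
apply: connect_trans (eqS_D (pi_eqS (esym ux))) _.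
apply: (@connect_trans _ _ v); first by apply: connect1; rewrite /D /stepOS uv.
by apply: IH; rewrite vC.
Qed.

(** O projects to an acyclic orientation of the quotient: an arc inside a class, or opposite arcs
    between two classes, would close a directed cycle modulo S. So [tau2] bounds the treewidth of
    the projection. *)
Lemma quotient_cert (H' : sgraph 'I_k) :
  (forall x y, adj H' x y = ((x, y) \in O) || ((y, x) \in O)) ->
  exists2 B, is_cert D k.+1 B & forall i, #|B i| <= tau2 H'.
Proof.
move=> adjO.
have aP : acyclic P.
  apply/'forall_forallP => A B; apply/implyP => /PP [x [y [<- <- xy]]].
  by rewrite -connect_pi; apply: O_acyclic.
have adj_quot A B : adj (quotient_graph H' theta) A B =
    (A != B) && (Defs.arc P A B || Defs.arc P B A).
  have mk (A' B' : cls) : A' != B' -> Defs.arc P A' B' || Defs.arc P B' A' ->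
    [exists x in val A', exists y in val B', adj H' x y].
    move=> _ /orP [] /PP [x [y [<- <- xy]]].
      apply/existsP; exists x; rewrite mem_pi /eqS connect0.
      by apply/existsP; exists y; rewrite mem_pi /eqS connect0 adjO xy.
    apply/existsP; exists y; rewrite mem_pi /eqS connect0.
    by apply/existsP; exists x; rewrite mem_pi /eqS connect0 adjO xy orbT.
  have km (A' B' : cls) : [exists x in val A', exists y in val B', adj H' x y] ->
     Defs.arc P A' B' || Defs.arc P B' A'.
    move=> /existsP [x /andP [xA /existsP [y /andP [yB]]]]; rewrite adjO.
    case/orP => h; apply/orP; [left|right]; apply/PP.
      by exists x, y; rewrite !(pi_surj xA, pi_surj yB).
    by exists y, x; rewrite !(pi_surj xA, pi_surj yB).
  apply/imsetP/andP => [[[A' B']]|[nAB ab]].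
    rewrite inE /= => /andP [nAB /km h] E.
    have : A \in [set A'; B'] by rewrite -E !inE eqxx.
    have : B \in [set A'; B'] by rewrite -E !inE eqxx orbT.
    have : (A' \in [set A; B]) && (B' \in [set A; B]) by rewrite E !inE !eqxx orbT.
    rewrite !inE => /andP [/orP [] /eqP E1 /orP [] /eqP E2] _ _; subst A' B'.
    - by rewrite eqxx in nAB.
    - by [].
    - by rewrite eq_sym orbC.
    - by rewrite eqxx in nAB.
  by exists (A, B); rewrite // inE nAB mk.
have oP : acyclic_orientation (quotient_graph H' theta) P.
  rewrite /acyclic_orientation aP andbT; apply/'forall_forallP => A B.
  have anti : ~~ (Defs.arc P A B && Defs.arc P B A).
    apply/negP => /andP [ab ba].
    by have := ('forall_forallP aP) A B; rewrite ab connect1.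
  rewrite anti andbT adj_quot; case: (A =P B) => [E|_] /=; last by rewrite eqxx.
  by move: anti; rewrite E andbb orbb => /negbTE ->.
have [B cB wB] := treewidth_cert (D := D) (pi := pi)
  (fun A => let: ex_intro x xA := cls_pick A in ex_intro _ x (pi_surj xA)) connect_pi aP.
exists B; first by rewrite card_ord in cB.
move=> i; apply: leq_trans (wB i) _.
apply: (@leq_trans (tau1 (quotient_graph H' theta))).
  by rewrite /tau1 (bigD1 P) //= leq_maxl.
rewrite /tau2 (bigD1 theta) /=; first by rewrite leq_maxl.
by apply/asboolP; apply: theta_equiv.
Qed.

End Widths.

Definition taum (mode : nat) (k : nat) (H : sgraph 'I_k) : nat :=
  if mode is 0 then tau1 H else if mode is 1 then tau2 H else tau3 H.

Lemma okOS_cert mode k (H : sgraph 'I_k) O S : okOS H mode O S ->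
  exists2 B, is_cert (stepOS O S) k.+1 B & forall i, #|B i| <= taum mode H.
Proof.
move=> /'forall_forallP ok.
have acy x y : (x, y) \in O -> ~~ connect (stepOS O S) y x.
  by move=> xy; have /and4P [/implyP + _ _ _] := ok x y; apply.
have adjO x y : adj H x y -> ((x, y) \in O) || ((y, x) \in O).
  by move=> xy; have /and4P [_ /implyP + _ _] := ok x y; apply.
have Oadj : mode < 2 -> forall x y, ((x, y) \in O) || ((y, x) \in O) -> adj H x y.
  move=> m2 x y /orP [] h; last rewrite adj_sym.
    by have /and4P [_ _ + _] := ok x y; rewrite m2 h.
  by have /and4P [_ _ + _] := ok y x; rewrite m2 h.
case: mode ok Oadj => [|[|mode]] ok Oadj.
- apply: (@acyclic_cert _ H) => //.
  + apply/setP => -[x y]; rewrite inE; apply/negP => h.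
    by have /and4P [_ _ _] := ok x y; rewrite h /= andbF.
  + by move=> P aP; rewrite /= /tau1 (bigD1 P) //= leq_maxl.
  + by move=> x y; apply/idP/idP; [apply: adjO | apply: Oadj].
- apply: quotient_cert => // x y.
  by apply/idP/idP; [apply: adjO | apply: Oadj].
(* In mode 2 the set O may use non-edges of H; its underlying graph is a supergraph of H, one of
   those in the definition of [tau3]. *)
pose H' := graph_of_rel (Defs.arc O).
have adjH' x y : adj H' x y = ((x, y) \in O) || ((y, x) \in O).
  apply/imsetP/idP => [[[a b]]|h].
    rewrite inE /= => /andP [nab ab] E.
    have nxy : x != y.
      apply/eqP => xy; have := congr1 (fun A : {set 'I_k} => #|A|) E.
      by rewrite !cards2 nab xy eqxx.
    have : (a \in [set x; y]) && (b \in [set x; y]) by rewrite E !inE !eqxx orbT.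
    rewrite !inE => /andP [/orP [] /eqP E1 /orP [] /eqP E2]; subst a b;
      by rewrite ?eqxx // in nab *; rewrite /Defs.arc in ab; rewrite ab ?orbT.
  have nxy a b : (a, b) \in O -> a != b.
    by move=> /acy; apply: contraNneq => ->; apply: connect0.
  case/orP: h => h; first by exists (x, y); rewrite // inE /= (nxy _ _ h).
  by exists (y, x); rewrite ?inE /= ?(nxy _ _ h) // setUC.
have [B cB wB] := quotient_cert acy adjH'.
exists B => // i; apply: leq_trans (wB i) _.
rewrite /= /tau3 (bigD1 H') /=; first by rewrite leq_maxl.
apply/subsetP => e eH; have [x [y [xy E]]] := edge_pair eH; subst e.
by rewrite -[_ \in _]/(adj H' x y) adjH'; apply: adjO.
Qed.

Lemma fev_var st env i : fev st env (Var i) = nth 0 env i. Proof. by []. Qed.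
Lemma fev_cst st env x : fev st env (Cst x) = x. Proof. by []. Qed.
Lemma fev_rd st env a e : fev st env (Rd a e) = st a (fev st env e). Proof. by []. Qed.
Lemma fev_bin st env o a b :
  fev st env (Bin o a b) = binop_fun o (fev st env a) (fev st env b).
Proof. by []. Qed.
Lemma fev_iter st env eb ei es : fev st env (Iter eb ei es) =
  iteri (fev st env eb) (fun j acc => fev st [:: j, acc & env] es) (fev st env ei).
Proof. by []. Qed.
Lemma fev_add st env a b : fev st env (Bin Add a b) = fev st env a + fev st env b.
Proof. by []. Qed.
Lemma fev_sub st env a b : fev st env (Bin Defs.Sub a b) = fev st env a - fev st env b.
Proof. by []. Qed.
Lemma fev_mul st env a b : fev st env (Bin Mul a b) = fev st env a * fev st env b.
Proof. by []. Qed.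
Lemma fev_div st env a b : fev st env (Bin Div a b) = fev st env a %/ fev st env b.
Proof. by []. Qed.

Arguments fev : simpl never.

Ltac fcall := rewrite /fCall1 /fCall2 /fCall3 fev_call ?fev_var ?fev_cst /=.
Definition fevE := (fev_var, fev_cst, fev_rd, fev_add, fev_sub, fev_mul, fev_div).

Section OrdinalForms.
Variables (st : store) (env : seq nat).
Local Notation ev := (fev st env).

Lemma fev_allo eb p b (P : 'I_b -> bool) : ev eb = b ->
  (forall (j : 'I_b) acc, fev st [:: val j, acc & env] p = P j) ->
  ev (fAll eb p) = [forall j, P j].
Proof.
move=> hb h; rewrite (fev_all (P := fun j => oapp P true (insub j)) hb).
  by congr nat_of_bool; apply: eq_forallb => j; rewrite valK.
by move=> j acc jb; rewrite insubT /= -(h _ acc).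
Qed.

Lemma fev_exo eb p b (P : 'I_b -> bool) : ev eb = b ->
  (forall (j : 'I_b) acc, fev st [:: val j, acc & env] p = P j) ->
  ev (fEx eb p) = [exists j, P j].
Proof.
move=> hb h; rewrite (fev_ex (P := fun j => oapp P true (insub j)) hb).
  by congr nat_of_bool; apply: eq_existsb => j; rewrite valK.
by move=> j acc jb; rewrite insubT /= -(h _ acc).
Qed.

Lemma fev_sumo eb e b (F : 'I_b -> nat) : ev eb = b ->
  (forall (j : 'I_b) acc, fev st [:: val j, acc & env] e = F j) ->
  ev (fSum eb e) = \sum_j F j.
Proof.
move=> hb h; rewrite (fev_sum (F := fun j => oapp F 0 (insub j)) hb).
  by apply: eq_bigr => j _; rewrite valK.
by move=> j acc jb; rewrite insubT /= -(h _ acc).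
Qed.

Lemma fev_prodo eb e b (F : 'I_b -> nat) : ev eb = b ->
  (forall (j : 'I_b) acc, fev st [:: val j, acc & env] e = F j) ->
  ev (fProd eb e) = \prod_j F j.
Proof.
move=> hb h; rewrite (fev_prod (F := fun j => oapp F 0 (insub j)) hb).
  by apply: eq_bigr => j _; rewrite valK.
by move=> j acc jb; rewrite insubT /= -(h _ acc).
Qed.

Lemma fev_maxo eb e b (F : 'I_b -> nat) : ev eb = b ->
  (forall (j : 'I_b) acc, fev st [:: val j, acc & env] e = F j) ->
  ev (fMax eb e) = \max_j F j.
Proof.
move=> hb h; rewrite (fev_max (F := fun j => oapp F 0 (insub j)) hb).
  by apply: eq_bigr => j _; rewrite valK.
by move=> j acc jb; rewrite insubT /= -(h _ acc).
Qed.

End OrdinalForms.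

(** * The expressions of the algorithm *)

(* The arrays are 0: input, 1: output, 2: k, 3: the threshold D on the degrees, 4: n,
   5: positions of the adjacency lists of G, 6: ranks, with 0 for the remaining
   nodes, 7: number of remaining nodes, 8: its previous value, 9, 10: temporary,
   11: out-neighbours in rows of D + 1 cells, 12: length of the current row,
   13: tables of the dynamic program.  Nodes of G are shifted by one, as 0 marks an
   empty cell or an undefined image.

   Numbers encode sets by their bits: [q] a query (O, S), [c] a sequence of k + 1
   bags, [C] a set of nodes of H.  The number [z] encodes a candidate on one bag:
   the digits in base [eCW] of its lower part are the walks leading to the nodes of
   H, those in base n of its upper part the images of the nodes of the bag.  A
   definition [dF] is the body of the function called by [eF]. *)
Definition eK := Rd 2 (Cst 0).
Definition eD := Rd 3 (Cst 0).
Definition eN := Rd 4 (Cst 0).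
Definition eK1 := Bin Add eK (Cst 1).
Definition eD1 := Bin Add eD (Cst 1).
Definition ePw a b := fCall2 fPow a b.
Definition dDig := fMod (Bin Div (Var 1) (ePw (Var 0) (Var 2))) (Var 0).
Definition eDig b x i := fCall3 dDig b x i.
Definition eBit x i := eDig (Cst 2) x i.
Definition idx a b := Bin Add (Bin Mul a eK) b.

Definition dO := eBit (Var 0) (idx (Var 1) (Var 2)).
Definition eO q x y := fCall3 dO q x y.
Definition dS := eBit (Var 0) (Bin Add (Bin Mul eK eK) (idx (Var 1) (Var 2))).
Definition eS q x y := fCall3 dS q x y.
Definition dStep := fOr (eO (Var 0) (Var 1) (Var 2))
  (fOr (eS (Var 0) (Var 1) (Var 2)) (eS (Var 0) (Var 2) (Var 1))).
Definition eStep q x y := fCall3 dStep q x y.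
Definition dClosed := fAll eK (fAll eK (fImp
  (fAnd (eBit (Var 5) (Var 2)) (eStep (Var 4) (Var 2) (Var 0))) (eBit (Var 5) (Var 0)))).
Definition eClosed q C := fCall2 dClosed q C.
(* y is reachable from x iff every closed set containing x contains y. *)
Definition dConn := fAll (ePw (Cst 2) eK) (fImp
  (fAnd (eClosed (Var 2) (Var 0)) (eBit (Var 0) (Var 3))) (eBit (Var 0) (Var 4))).
Definition eConn q x y := fCall3 dConn q x y.

(** Skips the lists one by one. It is called only with arguments up to k, for the lists of H and the
    start of G; the positions inside G are tabulated in array 5. *)
Definition dPos := Iter (Var 0) (Cst 1) (Bin Add (Var 1) (Bin Add (Rd 0 (Var 1)) (Cst 1))).
Definition ePos u := fCall1 dPos u.
(** A node of H has at most k neighbours, so the minimum changes no value, but it gives the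
    iteration count the small sort. *)
Definition dHadj := fEx (fMin eK (Rd 0 (ePos (Var 0))))
  (fEq (Rd 0 (Bin Add (ePos (Var 2)) (Bin Add (Var 0) (Cst 1)))) (Var 3)).
Definition eHadj x y := fCall2 dHadj x y.

Definition dOk (mode : nat) := fAll eK (fAll eK (
  fAnd (fImp (eO (Var 4) (Var 2) (Var 0)) (fNot (eConn (Var 4) (Var 0) (Var 2))))
  (fAnd (fImp (eHadj (Var 2) (Var 0)) (fOr (eO (Var 4) (Var 2) (Var 0)) (eO (Var 4) (Var 0) (Var 2))))
  (fAnd (fImp (Cst (mode < 2)) (fImp (eO (Var 4) (Var 2) (Var 0)) (eHadj (Var 2) (Var 0))))
        (fImp (eS (Var 4) (Var 2) (Var 0)) (fAnd (fLt (Var 2) (Var 0)) (Cst (0 < mode)))))))).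
Definition eOk mode q := fCall1 (dOk mode) q.
Definition dExtra := fSum eK (fSum eK (Bin Add (eS (Var 4) (Var 2) (Var 0))
  (fAnd (eO (Var 4) (Var 2) (Var 0)) (fNot (eHadj (Var 2) (Var 0)))))).
Definition dOdd := fMod dExtra (Cst 2).
Definition eOdd q := fCall1 dOdd q.

Definition dB := eBit (Var 0) (idx (Var 1) (Var 2)).
Definition eB c i v := fCall3 dB c i v.
Definition dX := fEx eK (fAnd (eB (Var 3) (Var 4) (Var 0)) (eConn (Var 2) (Var 0) (Var 5))).
Definition eX q c i v := Call dX q c i v.
Definition dU := fEx (Var 2) (eX (Var 2) (Var 3) (Var 0) (Var 5)).
Definition eU q c i v := Call dU q c i v.
Definition eSep q c i v := fAnd (eX q c i v) (eU q c i v).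
Definition dGood := fAll eK (fImp (eSep (Var 2) (Var 3) (Var 4) (Var 0))
  (eX (Var 2) (Var 3) (Var 5) (Var 0))).
Definition eGood q c i p := Call dGood q c i p.
Definition dOkc := fAnd (fAll eK (eU (Var 2) (Var 3) eK1 (Var 0)))
  (fAll eK1 (fOr (fEq (Var 0) (Cst 0))
     (fEx (Var 0) (eGood (Var 4) (Var 5) (Var 2) (Var 0))))).
Definition eOkc q c := fCall2 dOkc q c.
Definition dPar := fPick (Var 2) (eGood (Var 2) (Var 3) (Var 4) (Var 0)).
Definition ePar q c i := fCall3 dPar q c i.
Definition dWidi := fSum eK (eB (Var 2) (Var 3) (Var 0)).
Definition eWidi c i := fCall2 dWidi c i.
Definition dWid := fMax eK1 (eWidi (Var 2) (Var 0)).
Definition eWid c := fCall1 dWid c.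
Definition eNc := ePw (Cst 2) (Bin Mul eK1 eK).
(** Exhaustive search through all sequences of k + 1 subsets of the nodes of H; its cost depends on
    k only. *)
Definition dBest := fPick eNc (fAnd (eOkc (Var 2) (Var 0))
  (fAll eNc (fImp (eOkc (Var 4) (Var 0)) (fLe (eWid (Var 2)) (eWid (Var 0)))))).
Definition eBest q := fCall1 dBest q.

Definition dSrc := fPick eK (fAnd (eB (Var 3) (Var 4) (Var 0)) (eConn (Var 2) (Var 0) (Var 5))).
Definition eSrc q c i v := Call dSrc q c i v.
Definition dRk := fSum (Var 2) (eB (Var 2) (Var 3) (Var 0)).
Definition eRk c i b := fCall3 dRk c i b.
Definition eCW := ePw eD1 eK.
Definition eCWK := ePw eCW eK.
Definition eOut u j := Rd 11 (Bin Add (Bin Mul (Bin Defs.Sub u (Cst 1)) eD1) j).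
(** An empty cell means staying in place, so walks of exactly k steps include all shorter ones. *)
Definition dStepW := Bin Add (eOut (Var 0) (Var 1))
  (Bin Mul (fNot (eOut (Var 0) (Var 1))) (Var 0)).
Definition eStepW u j := fCall2 dStepW u j.
Definition dWalk := Iter eK (Var 0) (eStepW (Var 1) (eDig eD1 (Var 3) (Var 0))).
Definition eWalk u w := fCall2 dWalk u w.
Definition dAv := Bin Add (eDig eN (Bin Div (Var 2) eCWK)
   (eRk (eBest (Var 0)) (Var 1) (Var 3))) (Cst 1).
Definition eAv q i z b := Call dAv q i z b.
Definition eCv z v := eDig eCW z v.
Definition dSv := eAv (Var 0) (Var 1) (Var 2) (eSrc (Var 0) (eBest (Var 0)) (Var 1) (Var 3)).
Definition eSv q i z v := Call dSv q i z v.
Definition dPhi := Bin Mul (eX (Var 0) (eBest (Var 0)) (Var 1) (Var 3))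
  (eWalk (eSv (Var 0) (Var 1) (Var 2) (Var 3)) (eCv (Var 2) (Var 3))).
Definition ePhi q i z v := Call dPhi q i z v.
(* Selecting the smallest walk to each node makes every map occur only once. *)
Definition dCanon := fAll eK (
  fAnd (fImp (eX (Var 2) (eBest (Var 2)) (Var 3) (Var 0))
    (fAll eCW (fImp (fLt (Var 0) (eCv (Var 6) (Var 2)))
      (fNot (fEq (eWalk (eSv (Var 4) (Var 5) (Var 6) (Var 2)) (Var 0))
                 (eWalk (eSv (Var 4) (Var 5) (Var 6) (Var 2)) (eCv (Var 6) (Var 2))))))))
  (fAnd (fImp (fNot (eX (Var 2) (eBest (Var 2)) (Var 3) (Var 0))) (fEq (eCv (Var 4) (Var 0)) (Cst 0)))
    (fImp (eB (eBest (Var 2)) (Var 3) (Var 0))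
       (fEq (ePhi (Var 2) (Var 3) (Var 4) (Var 0)) (eAv (Var 2) (Var 3) (Var 4) (Var 0)))))).
Definition eCanon q i z := fCall3 dCanon q i z.
Definition dIsout := fEx eD1 (fEq (eOut (Var 2) (Var 0)) (Var 3)).
Definition eIsout u w := fCall2 dIsout u w.
(** Testing that x lies in the domain is enough, since the domain is closed under arcs and
    identifications. An arc that enters the domain from outside is left to a bag that reaches its
    tail. *)
Definition dCons := fAll eK (fAll eK (fImp (eX (Var 4) (eBest (Var 4)) (Var 5) (Var 2))
  (fAnd (fImp (eO (Var 4) (Var 2) (Var 0))
     (eIsout (ePhi (Var 4) (Var 5) (Var 6) (Var 2)) (ePhi (Var 4) (Var 5) (Var 6) (Var 0))))
   (fImp (eS (Var 4) (Var 2) (Var 0))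
     (fEq (ePhi (Var 4) (Var 5) (Var 6) (Var 2)) (ePhi (Var 4) (Var 5) (Var 6) (Var 0))))))).
Definition eCons q i z := fCall3 dCons q i z.
Definition dValid mode := fAnd (eOk mode (Var 0)) (fAnd (eCanon (Var 0) (Var 1) (Var 2))
  (eCons (Var 0) (Var 1) (Var 2))).
Definition eValid mode q i z := fCall3 (dValid mode) q i z.
(** The restriction to an interface, written in base n+1, is used directly as part of an array
    index: the memory is sparse, and an access costs only the length of its address. *)
Definition dCode := fSum eK (Bin Mul (Bin Mul (eSep (Var 2) (eBest (Var 2)) (Var 5) (Var 0))
  (ePhi (Var 2) (Var 3) (Var 4) (Var 0))) (ePw (Bin Add eN (Cst 1)) (Var 0))).
Definition eCode q i z l := Call dCode q i z l.
Definition eNq := ePw (Cst 2) (Bin Add (Bin Mul eK eK) (Bin Mul eK eK)).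
Definition dAddr := Bin Add (Bin Mul (Bin Add (Bin Mul (Var 2) eK1) (Var 1)) eNq) (Var 0).
Definition eAddr q l code := fCall3 dAddr q l code.
Definition dVal mode := Bin Mul (eValid mode (Var 0) (Var 1) (Var 2))
  (fProd eK1 (fIf (fAnd (fLt (Var 3) (Var 0))
      (fEq (ePar (Var 2) (eBest (Var 2)) (Var 0)) (Var 3)))
    (Rd 13 (eAddr (Var 2) (Var 0) (eCode (Var 2) (Var 3) (Var 4) (Var 0)))) (Cst 1))).
Definition eVal mode q i z := fCall3 (dVal mode) q i z.
(** The factor [eOk] empties the loop over candidates for inadmissible queries, whose widths are not
    controlled. *)
Definition dZ mode := Bin Mul (eOk mode (Var 0))
  (Bin Mul (ePw eN (eWidi (eBest (Var 0)) (Var 1))) eCWK).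
Definition eZ mode q i := fCall2 (dZ mode) q i.
Definition dAutp := fAll eK (fAll eK (fAnd
  (fImp (fEq (eDig eK (Var 4) (Var 2)) (eDig eK (Var 4) (Var 0))) (fEq (Var 2) (Var 0)))
  (fEq (eHadj (Var 2) (Var 0)) (eHadj (eDig eK (Var 4) (Var 2)) (eDig eK (Var 4) (Var 0)))))).
Definition eAut := fSum (ePw eK eK) (fCall1 dAutp (Var 0)).
Definition eTot mode b := fSum eNq (Bin Mul (fAnd (eOk mode (Var 0)) (fEq (eOdd (Var 0)) (Cst b)))
  (Rd 13 (eAddr (Var 0) (Cst 0) (Cst 0)))).
Definition eRes mode := Bin Div (Bin Defs.Sub (eTot mode 0) (eTot mode 1))
  (if mode is 0 then Cst 1 else eAut).

Definition bit (x i : nat) : bool := odd (x %/ 2 ^ i).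

Lemma bits_exist l (p : nat -> bool) :
  exists2 c, c < 2 ^ l & forall i, i < l -> bit c i = p i.
Proof.
have h i : i < l -> p i < 2 by case: (p i).
exists (undig 2 l p); first exact: ltn_undig.
move=> i il; have := dig_undig h il; rewrite /dig modn2 /bit.
by case: odd; case: (p i).
Qed.

Lemma bits_inj l x y : x < 2 ^ l -> y < 2 ^ l ->
  (forall i, i < l -> bit x i = bit y i) -> x = y.
Proof.
by move=> xl yl h; apply: (dig_inj xl yl) => i /h; rewrite /dig !modn2 /bit => ->.
Qed.

Lemma fev_pw st env a b : fev st env (ePw a b) = fev st env a ^ fev st env b.
Proof. by rewrite /ePw /fCall2 fev_call fev_pow. Qed.

Lemma fev_dig st env b x i :
  fev st env (eDig b x i) = dig (fev st env b) (fev st env x) (fev st env i).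
Proof.
by rewrite /eDig; fcall; rewrite /dDig fev_mod fev_div fev_pw !fev_var.
Qed.

Lemma fev_bit st env x i : fev st env (eBit x i) = bit (fev st env x) (fev st env i).
Proof. by rewrite /eBit fev_dig /dig modn2. Qed.

(** * Meaning of the expressions *)

Section Specs.
Variables (st : store) (k d n : nat) (H : sgraph 'I_k).
Hypothesis stK : st 2 0 = k.
Hypothesis stD : st 3 0 = d.
Hypothesis stN : st 4 0 = n.
Hypothesis stH : forall x y : 'I_k, fev st [:: val x; val y; 0; 0] dHadj = adj H x y.

Lemma fev_K env : fev st env eK = k. Proof. exact: stK. Qed.
Lemma fev_N env : fev st env eN = n. Proof. exact: stN. Qed.
Lemma fev_K1 env : fev st env eK1 = k.+1. Proof. by rewrite -addn1 -stK. Qed.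
Lemma fev_D1 env : fev st env eD1 = d.+1. Proof. by rewrite -addn1 -stD. Qed.

Definition Oset (q : nat) : {set 'I_k * 'I_k} := [set p : 'I_k * 'I_k | bit q (p.1 * k + p.2)].
Definition Sset (q : nat) : {set 'I_k * 'I_k} := [set p : 'I_k * 'I_k | bit q (k * k + (p.1 * k + p.2))].
Definition qstep q := stepOS (Oset q) (Sset q).

Section Env.
Variable env : seq nat.
Local Notation ev := (fev st env).

Lemma fev_hadj x y (x' y' : 'I_k) : ev x = x' -> ev y = y' ->
  ev (eHadj x y) = adj H x' y'.
Proof. by move=> ex ey; rewrite /eHadj; fcall; rewrite ex ey stH. Qed.

Lemma fev_O q x y (x' y' : 'I_k) : ev x = x' -> ev y = y' ->
  ev (eO q x y) = ((x', y') \in Oset (ev q)).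
Proof.
move=> ex ey; rewrite /eO; fcall.
by rewrite fev_bit !fevE stK ex ey inE.
Qed.

Lemma fev_S q x y (x' y' : 'I_k) : ev x = x' -> ev y = y' ->
  ev (eS q x y) = ((x', y') \in Sset (ev q)).
Proof.
move=> ex ey; rewrite /eS; fcall.
by rewrite fev_bit !fevE stK ex ey inE.
Qed.

End Env.

Lemma fev_step env q x y (x' y' : 'I_k) : fev st env x = x' -> fev st env y = y' ->
  fev st env (eStep q x y) = qstep (fev st env q) x' y'.
Proof.
move=> ex ey; rewrite /eStep; fcall; rewrite /dStep.
by apply: fev_or; [exact: fev_O | apply: fev_or; exact: fev_S].
Qed.

Lemma fev_closed env q C : fev st env (eClosed q C) =
  [forall a : 'I_k, forall b : 'I_k, bit (fev st env C) a && qstep (fev st env q) a b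
     ==> bit (fev st env C) b].
Proof.
rewrite /eClosed; fcall.
apply: fev_allo (fev_K _) _ => a acc; apply: fev_allo (fev_K _) _ => b acc'.
apply: fev_imp; last exact: fev_bit.
apply: fev_and; first exact: fev_bit.
exact: fev_step.
Qed.

Lemma fev_conn env q x y (x' y' : 'I_k) : fev st env x = x' -> fev st env y = y' ->
  fev st env (eConn q x y) = connect (qstep (fev st env q)) x' y'.
Proof.
move=> ex ey; rewrite /eConn; fcall; rewrite ex ey; set Q := fev st env q.
pose clo C := [forall a : 'I_k, forall b : 'I_k, bit C a && qstep Q a b ==> bit C b].
have -> : fev st [:: Q; val x'; val y'; 0] dConn =
    [forall C : 'I_(2 ^ k), clo C && bit C x' ==> bit C y'].
  apply: fev_allo; first by rewrite fev_pw fev_K.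
  move=> C acc; apply: fev_imp; last exact: fev_bit.
  by apply: fev_and; [exact: fev_closed | exact: fev_bit].
congr nat_of_bool; apply/forallP/idP => [h|/connectP [p pp yE] C]; last first.
  apply/implyP => /andP [/'forall_forallP cl]; rewrite yE.
  elim: p x' {y' yE ex ey} pp => //= z p IH x' /andP [xz pz] bx.
  by apply: IH => //; have := cl x' z; rewrite bx xz.
(* The closed set to test against is the set of nodes reachable from x. *)
have [c ck hc] := bits_exist k (fun i => oapp (connect (qstep Q) x') false (insub i)).
have hco (v : 'I_k) : bit c v = connect (qstep Q) x' v by rewrite hc //= valK.
have := h (Ordinal ck); rewrite /= !hco connect0 andbT => /implyP; apply.
apply/'forall_forallP => a b; rewrite !hco; apply/implyP => /andP [xa ab].
exact: connect_trans xa (connect1 ab).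
Qed.

Lemma fev_ok env mode q : fev st env (eOk mode q) =
  okOS H mode (Oset (fev st env q)) (Sset (fev st env q)).
Proof.
rewrite /eOk; fcall; apply: fev_allo (fev_K _) _ => x acc.
apply: fev_allo (fev_K _) _ => y acc'.
apply: fev_and; first by apply: fev_imp; [exact: fev_O | apply: fev_not; exact: fev_conn].
apply: fev_and.
  by apply: fev_imp; [exact: fev_hadj | apply: fev_or; exact: fev_O].
apply: fev_and.
  apply: fev_imp => //; apply: fev_imp; [exact: fev_O | exact: fev_hadj].
apply: fev_imp; first exact: fev_S.
by apply: fev_and => //; rewrite fev_lt.
Qed.

Lemma fev_odd env q : fev st env (eOdd q) =
  oddOS H (Oset (fev st env q)) (Sset (fev st env q)).
Proof.
rewrite /eOdd; fcall; set Q := fev st env q.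
rewrite /dOdd fev_mod fev_cst.
rewrite (_ : fev st _ dExtra = #|Sset Q| + #|Oset Q :\: adjset H|) ?modn2 //.
rewrite -!sum1_card [in RHS]big_mkcond [X in _ + X]big_mkcond -big_split /=.
have -> : fev st [:: Q; 0; 0; 0] dExtra = \sum_(x < k) \sum_(y < k)
    (((x, y) \in Sset Q) + ((x, y) \in Oset Q :\: adjset H)).
  apply: fev_sumo (fev_K _) _ => x acc; apply: fev_sumo (fev_K _) _ => y acc'.
  rewrite fev_add (fev_S _ (x' := x) (y' := y)) //; congr (_ + _).
  rewrite in_setD [(x, y) \in adjset H]inE /= andbC; apply: fev_and; first exact: fev_O.
  by apply: fev_not; exact: fev_hadj.
rewrite pair_big; apply: eq_bigr => -[x y] _ /=.
by case: (_ \in Sset Q); case: (_ \in _ :\: _).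
Qed.

Definition Bset (c i : nat) : {set 'I_k} := [set v : 'I_k | bit c (i * k + v)].
Definition Xset (q c i : nat) : {set 'I_k} := reachD (qstep q) (Bset c i).

Lemma fev_B env c i v (v' : 'I_k) : fev st env v = v' ->
  fev st env (eB c i v) = (v' \in Bset (fev st env c) (fev st env i)).
Proof. by move=> ev; rewrite /eB; fcall; rewrite fev_bit !fevE stK ev inE. Qed.

Lemma fev_X env q c i v (v' : 'I_k) : fev st env v = v' ->
  fev st env (eX q c i v) = (v' \in Xset (fev st env q) (fev st env c) (fev st env i)).
Proof.
move=> ev; rewrite /eX; fcall; rewrite ev inE.
apply: fev_exo (fev_K _) _ => b acc.
by apply: fev_and; [exact: fev_B | exact: fev_conn].
Qed.

Lemma fev_U env q c i v (v' : 'I_k) : fev st env v = v' ->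
  fev st env (eU q c i v) = (v' \in upto (Xset (fev st env q) (fev st env c)) (fev st env i)).
Proof.
move=> ev; rewrite /eU; fcall; rewrite ev.
set Q := fev st env q; set C := fev st env c; set I := fev st env i.
have -> : fev st [:: Q; C; I; val v'] dU = [exists j : 'I_I, v' \in Xset Q C j].
  by apply: fev_exo => // j acc; apply: fev_X.
congr nat_of_bool; apply/existsP/bigcupP => [[j h]|[j _ h]]; by exists j.
Qed.

Lemma fev_sep env q c i v (v' : 'I_k) : fev st env v = v' ->
  fev st env (eSep q c i v) = (v' \in sep (Xset (fev st env q) (fev st env c)) (fev st env i)).
Proof. by move=> ev; rewrite inE; apply: fev_and; [exact: fev_X | exact: fev_U]. Qed.

Lemma fev_good env q c i p : let X := Xset (fev st env q) (fev st env c) in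
  fev st env (eGood q c i p) = (sep X (fev st env i) \subset X (fev st env p)).
Proof.
move=> X; rewrite /eGood; fcall.
set Q := fev st env q in X *; set C := fev st env c in X *; set I := fev st env i.
set p' := fev st env p.
have -> : fev st [:: Q; C; I; p'] dGood = [forall v, (v \in sep X I) ==> (v \in X p')].
  apply: fev_allo (fev_K _) _ => v acc; apply: fev_imp; first exact: fev_sep.
  exact: fev_X.
congr nat_of_bool; apply/forallP/subsetP => h v; first exact/implyP.
exact/implyP/h.
Qed.

Definition okc (q c : nat) : bool :=
  (upto (Xset q c) k.+1 == setT) &&
  [forall i : 'I_k.+1, (val i == 0) ||
     [exists p : 'I_i, sep (Xset q c) i \subset Xset q c p]].

Lemma fev_okc env q c : fev st env (eOkc q c) = okc (fev st env q) (fev st env c).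
Proof.
rewrite /eOkc; fcall; set Q := fev st env q; set C := fev st env c.
apply: fev_and.
  have -> : (upto (Xset Q C) k.+1 == setT) = [forall v, v \in upto (Xset Q C) k.+1].
    apply/eqP/forallP => [-> v|h]; first by rewrite inE.
    by apply/setP => v; rewrite inE h.
  apply: fev_allo (fev_K _) _ => v acc.
  by rewrite (fev_U _ _ _ (v' := v)) // fev_K1.
apply: fev_allo (fev_K1 _) _ => i acc; apply: fev_or; first by rewrite fev_eq.
by apply: fev_exo => // p acc'; rewrite fev_good.
Qed.

Definition parent (q c i : nat) : nat :=
  pick_below i (fun p => sep (Xset q c) i \subset Xset q c p).

Lemma fev_par env q c i :
  fev st env (ePar q c i) = parent (fev st env q) (fev st env c) (fev st env i).
Proof.
rewrite /ePar; fcall; set Q := fev st env q; set C := fev st env c; set I := fev st env i.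
by apply: (fev_pick (b := I) (P := fun p => sep (Xset Q C) I \subset Xset Q C p)) => // p acc _;
  rewrite fev_good.
Qed.

Lemma fev_widi env c i : fev st env (eWidi c i) = #|Bset (fev st env c) (fev st env i)|.
Proof.
rewrite /eWidi; fcall; rewrite -sum1_card big_mkcond.
have -> : fev st [:: fev st env c; fev st env i; 0; 0] dWidi =
   \sum_(v < k) (v \in Bset (fev st env c) (fev st env i)).
  by apply: fev_sumo (fev_K _) _ => v acc; apply: fev_B.
by apply: eq_bigr => v _; case: (_ \in _).
Qed.

Definition wid (c : nat) : nat := \max_(i < k.+1) #|Bset c i|.

Lemma fev_wid env c : fev st env (eWid c) = wid (fev st env c).
Proof.
by rewrite /eWid; fcall; apply: fev_maxo (fev_K1 _) _ => i acc; rewrite fev_widi.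
Qed.

Definition Nc : nat := 2 ^ (k.+1 * k).

Lemma fev_Nc env : fev st env eNc = Nc.
Proof. by rewrite fev_pw fev_cst fev_mul fev_K1 fev_K. Qed.

Definition best (q : nat) : nat := pick_below Nc (fun c =>
  okc q c && [forall c' : 'I_Nc, okc q c' ==> (wid c <= wid c')]).

Lemma fev_best env q : fev st env (eBest q) = best (fev st env q).
Proof.
rewrite /eBest; fcall; set Q := fev st env q.
apply: (fev_pick (fev_Nc _)) => c acc _; apply: fev_and; first exact: fev_okc.
apply: fev_allo (fev_Nc _) _ => c' acc'; apply: fev_imp; first exact: fev_okc.
by rewrite fev_le !fev_wid.
Qed.

Lemma is_cert_okc q c : is_cert (qstep q) k.+1 (Bset c) -> okc q c.
Proof.
move=> [cov hp]; apply/andP; split; first exact/eqP.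
apply/forallP => i; case: posnP => //= i0.
have [|p pi hpi] := hp i; first by rewrite i0 ltn_ord.
by apply/existsP; exists (Ordinal pi).
Qed.

Lemma bestP q w : (exists2 B, is_cert (qstep q) k.+1 B & forall i, #|B i| <= w) ->
  okc q (best q) /\ forall i, i < k.+1 -> #|Bset (best q) i| <= w.
Proof.
move=> [B [cov hp] Bw].
(* Bit j records whether node [j %% k] belongs to bag [j %/ k]. *)
have [c cN hc] := bits_exist (k.+1 * k)
  (fun j => oapp (fun v : 'I_k => v \in B (j %/ k)) false (insub (j %% k))).
have BE i : i < k.+1 -> Bset c i = B i.
  move=> ik; apply/setP => v; rewrite inE hc.
    have k0 : 0 < k by case: (k) v => // -[].
    by rewrite modnMDl modn_small // divnMDl // divn_small // addn0 valK.
  have := ltn_ord v; nia.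
have okcc : okc q c.
  apply: is_cert_okc; split.
    by rewrite -cov; apply: eq_bigr => i _; rewrite BE.
  move=> i /andP [i0 ik]; have [|p pi hpi] := hp i; first by rewrite i0.
  exists p => //; rewrite !BE //; last exact: ltn_trans ik.
  rewrite (eq_bigr (fun j : 'I_i => reachD (qstep q) (B j))) // => j _.
  by rewrite BE //; apply: ltn_trans ik.
have widc : wid c <= w by apply/bigmax_leqP => i _; rewrite BE.
pose P c := okc q c && [forall c' : 'I_Nc, okc q c' ==> (wid c <= wid c')].
have [|bN /andP [okb /forallP wb]] := @pick_belowP Nc P.
  case: (@arg_minnP _ (Ordinal cN) (fun c => okc q (val c)) (fun c => wid (val c)) okcc).
  move=> c0 ok0 min0; exists (val c0); first exact: ltn_ord.
  rewrite /P ok0; apply/forallP => c'; apply/implyP; exact: min0.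
split=> // i ik; apply: leq_trans (leq_trans _ (implyP (wb (Ordinal cN)) okcc)) widc.
by rewrite /wid (bigD1 (Ordinal ik)) //= leq_maxl.
Qed.

Lemma parentP q c i : okc q c -> 0 < i < k.+1 ->
  parent q c i < i /\ sep (Xset q c) i \subset Xset q c (parent q c i).
Proof.
move=> /andP [_ /forallP h] /andP [i0 ik].
apply: pick_belowP; have := h (Ordinal ik); rewrite /= eqn0Ngt i0 /=.
by move=> /existsP [p hp]; exists (val p); first exact: ltn_ord.
Qed.

End Specs.

Lemma eq_iteri_lt (T : Type) m (f g : nat -> T -> T) x :
  (forall t y, t < m -> f t y = g t y) -> iteri m f x = iteri m g x.
Proof. by elim: m => //= m IH h; rewrite IH ?h // => t y tm; apply/h/ltnW. Qed.

Lemma pick_below_le b p : pick_below b p <= b.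
Proof.
rewrite /pick_below; elim: b => //= m IH.
by case: ifP => _; [apply: leqnSn | apply: leqW].
Qed.

(** * Enumerating the maps on one bag *)

Section Enumeration.
Variables (st : store) (k d n : nat) (H : sgraph 'I_k).
Hypothesis stK : st 2 0 = k.
Hypothesis stD : st 3 0 = d.
Hypothesis stN : st 4 0 = n.
Hypothesis stH : forall x y : 'I_k, fev st [:: val x; val y; 0; 0] dHadj = adj H x y.
Variable out : nat -> nat.
Hypothesis stOut : forall a, st 11 a = out a.
Hypothesis out_le : forall a, out a <= n.
Hypothesis out_last : forall u, u < n -> out (u * d.+1 + d) = 0.

Local Notation Oset := (Oset k).
Local Notation Sset := (Sset k).
Local Notation qstep := (@qstep k).
Local Notation Bset := (Bset k).
Local Notation Xset := (Xset k).
Local Notation best := (best k).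
Local Notation parent := (parent k).
Local Notation map := {ffun 'I_k -> 'I_n.+1}.

Definition outw (u j : nat) : nat := out ((u - 1) * d.+1 + j).
Definition stepw (u j : nat) : nat := if outw u j == 0 then u else outw u j.
Definition walk (u w : nat) : nat := iteri k (fun t cur => stepw cur (dig d.+1 w t)) u.
Definition CW := d.+1 ^ k.
Definition isout (u w : nat) : bool := [exists j : 'I_d.+1, outw u j == w].

Lemma fev_out env u j : fev st env (eOut u j) = outw (fev st env u) (fev st env j).
Proof. by rewrite /eOut !fevE stD addn1 stOut. Qed.

Lemma fev_stepw env u j : fev st env (eStepW u j) = stepw (fev st env u) (fev st env j).
Proof.
rewrite /eStepW; fcall; rewrite /dStepW /fNot fev_add fev_mul fev_sub !fev_out !fevE /=.
by rewrite /stepw; case: outw => [|x] /=; lia.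
Qed.

Lemma fev_walk env u w : fev st env (eWalk u w) = walk (fev st env u) (fev st env w).
Proof.
rewrite /eWalk; fcall; rewrite /walk.
set U := fev st env u; set W := fev st env w.
rewrite /dWalk fev_iter (fev_K stK) fev_var; apply: eq_iteri_lt => t y _.
by rewrite fev_stepw fev_dig (fev_D1 stD).
Qed.

Lemma fev_isout env u w : fev st env (eIsout u w) = isout (fev st env u) (fev st env w).
Proof.
rewrite /eIsout; fcall; apply: fev_exo (fev_D1 stD _) _ => j acc.
by rewrite fev_eq fev_out !fev_var.
Qed.

Lemma fev_CW env : fev st env eCW = CW.
Proof. by rewrite fev_pw (fev_D1 stD) (fev_K stK). Qed.

Lemma fev_CWK env : fev st env eCWK = CW ^ k.
Proof. by rewrite fev_pw fev_CW (fev_K stK). Qed.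

Lemma stepw_range u j : 0 < u <= n -> 0 < stepw u j <= n.
Proof.
move=> un; rewrite /stepw; case: eqP => // /eqP nz.
by rewrite lt0n nz out_le.
Qed.

Lemma walk_range u w : 0 < u <= n -> 0 < walk u w <= n.
Proof.
move=> un; rewrite /walk; suff: forall m, 0 <
    iteri m (fun t cur => stepw cur (dig d.+1 w t)) u <= n by apply.
by elim=> //= m IH; apply: stepw_range.
Qed.

Definition rk (c i b : nat) : nat := #|[set b' in Bset c i | b' < b]|.

Lemma fev_rk env c i b : fev st env b <= k ->
  fev st env (eRk c i b) = rk (fev st env c) (fev st env i) (fev st env b).
Proof.
rewrite /eRk; fcall; set C := fev st env c; set I := fev st env i; set b0 := fev st env b.
move=> bk; pose F b' := oapp (fun v : 'I_k => nat_of_bool (v \in Bset C I)) 0 (insub b').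
rewrite (fev_sum (b := b0) (F := F)) //; last first.
  move=> j acc jb; have jk := leq_trans jb bk; rewrite /F insubT /=.
  by rewrite (fev_B stK _ _ (v' := Ordinal jk)).
rewrite /rk -sum1_card (big_ord_widen k F bk) big_mkcond [RHS]big_mkcond /=.
apply: eq_bigr => j _; rewrite /F valK /= !inE; case: (bit _ _); case: (_ < _) => //.
Qed.

Definition av (q i z b : nat) : nat := (dig n (z %/ CW ^ k) (rk (best q) i b)).+1.

Lemma fev_av env q i z b : fev st env b <= k -> fev st env (eAv q i z b) =
  av (fev st env q) (fev st env i) (fev st env z) (fev st env b).
Proof.
move=> bk; rewrite /eAv; fcall; rewrite /dAv fev_add fev_cst fev_dig fev_div fev_CWK.
by rewrite fev_rk ?fev_var //= (fev_N stN) (fev_best stK) ?fev_var addn1.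
Qed.

Definition cv (z v : nat) : nat := dig CW z v.

Lemma fev_cv env z v : fev st env (eCv z v) = cv (fev st env z) (fev st env v).
Proof. by rewrite /eCv fev_dig fev_CW. Qed.

Definition src (q c i : nat) (v : 'I_k) : nat := pick_below k (fun b =>
  oapp (fun b' => (b' \in Bset c i) && connect (qstep q) b' v) false (insub b)).

Lemma srcP q c i v : v \in Xset q c i -> exists2 b : 'I_k, b \in Bset c i &
  connect (qstep q) b v /\ src q c i v = b.
Proof.
rewrite inE => /existsP [b hb].
pose P b := oapp (fun b' => (b' \in Bset c i) && connect (qstep q) b' v) false (insub b).
have [|lt] := @pick_belowP k P; first by exists (val b); [exact: ltn_ord | rewrite /P valK].
rewrite {1}/P insubT /= => /andP [h1 h2].
by exists (Ordinal lt).
Qed.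

Lemma src_le q c i v : src q c i v <= k.
Proof. exact: pick_below_le. Qed.

Lemma fev_src env q c i v (v' : 'I_k) : fev st env v = v' ->
  fev st env (eSrc q c i v) = src (fev st env q) (fev st env c) (fev st env i) v'.
Proof.
move=> ev; rewrite /eSrc; fcall; rewrite ev.
apply: (fev_pick (fev_K stK _)) => b acc bk; rewrite insubT /=.
apply: fev_and; first by apply: (fev_B stK _ _ (v' := Ordinal bk)).
exact: (fev_conn stK _ (x' := Ordinal bk)).
Qed.

Definition sv q i z (v : 'I_k) : nat := av q i z (src q (best q) i v).

Lemma fev_sv env q i z v (v' : 'I_k) : fev st env v = v' ->
  fev st env (eSv q i z v) = sv (fev st env q) (fev st env i) (fev st env z) v'.
Proof.
move=> ev; rewrite /eSv; fcall; rewrite ev.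
have E : fev st [:: fev st env q; fev st env i; fev st env z; val v']
   (eSrc (Var 0) (eBest (Var 0)) (Var 1) (Var 3)) =
   src (fev st env q) (best (fev st env q)) (fev st env i) v'.
  by rewrite (fev_src _ _ _ (v' := v')) // (fev_best stK).
by rewrite /dSv fev_av E ?src_le.
Qed.

Definition phi q i z (v : 'I_k) : nat :=
  (v \in Xset q (best q) i) * walk (sv q i z v) (cv z v).

Lemma fev_phi env q i z v (v' : 'I_k) : fev st env v = v' ->
  fev st env (ePhi q i z v) = phi (fev st env q) (fev st env i) (fev st env z) v'.
Proof.
move=> ev; rewrite /ePhi; fcall; rewrite ev /dPhi fev_mul.
rewrite (fev_X stK _ _ _ (v' := v')) // fev_walk (fev_sv _ _ _ (v' := v')) //.
by rewrite fev_cv (fev_best stK).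
Qed.

Definition canon q i z : bool := [forall v : 'I_k,
  [&& (v \in Xset q (best q) i) ==> [forall c' : 'I_CW, (c' < cv z v) ==>
        (walk (sv q i z v) c' != walk (sv q i z v) (cv z v))],
      (v \notin Xset q (best q) i) ==> (cv z v == 0)
    & (v \in Bset (best q) i) ==> (phi q i z v == av q i z v)]].

Lemma fev_canon env q i z :
  fev st env (eCanon q i z) = canon (fev st env q) (fev st env i) (fev st env z).
Proof.
rewrite /eCanon; fcall; set Q := fev st env q; set I := fev st env i; set Z := fev st env z.
apply: fev_allo (fev_K stK _) _ => v acc; apply: fev_and.
  apply: fev_imp; first by rewrite (fev_X stK _ _ _ (v' := v)) // (fev_best stK).
  apply: fev_allo (fev_CW _) _ => c' acc'; apply: fev_imp.
    by rewrite fev_lt fev_cv.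
  apply: fev_not; rewrite fev_eq !fev_walk !(fev_sv _ _ _ (v' := v)) //.
  by rewrite fev_cv.
apply: fev_and.
  apply: fev_imp; last by rewrite fev_eq fev_cv.
  by apply: fev_not; rewrite (fev_X stK _ _ _ (v' := v)) // (fev_best stK).
apply: fev_imp; first by rewrite (fev_B stK _ _ (v' := v)) // (fev_best stK).
rewrite fev_eq (fev_phi _ _ _ (v' := v)) // fev_av //.
by rewrite fev_var /= ltnW.
Qed.

Definition consq q i (f : 'I_k -> nat) : bool := [forall x, forall y,
  (x \in Xset q (best q) i) ==>
    (((x, y) \in Oset q) ==> isout (f x) (f y)) &&
    (((x, y) \in Sset q) ==> (f x == f y))].

Lemma fev_cons env q i z : fev st env (eCons q i z) =
  consq (fev st env q) (fev st env i) (phi (fev st env q) (fev st env i) (fev st env z)).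
Proof.
rewrite /eCons; fcall; set Q := fev st env q; set I := fev st env i; set Z := fev st env z.
apply: fev_allo (fev_K stK _) _ => x acc; apply: fev_allo (fev_K stK _) _ => y acc'.
apply: fev_imp; first by rewrite (fev_X stK _ _ _ (v' := x)) // (fev_best stK).
apply: fev_and; apply: fev_imp.
- by rewrite (fev_O stK _ (x' := x) (y' := y)).
- by rewrite fev_isout (fev_phi _ _ _ (v' := x)) // (fev_phi _ _ _ (v' := y)).
- by rewrite (fev_S stK _ (x' := x) (y' := y)).
- by rewrite fev_eq (fev_phi _ _ _ (v' := x)) // (fev_phi _ _ _ (v' := y)).
Qed.

Definition valid mode q i z : bool :=
  [&& okOS H mode (Oset q) (Sset q), canon q i z & consq q i (phi q i z)].

Lemma fev_valid env mode q i z : fev st env (eValid mode q i z) =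
  valid mode (fev st env q) (fev st env i) (fev st env z).
Proof.
rewrite /eValid; fcall; apply: fev_and; first by rewrite (fev_ok stK stH).
by apply: fev_and; [exact: fev_canon | exact: fev_cons].
Qed.

Definition Zsize q i : nat := n ^ #|Bset (best q) i| * CW ^ k.

Lemma fev_Z env mode q i : fev st env (eZ mode q i) =
  okOS H mode (Oset (fev st env q)) (Sset (fev st env q)) * Zsize (fev st env q) (fev st env i).
Proof.
rewrite /eZ; fcall; rewrite /dZ !fev_mul (fev_ok stK stH) fev_pw fev_CWK (fev_N stN).
by rewrite (fev_widi stK) (fev_best stK).
Qed.

Definition sols q i (f : map) : bool :=
  (supp f == Xset q (best q) i) && consq q i (fun v => f v).

Definition mkphi q i z : map := [ffun v => inord (phi q i z v)].

Lemma CW_gt0 : 0 < CW. Proof. by rewrite expn_gt0. Qed.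

Lemma av_range q i z b : b \in Bset (best q) i -> z < Zsize q i -> 0 < av q i z b <= n.
Proof.
move=> bB zZ; rewrite /av /=; apply: ltn_dig.
(* For n = 0 a nonempty bag has no candidates at all. *)
move: zZ; rewrite /Zsize; case: (n) => //; rewrite exp0n //.
by apply/card_gt0P; exists b.
Qed.

Lemma sv_range q i z v : v \in Xset q (best q) i -> z < Zsize q i -> 0 < sv q i z v <= n.
Proof. by move=> /srcP [b bB [_ E]] zZ; rewrite /sv E; apply: av_range. Qed.

Lemma phi_range q i z v : v \in Xset q (best q) i -> z < Zsize q i ->
  0 < phi q i z v <= n.
Proof. by move=> vX zZ; rewrite /phi vX mul1n; apply/walk_range/sv_range. Qed.

Lemma phi_out q i z v : v \notin Xset q (best q) i -> phi q i z v = 0.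
Proof. by move=> /negbTE vX; rewrite /phi vX. Qed.

Lemma mkphiE q i z v : z < Zsize q i -> mkphi q i z v = phi q i z v :> nat.
Proof.
move=> zZ; rewrite ffunE inordK // ltnS.
have [vX|vX] := boolP (v \in Xset q (best q) i); last by rewrite phi_out.
by have /andP [] := phi_range vX zZ.
Qed.

Lemma Bset_X q c i v : v \in Bset c i -> v \in Xset q c i.
Proof. by move=> vB; rewrite inE; apply/existsP; exists v; rewrite vB connect0. Qed.

Lemma rk_lt c i (b : 'I_k) : b \in Bset c i -> rk c i b < #|Bset c i|.
Proof.
move=> bB; apply: proper_card; apply/properP; split.
  by apply/subsetP => x; rewrite inE => /andP [].
by exists b; rewrite // !inE ltnn andbF.
Qed.

Lemma rk_mono c i (b b' : 'I_k) : b \in Bset c i -> b < b' -> rk c i b < rk c i b'.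
Proof.
move=> bB bb; apply: proper_card; apply/properP; split.
  apply/subsetP => x; rewrite !inE => /andP [-> xb]; exact: ltn_trans bb.
by exists b; rewrite !inE ?ltnn ?andbF // bb andbT -[bit _ _]/(true && _); move: bB; rewrite inE.
Qed.

Lemma rk_inj c i : {in Bset c i &, injective (fun b : 'I_k => rk c i b)}.
Proof.
move=> b b' bB b'B E; apply: val_inj => /=.
case: (ltngtP b b') => // h; first by have := rk_mono bB h; rewrite E ltnn.
by have := rk_mono b'B h; rewrite E ltnn.
Qed.

Lemma rk_surj c i r : r < #|Bset c i| -> exists2 b : 'I_k, b \in Bset c i & rk c i b = r.
Proof.
move=> rB; pose f (b : 'I_k) := insubd (Ordinal rB) (rk c i b).
have fE b : b \in Bset c i -> val (f b) = rk c i b.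
  by move=> bB; rewrite val_insubd rk_lt.
have : f @: Bset c i == setT.
  rewrite eqEcard subsetT card_in_imset ?cardsT ?card_ord ?leqnn // => b b' bB b'B E.
  by apply: (rk_inj bB b'B); rewrite /= -(fE b) // -(fE b') // E.
move=> /eqP/setP /(_ (Ordinal rB)); rewrite inE => /imsetP [b bB E].
by exists b => //; rewrite -(fE b) // -E.
Qed.

(** The digits are recovered from the map: by [canon], the upper ones are the values on the bag, and
    the lower ones are least walks from the selected sources, or 0 outside the domain. *)
Lemma mkphi_inj mode q i z z' : z < Zsize q i -> z' < Zsize q i ->
  valid mode q i z -> valid mode q i z' -> mkphi q i z = mkphi q i z' -> z = z'.
Proof.
move=> zZ zZ' /and3P [_ /forallP c1 _] /and3P [_ /forallP c2 _] E.
have P v : phi q i z v = phi q i z' v by rewrite -!mkphiE // E.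
have Ea (b : 'I_k) : b \in Bset (best q) i -> av q i z b = av q i z' b.
  move=> bB; have /and3P [_ _] := c1 b; have /and3P [_ _] := c2 b.
  by rewrite bB /= => /eqP <- /eqP <-.
have Es v : v \in Xset q (best q) i -> sv q i z v = sv q i z' v.
  by move=> /srcP [b bB [_ sE]]; rewrite /sv sE Ea.
have Ec (v : 'I_k) : cv z v = cv z' v.
  have /and3P [m1 o1 _] := c1 v; have /and3P [m2 o2 _] := c2 v.
  have [vX|vX] := boolP (v \in Xset q (best q) i); last first.
    by rewrite vX /= in o1 o2; rewrite (eqP o1) (eqP o2).
  have W := P v; rewrite /phi vX !mul1n Es // in W.
  rewrite vX Es //= in m1; rewrite vX /= in m2.
  have l1 : cv z v < CW by apply: ltn_dig CW_gt0.
  have l2 : cv z' v < CW by apply: ltn_dig CW_gt0.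
  case: (ltngtP (cv z v) (cv z' v)) => // h.
    by have := forallP m2 (Ordinal l1); rewrite /= h /= W eqxx.
  by have := forallP m1 (Ordinal l2); rewrite /= h /= W eqxx.
have CK : 0 < CW ^ k by rewrite expn_gt0 CW_gt0.
rewrite (divn_eq z (CW ^ k)) (divn_eq z' (CW ^ k)); congr (_ * _ + _).
  apply: (@dig_inj n #|Bset (best q) i|); rewrite ?ltn_divLR //.
  move=> r rB; have [b bB <-] := rk_surj rB.
  by have := Ea b bB; rewrite /av => -[].
apply: (@dig_inj CW k); rewrite ?ltn_mod // => v vk.
have dm x : dig CW (x %% CW ^ k) v = dig CW x v.
  by rewrite -(dig_addl (x %/ CW ^ k) (x %% CW ^ k) CW_gt0 vk) -divn_eq.
by rewrite !dm; apply: (Ec (Ordinal vk)).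
Qed.

Lemma supp_mkphi q i z : z < Zsize q i -> supp (mkphi q i z) = Xset q (best q) i.
Proof.
move=> zZ; apply/setP => v; rewrite [LHS]inE -val_eqE /= mkphiE //.
have [vX|vX] := boolP (v \in Xset q (best q) i); last by rewrite phi_out.
by have /andP [h _] := phi_range vX zZ; rewrite -lt0n h.
Qed.

Lemma X_closed q c i x y : x \in Xset q c i -> qstep q x y -> y \in Xset q c i.
Proof.
rewrite !inE => /existsP [b /andP [bB bx]] xy; apply/existsP; exists b.
by rewrite bB; apply: connect_trans bx (connect1 xy).
Qed.

(* Walking along O-arcs costs one step each; identified vertices and idle
   steps use the last cell of a row, which is empty. *)
Lemma walk_complete q i (f : map) b v : sols q i f -> b \in Xset q (best q) i ->
  connect (qstep q) b v -> exists2 w, w < CW & walk (f b) w = f v.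
Proof.
move=> /andP [/eqP sf /'forall_forallP cf] bX bv.
have f0 x : x \in Xset q (best q) i -> 0 < f x.
  by rewrite -sf inE -val_eqE lt0n.
have fn x : f x <= n by rewrite -ltnS.
have stay x : x \in Xset q (best q) i -> stepw (f x) d = f x.
  move=> xX; rewrite /stepw /outw out_last //.
  by have := f0 x xX; have := fn x; lia.
have one x y : x \in Xset q (best q) i -> qstep q x y ->
    exists2 j, j < d.+1 & stepw (f x) j = f y.
  move=> xX xy; have yX := X_closed xX xy.
  case/or3P: (xy) => h.
  - have := cf x y; rewrite xX h /= => /andP [/existsP [j /eqP E] _].
    exists (val j); first exact: ltn_ord.
    by rewrite /stepw E; have := f0 y yX; case: (val (f y)).
  - have := cf x y; rewrite xX h /= => /andP [_ /eqP E].
    by exists d => //; rewrite -E stay.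
  - have := cf y x; rewrite yX h /= => /andP [_ /eqP E].
    by exists d => //; rewrite E stay.
(* Paths of length at most m become walks of exactly m steps, padded by idle ones. *)
have main m : forall p, size p <= m -> path (qstep q) b p ->
    last b p \in Xset q (best q) i /\
    exists2 g : nat -> nat, (forall t, g t < d.+1) &
      iteri m (fun t cur => stepw cur (g t)) (f b) = f (last b p).
  have rest : forall m', iteri m' (fun t cur => stepw cur d) (val (f b)) = f b.
    by elim=> //= m' ->; rewrite stay.
  elim: m => [|m IH] p; first by case: p => // _ _; split=> //; exists (fun=> d).
  case/lastP: p => [|p y] sz.
    by move=> _; split=> //; exists (fun=> d) => //; exact: rest.
  rewrite rcons_path size_rcons ltnS in sz *; move=> /andP [pp xy].
  have [xX [g gd E]] := IH p sz pp; rewrite last_rcons.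
  split; first exact: X_closed xy.
  have [j jd jE] := one _ _ xX xy.
  exists (fun t => if t < m then g t else j); first by move=> t; case: ifP.
  rewrite /= ltnn -jE -E; congr stepw; apply: eq_iteri_lt => t cur ->.
  by [].
have /connectP [p pp ->] := bv.
case: (shortenP pp) => p' pp' up' _.
have sz : size p' <= k.
  have /card_uniqP E := up'; have := max_card (mem (b :: p')); rewrite E card_ord /=.
  exact: ltnW.
have [_ [g gd E]] := main k p' sz pp'.
exists (undig d.+1 k g); first by apply: ltn_undig => t _; apply: gd.
rewrite -E /walk; apply: eq_iteri_lt => t cur tk.
by rewrite dig_undig // => t' _; apply: gd.
Qed.

(** The converse construction: the images of the bag nodes go to the upper digits, a least walk for
    each reachable node to the lower ones; [walk_complete] provides such walks. *)
Lemma mkphi_surj mode q i (f : map) : okOS H mode (Oset q) (Sset q) ->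
  sols q i f -> exists z, [/\ z < Zsize q i, valid mode q i z & mkphi q i z = f].
Proof.
move=> okq /[dup] sol /andP [/eqP sf cf].
set c := best q in sf *.
have f0 x : x \in Xset q c i -> 0 < f x by rewrite -sf inE -val_eqE lt0n.
have fn x : f x <= n by rewrite -ltnS.
pose pickb r := [pick b : 'I_k | (b \in Bset c i) && (rk c i b == r)].
(* The upper digit r is the image of the bag node of rank r, shifted back to start from 0. *)
pose ga r := oapp (fun b => f b - 1) 0 (pickb r).
have gaE b : b \in Bset c i -> ga (rk c i b) = f b - 1.
  move=> bB; rewrite /ga /pickb; case: pickP => [b' /andP [b'B /eqP E]|/(_ b)] /=.
    by rewrite (rk_inj b'B bB E).
  by rewrite bB eqxx.
have gan r : r < #|Bset c i| -> ga r < n.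
  move=> /rk_surj [b bB <-]; rewrite gaE //.
  by have := f0 b (Bset_X q bB); have := fn b; lia.
pose srcv v := oapp (fun b : 'I_k => val (f b)) 0 (insub (src q c i v)).
pose hit (v : 'I_k) w := (w < CW) && (walk (srcv v) w == f v).
have hitX v : v \in Xset q c i -> exists w, hit v w.
  move=> vX; have [b bB [bv E]] := srcP vX.
  have [w wC wE] := walk_complete sol (Bset_X q bB) bv.
  by exists w; rewrite /hit wC /srcv E valK /= wE eqxx.
(* [find] returns the first walk that hits the image of v, which is what [canon] asks for. *)
pose gc v := oapp (fun v' : 'I_k => if v' \in Xset q c i then find (hit v') (iota 0 CW)
   else 0) 0 (insub v).
have gcX (v : 'I_k) : v \in Xset q c i ->
    hit v (gc v) /\ forall w, w < gc v -> ~~ hit v w.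
  move=> vX; rewrite /gc valK /= vX.
  have hs : has (hit v) (iota 0 CW).
    have [w hw] := hitX v vX; apply/hasP; exists w => //.
    by rewrite mem_iota; have /andP [] := hw.
  have fl : find (hit v) (iota 0 CW) < CW by rewrite -{2}(size_iota 0 CW) -has_find.
  split; first by have := nth_find 0 hs; rewrite nth_iota.
  move=> w wf; have := before_find 0 wf; rewrite nth_iota ?(ltn_trans wf fl) // add0n.
  by move=> ->.
have gcC v : v < k -> gc v < CW.
  move=> vk; have [vX|vX] := boolP (Ordinal vk \in Xset q c i).
    by have [/andP [h _] _] := gcX _ vX.
  by rewrite /gc insubT /= (negbTE vX) CW_gt0.
have CK : 0 < CW ^ k by rewrite expn_gt0 CW_gt0.
set A := undig n #|Bset c i| ga; set C := undig CW k gc.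
have An : A < n ^ #|Bset c i| by apply: ltn_undig.
have Cn : C < CW ^ k by apply: ltn_undig.
pose z := A * CW ^ k + C.
have zA : z %/ CW ^ k = A by rewrite divnMDl // divn_small // addn0.
have zc (v : 'I_k) : cv z v = gc v.
  by rewrite /cv dig_addl ?CW_gt0 // dig_undig.
have za b : b \in Bset c i -> av q i z b = f b.
  move=> bB; rewrite /av zA dig_undig //; last exact: rk_lt.
  by rewrite gaE // -addn1 subnK // f0 // Bset_X.
have zs v : v \in Xset q c i -> sv q i z v = srcv v.
  by move=> /srcP [b bB [_ E]]; rewrite /sv /srcv E za // valK.
have zp v : phi q i z v = f v.
  have [vX|vX] := boolP (v \in Xset q c i).
    rewrite /phi vX mul1n zs // zc.
    by have [/andP [_ /eqP]] := gcX v vX.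
  rewrite phi_out //; move: vX; rewrite -sf inE negbK => /eqP ->.
  by [].
have zZ : z < Zsize q i.
  rewrite /Zsize /z -/c; apply: (@leq_trans (A.+1 * CW ^ k)).
    by rewrite mulSn addnC ltn_add2r.
  by rewrite leq_mul2r An orbT.
exists z; split=> //; last by apply/ffunP => v; apply: val_inj; rewrite /= mkphiE.
rewrite /valid okq /=; apply/andP; split; last first.
  apply/'forall_forallP => x y; rewrite !zp; exact: ('forall_forallP cf).
apply/forallP => v; apply/and3P; split; apply/implyP.
- move=> vX; apply/forallP => w; apply/implyP; rewrite zc zs // => wv.
  have [/andP [_ /eqP ->] /(_ _ wv)] := gcX v vX.
  by rewrite /hit ltn_ord.
- by move=> vX; rewrite zc /gc valK /= (negbTE vX).
- by move=> vB; rewrite zp za.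
Qed.

(** Valid candidates correspond one to one to local solutions, so a sum over numbers z becomes a sum
    over maps. *)
Lemma sum_valid mode q i (F : map -> nat) : okOS H mode (Oset q) (Sset q) ->
  \sum_(z < Zsize q i) valid mode q i z * F (mkphi q i z) = \sum_(f | sols q i f) F f.
Proof.
move=> okq.
transitivity (\sum_(z : 'I_(Zsize q i) | valid mode q i z) F (mkphi q i z)).
  rewrite [RHS]big_mkcond; apply: eq_bigr => z _.
  by case: valid; rewrite ?mul1n ?mul0n.
rewrite [RHS](eq_bigl (fun f => f \in [set f | sols q i f])); last by move=> f; rewrite inE.
have -> : [set f | sols q i f] = (fun z : 'I_(Zsize q i) => mkphi q i z) @:
    [set z : 'I_(Zsize q i) | valid mode q i z].
  apply/setP => f; rewrite inE; apply/idP/imsetP.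
    move=> sf; have [z [zZ vz <-]] := mkphi_surj okq sf.
    by exists (Ordinal zZ); rewrite // inE.
  move=> [z]; rewrite inE => vz ->; have zZ := ltn_ord z.
  rewrite /sols supp_mkphi // eqxx /=; have /and3P [_ _ /'forall_forallP h] := vz.
  by apply/'forall_forallP => x y; rewrite !mkphiE.
rewrite big_imset /=; last first.
  move=> z z'; rewrite !inE => vz vz' E; apply: val_inj.
  exact: mkphi_inj (ltn_ord z) (ltn_ord z') vz vz' E.
by apply: eq_bigl => z; rewrite inE.
Qed.

End Enumeration.

(** * Frames and costs of commands *)

Fixpoint reads (a : nat) (e : fexp) : bool :=
  match e with
  | Var _ | Cst _ => false
  | Rd b e1 => (a == b) || reads a e1
  | Bin _ e1 e2 => reads a e1 || reads a e2
  | Iter eb ei es => [|| reads a eb, reads a ei | reads a es]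
  | Call f x y z t => [|| reads a f, reads a x, reads a y, reads a z | reads a t]
  end.

Lemma fev_update a i x st env e : ~~ reads a e ->
  fev (update st a i x) env e = fev st env e.
Proof.
elim: e env => [j|c|b e IH|o e1 IH1 e2 IH2|eb IHb ei IHi es IHs
    |f IHf u IHu v IHv w IHw t IHt] env //.
- move=> nr; have nb : a != b by move: nr; rewrite /= negb_or => /andP [].
  rewrite !fev_rd IH; last by move: nr; rewrite /= negb_or => /andP [].
  by rewrite updateE eq_sym (negbTE nb).
- rewrite /= negb_or => /andP [n1 n2].
  by rewrite !fev_bin IH1 // IH2.
- rewrite /= !negb_or => /and3P [n1 n2 n3].
  rewrite !fev_iter IHb // IHi //.
  by apply: eq_iteri_lt => j y _; rewrite IHs.
- rewrite /= !negb_or => /and5P [n1 n2 n3 n4 n5].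
  by rewrite !fev_call IHf // IHu // IHv // IHw // IHt.
Qed.

(** Bounds a single pass through each loop; numbers of iterations may depend on n and are counted
    separately. *)
Fixpoint ctb (c : fcmd) (m : nat) : nat :=
  match c with
  | Put _ e1 e2 => 2 * (tb e1 m + tb e2 m) + 2
  | Then c1 c2 => ctb c1 m + ctb c2 m
  | For e c1 => 10 * tb e m + ctb c1 m
  end.

(** In contrast to iterations inside expressions, loops of commands may have large bounds. *)
Fixpoint wfsc (G : seq bool) (c : fcmd) : bool :=
  match c with
  | Put _ e1 e2 => wfs G e1 && wfs G e2
  | Then c1 c2 => wfsc G c1 && wfsc G c2
  | For e c1 => wfs G e && wfsc (srt G e :: G) c1
  end.

Lemma ctb_for e c m : ctb (For e c) m = 10 * tb e m + ctb c m.
Proof. by []. Qed.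

Section CommandCosts.
Variables (G : seq bool) (env : seq nat) (m M : nat) (st : store).
Hypotheses (M2 : 1 < M) (hst : bnd m M st) (henv : envok G env m M).

Lemma put_cost a e1 e2 : wfsc G (Put a e1 e2) ->
  cco env (Put a e1 e2) st <= ctb (Put a e1 e2) m * bitlen M.
Proof.
move=> /= /andP [w1 w2].
have [_ _ c1] := tb_ok M2 w1 hst henv; have [_ _ c2] := tb_ok M2 w2 hst henv.
have b1 := bitlen_fco st env e1; have b2 := bitlen_fco st env e2.
by have := bitlen_gt0 M; nia.
Qed.

(** Invariant and cost are obtained together, because the cost of a step is known only from the
    invariant's bounds on the stored values. *)
Lemma for_inv e c (I : nat -> store -> Prop) (Y : nat -> nat) :
  wfs G e -> I 0 st ->
  (forall j s, j < fev st env e -> I j s ->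
     I j.+1 (cden (j :: env) c s) /\ cco (j :: env) c s <= Y j) ->
  I (fev st env e) (cden env (For e c) st) /\
  cco env (For e c) st <= \sum_(j < fev st env e) Y j
    + (fev st env e).+1 * (10 * tb e m * bitlen M).
Proof.
move=> we I0 step; have [v _ ce] := tb_ok M2 we hst henv.
rewrite /=; set b := fev st env e in step v *.
have inv j : j <= b -> I j (iteri j (fun j s => cden (j :: env) c s) st).
  elim: j => // j IH jb; have [] := step j _ jb (IH (ltnW jb)); by [].
split; first exact: inv.
have bb : bitlen b <= tb e m * bitlen M.
  exact: bitlen_val M2 (tb_gt0 e m) v.
have B := bitlen_gt0 M; have T := tb_gt0 e m.
have S : \sum_(j < b) (cco (val j :: env) c (iteri j (fun j s => cden (j :: env) c s) st)
         + 5 * bitlen b + 5) <= \sum_(j < b) Y j + b * (10 * tb e m * bitlen M).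
  have -> : b * (10 * tb e m * bitlen M) = \sum_(j < b) 10 * tb e m * bitlen M.
    by rewrite sum_nat_const card_ord.
  rewrite -big_split; apply: leq_sum => j _.
  have [_ h] := step j _ (ltn_ord j) (inv j (ltnW (ltn_ord j))).
  rewrite /= -addnA; apply: leq_add h _.
  by clear -bb B T; nia.
move: S; set SS := \sum_(j < b) _; set SY := \sum_(j < b) _ => S.
have u0 : 0 < tb e m * bitlen M by rewrite muln_gt0 T.
rewrite [b.+1 * _]mulSn -!mulnA; rewrite -!mulnA in S; clear -S bb u0 ce.
by move: (b * _) S => Z S; move: (tb e m * _) bb u0 ce => u; lia.
Qed.

End CommandCosts.

Lemma leq_absorb a b x y : 0 < a -> 0 < b -> a * (b * x) + y <= a * (b * (y + x)).
Proof.
move=> a0 b0; rewrite !mulnA mulnDr [leqRHS]addnC leq_add2l leq_pmull //.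
by rewrite muln_gt0 a0.
Qed.

Lemma leq_sum_ord (F : nat -> nat) a b : a <= b -> \sum_(i < a) F i <= \sum_(i < b) F i.
Proof.
move=> ab; rewrite -(subnK ab); elim: (b - a) => //= r IH.
by rewrite addSn big_ord_recr /=; apply: leq_trans IH (leq_addr _ _).
Qed.

(** * The dynamic program *)

(** The loop counts upwards while the bag index goes down, so the children of a bag, which have
    larger indices, are finished before it. *)
Definition bI := Bin Defs.Sub eK (Var 1).
Definition bAddr := eAddr (Var 2) bI (eCode (Var 2) bI (Var 0) bI).
Definition bBody mode := Put 13 bAddr (Bin Add (Rd 13 bAddr) (eVal mode (Var 2) bI (Var 0))).
Definition bZ mode := eZ mode (Var 1) (Bin Defs.Sub eK (Var 0)).
Definition pZ mode := For (bZ mode) (bBody mode).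
Definition pB mode := For eNq (For eK1 (pZ mode)).

Section PhaseB.
Variables (k d n : nat) (H : sgraph 'I_k) (out : nat -> nat) (mode m M : nat).
Hypothesis out_le : forall a, out a <= n.
Hypothesis out_last : forall u, u < n -> out (u * d.+1 + d) = 0.

Local Notation map := {ffun 'I_k -> 'I_n.+1}.
Local Notation Q := (2 ^ (k * k + k * k)).
Local Notation bst q := (best k q).
Local Notation Xs q := (Xset k q (best k q)).
Local Notation par q := (parent k q (best k q)).
Local Notation okq q := (okOS H mode (Oset k q) (Sset k q)).
Local Notation mkp := (mkphi k d n out).

Definition ctx (st : store) : Prop :=
  [/\ st 2 0 = k, st 3 0 = d, st 4 0 = n,
   forall x y : 'I_k, fev st [:: val x; val y; 0; 0] dHadj = adj H x y
   & forall a, st 11 a = out a].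

Lemma ctx_update st a x : ctx st -> ctx (update st 13 a x).
Proof.
by move=> [c1 c2 c3 c4 c5]; split=> // u v; rewrite -c4; apply: fev_update.
Qed.

Definition codeof (f : map) : nat := \sum_v f v * n.+1 ^ v.

Lemma codeof_inj : injective codeof.
Proof.
move=> f g E; pose h (f : map) v := oapp (fun v' => val (f v')) 0 (insub v).
have hE (f' : map) : codeof f' = undig n.+1 k (h f').
  by apply: eq_bigr => v _; rewrite /h valK.
have hn (f' : map) v : v < k -> h f' v < n.+1.
  by move=> vk; rewrite /h insubT /= ltn_ord.
apply/ffunP => v; apply: val_inj => /=.
have := dig_undig (hn f) (ltn_ord v); rewrite -hE E hE dig_undig //; last exact: hn.
by rewrite /h valK.
Qed.

Definition addr (q l c : nat) : nat := (c * k.+1 + l) * Q + q.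

Lemma addr_inj q l c q' l' c' : q < Q -> q' < Q -> l < k.+1 -> l' < k.+1 ->
  addr q l c = addr q' l' c' -> [/\ q = q', l = l' & c = c'].
Proof.
move=> qQ qQ' lk lk' E.
have Q0 : 0 < Q by rewrite expn_gt0.
have Eq : q = q'.
  by have := congr1 (modn^~ Q) E; rewrite /addr !modnMDl !modn_small.
have El : c * k.+1 + l = c' * k.+1 + l'.
  by have := congr1 (divn^~ Q) E; rewrite /addr !divnMDl // !divn_small // !addn0.
split=> //; first by have := congr1 (modn^~ k.+1) El; rewrite !modnMDl !modn_small.
by have := congr1 (divn^~ k.+1) El; rewrite !divnMDl // !divn_small // !addn0.
Qed.

Section Values.
Variable st : store.
Hypothesis cst : ctx st.

Lemma fev_addr env q l c : fev st env (eAddr q l c) =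
  addr (fev st env q) (fev st env l) (fev st env c).
Proof.
have [c1 _ _ _ _] := cst.
rewrite /eAddr; fcall; rewrite /dAddr !fev_add !fev_mul fev_add fev_mul (fev_K1 c1).
by rewrite fev_pw fev_add fev_mul (fev_K c1) fev_cst !fev_var.
Qed.

Lemma fev_code env q i z l : fev st env z < Zsize k d n (fev st env q) (fev st env i) ->
  fev st env (eCode q i z l) =
  codeof (rst (sep (Xs (fev st env q)) (fev st env l))
              (mkp (fev st env q) (fev st env i) (fev st env z))).
Proof.
have [c1 c2 c3 c4 c5] := cst.
rewrite /eCode; fcall; set q0 := fev st env q; set i0 := fev st env i => zZ.
set z0 := fev st env z in zZ *; set l0 := fev st env l.
apply: fev_sumo (fev_K c1 _) _ => v acc.
rewrite 2!fev_mul (fev_sep c1 _ _ _ (v' := v)) // (fev_phi c1 c2 c3 c5 _ _ _ (v' := v)) //.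
rewrite (fev_best c1) fev_pw fev_add (fev_N c3) fev_cst addn1 !fev_var /=.
rewrite ffunE; congr (_ * _); case: ifP => _; last by rewrite mul0n.
by rewrite mul1n mkphiE.
Qed.

Definition val_at q i z : nat := valid d n H out mode q i z *
  \prod_(l < k.+1 | (i < l) && (par q l == i))
     st 13 (addr q l (codeof (rst (sep (Xs q) l) (mkp q i z)))).

Lemma fev_val env q i z : fev st env z < Zsize k d n (fev st env q) (fev st env i) ->
  fev st env (eVal mode q i z) = val_at (fev st env q) (fev st env i) (fev st env z).
Proof.
have [c1 c2 c3 c4 c5] := cst.
rewrite /eVal; fcall; set q0 := fev st env q; set i0 := fev st env i => zZ.
set z0 := fev st env z in zZ *.
rewrite /dVal fev_mul (fev_valid c1 c2 c3 c4 c5) !fev_var /=; congr (_ * _).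
rewrite [RHS]big_mkcond; apply: fev_prodo (fev_K1 c1 _) _ => l acc.
rewrite (@fev_if _ _ _ _ _ ((i0 < l) && (par q0 l == i0))); last first.
  apply: fev_and; first by rewrite fev_lt !fev_var.
  by rewrite fev_eq (fev_par c1) (fev_best c1) !fev_var.
rewrite fev_cst fev_rd fev_addr; case: ifP => // _; congr (st 13 (addr _ _ _)).
by rewrite fev_code !fev_var.
Qed.

End Values.

Definition T (q l : nat) (sigma : map) : nat :=
  tab k.+1 (Xs q) (par q) (sols d out q) l sigma.

Definition spec_tab (q0 ii q l : nat) (sigma : map) : nat :=
  if okq q && ((q < q0) || (q == q0) && (k - l < ii)) then T q l sigma else 0.

(* The tables after the first [ii] bags, from last to first, of the query [q0]. *)
Definition IB (q0 ii : nat) (s : store) : Prop :=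
  [/\ ctx s, bnd m M s & forall q l (sigma : map), q < Q -> l < k.+1 ->
      s 13 (addr q l (codeof sigma)) = spec_tab q0 ii q l sigma].

Definition Tbound := (n.+1 ^ k) ^ (k.+2 ^ k.+1).

Lemma T_le q l sigma : l < k.+1 -> T q l sigma <= Tbound.
Proof.
move=> lk; rewrite /T /tab; apply: leq_trans; first exact: table_le.
by rewrite leq_pexp2l ?expn_gt0 // leq_pexp2l // leq_subr.
Qed.

Definition prodT q i z : nat := \prod_(l < k.+1 | (i < l) && (par q l == i))
  T q l (rst (sep (Xs q) l) (mkp q i z)).

(** The content of a table cell after the first [z0] candidates of bag i. *)
Definition part q i z0 (sigma : map) : nat := \sum_(z < z0)
  valid d n H out mode q i z * ((rst (sep (Xs q) i) (mkp q i z) == sigma) * prodT q i z).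

Lemma part_T st q i sigma : ctx st -> i < k.+1 -> okq q ->
  part q i (Zsize k d n q i) sigma = T q i sigma.
Proof.
move=> [c1 c2 c3 c4 c5] ik okqq; rewrite /part /T tabE //.
rewrite (sum_valid c1 c2 c3 out_le out_last _ (fun f => (rst (sep (Xs q) i) f == sigma) *
   \prod_(l < k.+1 | (i < l) && (par q l == i)) T q l (rst (sep (Xs q) l) f)) okqq).
rewrite [RHS]big_mkcondr; apply: eq_bigr => f _; by case: ifP; rewrite ?mul1n ?mul0n.
Qed.

Hypotheses (M2 : 1 < M) (Mtab : Tbound <= M) (m_small : Q + k.+1 <= m).
Hypothesis MZ : forall q i, okq q -> i < k.+1 -> Zsize k d n q i <= M.

Variable w : nat.
Hypothesis wid_le : forall q i, okq q -> i < k.+1 -> #|Bset k (bst q) i| <= w.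

Let bl := bitlen M.
Let Zmax := maxn 1 n ^ w * CW k d ^ k.

Lemma Zsize_le q i : okq q -> i < k.+1 -> Zsize k d n q i <= Zmax.
Proof.
move=> ok ik; rewrite /Zsize leq_mul2r; apply/orP; right.
apply: (@leq_trans (maxn 1 n ^ #|Bset k (bst q) i|)); first by rewrite leq_exp2rW // leq_maxr.
by rewrite leq_pexp2l ?wid_le // leq_max.
Qed.

Lemma pZ_ok q ii s : q < Q -> ii < k.+1 -> IB q ii s ->
  IB q ii.+1 (cden [:: ii; q] (pZ mode) s) /\
  cco [:: ii; q] (pZ mode) s <= Zmax.+1 * (ctb (pZ mode) m * bl).
Proof.
move=> qQ iik [cs bs ts]; set i := k - ii.
have ik : i < k.+1 by rewrite ltnS leq_subr.
have [c1 c2 c3 c4 c5] := cs.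
have eZ0 : fev s [:: ii; q] (bZ mode) = okq q * Zsize k d n q i.
  by rewrite /bZ (fev_Z c1 c2 c3 c4) fev_sub (fev_K c1) !fev_var.
have henv : envok [:: true; true] [:: ii; q] m M.
  apply: envok_cons; first by lia.
  by apply: envok_cons; [lia | move=> j; rewrite nth_nil].
have wfZ : wfs [:: true; true] (bZ mode) && wfsc [:: false; true; true] (bBody mode).
  by case: mode => [|[|mo]]; vm_compute.
have /andP [wZ wBd] := wfZ.
(* Inside the innermost loop the cells of bag i hold partial sums, and all others are as before the
   loop. *)
pose IC z0 s' := [/\ ctx s', bnd m M s' & forall q' l (sigma : map), q' < Q -> l < k.+1 ->
   s' 13 (addr q' l (codeof sigma)) = if (q' == q) && (l == i) && okq q then part q i z0 sigma
     else spec_tab q ii q' l sigma].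
have IC0 : IC 0 s.
  split; [exact: cs | exact: bs | move=> q' l sigma qQ' lk].
  rewrite (ts _ _ _ qQ' lk).
  case: ifP; last by [].
  move=> /andP [/andP [/eqP -> /eqP ->] _].
  rewrite /part big_ord0 /spec_tab ltnn eqxx /= [k - i < ii]ltnNge.
  have -> : ii <= k - i by rewrite /i; lia.
  by rewrite andbF.
have [|[cs' bs' ts'] cost] := for_inv (c := bBody mode) (I := IC)
    (Y := fun=> ctb (bBody mode) m * bl) M2 bs henv wZ IC0.
  move=> z s' zb [cs' bs' ts']; rewrite eZ0 in zb.
  have okqq : okq q by move: zb; case: (okq q).
  rewrite okqq mul1n in zb.
  have henv' : envok [:: false; true; true] [:: z; ii; q] m M.
    apply: (envok_cons (s := false) _ henv).
    exact: ltnW (leq_trans zb (MZ okqq ik)).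
  split; last by rewrite /bl /bBody; apply: (put_cost M2 bs' henv'); exact: wBd.
  have [c1' c2' c3' c4' c5'] := cs'.
  have eI : fev s' [:: z; ii; q] bI = i by rewrite /bI fev_sub (fev_K c1') fev_var.
  have hz : fev s' [:: z; ii; q] (Var 0) < Zsize k d n (fev s' [:: z; ii; q] (Var 2))
      (fev s' [:: z; ii; q] bI) by rewrite eI !fev_var.
  have eA : fev s' [:: z; ii; q] bAddr =
      addr q i (codeof (rst (sep (Xs q) i) (mkp q i z))).
    by rewrite /bAddr (fev_addr cs') (fev_code cs' _ hz) eI !fev_var.
  set sg := rst (sep (Xs q) i) (mkp q i z) in eA.
  have eV : fev s' [:: z; ii; q] (Bin Add (Rd 13 bAddr) (eVal mode (Var 2) bI (Var 0)))
      = part q i z.+1 sg.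
    rewrite fev_add fev_rd eA (fev_val cs' hz) eI !fev_var [nth _ _ _]/= [nth _ _ _]/=.
    rewrite (ts' _ _ _ qQ ik) !eqxx okqq /=.
    rewrite /part big_ord_recr /= -/sg eqxx mul1n; congr (_ + _ * _).
    (* Children have index l > i, so their cells are complete and are not touched by the current
       loop. *)
    apply: eq_bigr => l /andP [il _]; rewrite (ts' _ _ _ qQ (ltn_ord l)).
    have -> : (val l == i) = false by apply/negbTE; rewrite neq_ltn il orbT.
    rewrite andbF /= /spec_tab okqq eqxx ltnn /=.
    by have -> : k - l < ii by have := ltn_ord l; move: il; rewrite /i; lia.
  have -> : cden [:: z; ii; q] (bBody mode) s' =
      update s' 13 (addr q i (codeof sg)) (part q i z.+1 sg) by rewrite -eA -eV.
  (* Cells only grow while candidates are added, so the final table entry bounds all intermediate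
     values. *)
  have pM : part q i z.+1 sg <= M.
    apply: leq_trans _ Mtab; apply: leq_trans _ (T_le q sg ik).
    rewrite -(part_T sg cs ik okqq).
    exact: (leq_sum_ord (fun z => valid d n H out mode q i z *
       ((rst (sep (Xs q) i) (mkp q i z) == sg) * prodT q i z))).
  split; first exact: ctx_update.
    by move=> b j; rewrite updateE; case: andP => [[/eqP -> _]|_]; last exact: bs'.
  move=> q' l sigma qQ' lk; rewrite updateE eqxx /=; case: eqP => [E|nE].
    have [-> -> /codeof_inj ->] := addr_inj qQ' qQ lk ik E.
    by rewrite !eqxx okqq.
  rewrite (ts' _ _ _ qQ' lk); case: ifP; last by [].
  move=> /andP [/andP [/eqP eq /eqP el] _].
  rewrite /part big_ord_recr /= -/sg; case: eqP => [sE|_]; last by rewrite mul0n muln0 addn0.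
  by case: nE; rewrite eq el sE.
split.
  split; [exact: cs' | exact: bs' | move=> q' l sigma qQ' lk].
  rewrite (ts' _ _ _ qQ' lk) eZ0.
  case: (boolP (okq q)) => okqq; last first.
    rewrite andbF /spec_tab; have [qq|qq] := eqVneq q' q.
      by rewrite qq (negbTE okqq).
    by [].
  rewrite andbT mul1n (part_T sigma cs ik okqq) /spec_tab.
  have [->|qq] := eqVneq q' q; last by [].
  rewrite ltnn okqq [_ && _]/= [_ || _]/=.
  have [->|nl] := eqVneq l i.
    have -> : k - i < ii.+1 by rewrite /i; lia.
    by [].
  have -> : (k - l < ii) = (k - l < ii.+1).
    by move: nl lk iik; rewrite /i; clear; lia.
  by [].
apply: leq_trans cost _; rewrite eZ0 sum_nat_const card_ord.
set zz := okq q * _.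
have zZ : zz <= Zmax.
  by rewrite /zz; case: (boolP (okq q)) => ok; [rewrite mul1n Zsize_le | rewrite mul0n].
rewrite /bl /pZ ctb_for mulnDl mulnDr addnC; apply: leq_add.
  by rewrite leq_mul2r ltnS zZ orbT.
by rewrite leq_mul2r leqW ?orbT.
Qed.

Lemma pB_ok s : ctx s -> bnd m M s -> (forall a, s 13 a = 0) ->
  IB Q 0 (cden [::] (pB mode) s) /\
  cco [::] (pB mode) s <= Q.+1 * (k.+2 * (Zmax.+1 * (ctb (pB mode) m * bl))).
Proof.
move=> cs bs z13.
have Q0 : 0 < Q by rewrite expn_gt0.
have e0 : envok [::] [::] m M by move=> i; rewrite !nth_nil.
have eQ : fev s [::] eNq = Q.
  by have [c1 _ _ _ _] := cs; rewrite fev_pw fev_add fev_mul (fev_K c1).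
have [||] := for_inv (c := For eK1 (pZ mode)) (I := fun q => IB q 0)
  (Y := fun=> k.+2 * (Zmax.+1 * (ctb (For eK1 (pZ mode)) m * bl))) M2 bs e0 (isT : wfs [::] eNq).
- by split=> // q l sigma _ _; rewrite z13 /spec_tab ltn0 andbF /= andbF.
- move=> q s' qQ [cs' bs' ts']; rewrite eQ in qQ.
  have e1 : envok [:: true] [:: q] m M.
    by apply: envok_cons; [lia | move=> j; rewrite nth_nil].
  have eK1' : fev s' [:: q] eK1 = k.+1 by have [c1 _ _ _ _] := cs'; apply: fev_K1.
  have [||] := for_inv (c := pZ mode) (I := IB q)
    (Y := fun=> Zmax.+1 * (ctb (pZ mode) m * bl)) M2 bs' e1 (isT : wfs [:: true] eK1).
  + by split.
  + by move=> ii s'' ; rewrite eK1' => iik; apply: pZ_ok.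
  rewrite eK1' sum_nat_const card_ord => -[c2 b2 t2] cost; split.
    split=> // q' l sigma qQ' lk; rewrite t2 // /spec_tab; congr (if _ then _ else _).
    have -> : k - l < k.+1 by rewrite ltnS leq_subr.
    by congr (_ && _); rewrite ltn0 andbT andbF orbF orbC ltnS [q' <= q]leq_eqVlt.
  apply: leq_trans cost _; rewrite ctb_for /bl.
  move: (ctb (pZ mode) m) (tb eK1 m) (bitlen M) => x y b.
  rewrite [(10 * y + x) * b]mulnDl.
  have h : Zmax.+1 * (x * b) + 10 * y * b <= Zmax.+1 * (10 * y * b + x * b).
    by rewrite mulnDr [leqRHS]addnC leq_add2l leq_pmull.
  apply: (@leq_trans (k.+2 * (Zmax.+1 * (x * b) + 10 * y * b))).
    by rewrite mulnDr leq_add2r leq_mul2r leqnSn orbT.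
  by rewrite leq_mul2l h orbT.
rewrite eQ sum_nat_const card_ord => hI cost; split=> //.
apply: leq_trans cost _; rewrite /pB [ctb (For eNq _) m]ctb_for /bl.
move: (ctb (For eK1 _) m) => x; move: (tb eNq m) (bitlen M) => y b.
rewrite [(10 * y + x) * b]mulnDl.
have h : k.+2 * (Zmax.+1 * (x * b)) + 10 * y * b <=
    k.+2 * (Zmax.+1 * (10 * y * b + x * b)).
  exact: leq_absorb.
apply: (@leq_trans (Q.+1 * (k.+2 * (Zmax.+1 * (x * b)) + 10 * y * b))).
  by rewrite mulnDr leq_add2r leq_mul2r leqnSn orbT.
by rewrite leq_mul2l h orbT.
Qed.

End PhaseB.

(** The lower k * k bits encode O and the upper ones S; the decoding is an injection between sets of
    equal size. *)
Lemma sum_codes k (F : {set 'I_k * 'I_k} * {set 'I_k * 'I_k} -> nat) :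
  \sum_(q < 2 ^ (k * k + k * k)) F (Oset k q, Sset k q) = \sum_p F p.
Proof.
pose h (q : 'I_(2 ^ (k * k + k * k))) := (Oset k q, Sset k q).
have hi : injective h.
  move=> q q' [EO ES]; apply: val_inj; apply: (bits_inj (ltn_ord q) (ltn_ord q')) => i il.
  have dec j : j < k * k -> exists x y : 'I_k, j = x * k + y.
    move=> jl; have k0 : 0 < k by case: (k) jl.
    have xk : j %/ k < k by rewrite ltn_divLR.
    by exists (Ordinal xk), (Ordinal (ltn_pmod j k0)); rewrite /= -divn_eq.
  have [ilt|ige] := ltnP i (k * k).
    have [x [y ->]] := dec i ilt.
    by have /setP /(_ (x, y)) := EO; rewrite !inE.
  have [|x [y E]] := dec (i - k * k); first by lia.
  have -> : i = k * k + (x * k + y) by lia.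
  by have /setP /(_ (x, y)) := ES; rewrite !inE.
have hb : bijective h.
  apply: (inj_card_bij hi).
  have E : #|{set 'I_k * 'I_k}| = 2 ^ (k * k).
    by rewrite -cardsT -powersetT card_powerset cardsT card_prod card_ord.
  by rewrite card_ord card_prod !E expnD.
by rewrite (reindex h) //; apply: onW_bij.
Qed.

(** * From the tables to the three counts *)

Section Answer.
Variables (k d n : nat) (H : sgraph 'I_k) (out : nat -> nat) (outr : rel 'I_n).
Hypothesis outE : forall u v, outr u v = isout d out u.+1 v.+1.

Local Notation map := {ffun 'I_k -> 'I_n.+1}.
Local Notation Xs q := (Xset k q (best k q)).

(** The domains cover all nodes, so solutions are total maps, with values shifted by one. A
    constraint on (x, y) is checked at any bag that reaches x, because it reaches y as well. *)
Lemma T_count q : okc k q (best k q) ->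
  T d out q 0 ([ffun=> ord0] : map) = countOS outr (Oset k q) (Sset k q).
Proof.
move=> okcq; rewrite /T -count_join //; first last.
- by apply/eqP; case/andP: okcq.
- by move=> i ik; have [] := parentP okcq ik.
- by move=> i ik; have [] := parentP okcq ik.
- by move=> i f /andP [/eqP].
have /andP [/eqP cov _] := okcq.
pose h (f : {ffun 'I_k -> 'I_n}) : map := [ffun v => lift ord0 (f v)].
have hi : injective h.
  move=> f g /ffunP E; apply/ffunP => v; have := E v; rewrite !ffunE; exact: lift_inj.
have inX v : exists j : 'I_k.+1, v \in Xs q j.
  have : v \in upto (Xs q) k.+1 by rewrite cov inE.
  by move=> /bigcupP [j _ vj]; exists j.
rewrite /countOS -(card_imset _ hi); apply: eq_card => psi; rewrite inE.
apply/idP/imsetP => [/andP [/eqP sp /forallP cp]|[f]].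
  have nz v : exists u, psi v == lift ord0 u.
    have : v \in supp psi by rewrite sp cov inE.
    rewrite inE eq_sym => /unlift_some [u E _]; by exists u; rewrite E.
  have [f fE] : exists f : {ffun 'I_k -> 'I_n}, forall v, psi v = lift ord0 (f v).
    exists [ffun v => xchoose (nz v)] => v.
    by rewrite ffunE; apply/eqP/(xchooseP (nz v)).
  exists f; last by apply/ffunP => v; rewrite ffunE.
  rewrite inE; apply/'forall_forallP => x y; have [j xj] := inX x.
  have /andP [_ /'forall_forallP /(_ x y)] := cp j; rewrite xj /= !ffunE xj.
  move=> /andP [h1 h2]; apply/andP; split; apply/implyP => xy.
    have yj : y \in Xs q j by apply: X_closed xj _; rewrite /qstep /stepOS xy.
    by move: h1; rewrite xy yj outE !fE !lift0.
  have yj : y \in Xs q j by apply: X_closed xj _; rewrite /qstep /stepOS xy orbT.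
  by move: h2; rewrite xy yj !fE /= eqSS.
rewrite inE => /'forall_forallP sf ->; apply/andP; split.
  by rewrite cov; apply/eqP/setP => v; rewrite !inE ffunE.
apply/forallP => j; apply/andP; split.
  by rewrite supp_rst; apply/eqP/setIidPl/subsetP => v _; rewrite inE ffunE.
apply/'forall_forallP => x y; apply/implyP => xj; rewrite !ffunE xj.
have /andP [h1 h2] := sf x y; apply/andP; split; apply/implyP => xy.
  have -> : y \in Xs q j by apply: X_closed xj _; rewrite /qstep /stepOS xy.
  by move: h1; rewrite xy outE !lift0.
have -> : y \in Xs q j by apply: X_closed xj _; rewrite /qstep /stepOS xy orbT.
by move: h2; rewrite xy /= => /eqP ->.
Qed.

Lemma fev_aut st env : ctx d n H out st -> fev st env eAut = #|auts H|.
Proof.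
move=> [c1 c2 c3 c4 c5].
pose adjn (a b : nat) : bool := oapp (fun x : 'I_k =>
  oapp (fun y : 'I_k => adj H x y) false (insub b)) false (insub a).
pose P (g : {ffun 'I_k -> nat}) : nat := [forall x, forall y,
  ((g x == g y) ==> (val x == val y)) && (adj H x y == adjn (g x) (g y))].
have -> : fev st env eAut = \sum_(x < k ^ k) P [ffun i : 'I_k => dig k x i].
  apply: fev_sumo; first by rewrite fev_pw !(fev_K c1).
  move=> s acc; fcall; apply: fev_allo (fev_K c1 _) _ => x acc1.
  apply: fev_allo (fev_K c1 _) _ => y acc2; rewrite !ffunE.
  have k0 : 0 < k by case: (k) x => // -[].
  have dx : dig k s x < k by apply: ltn_dig.
  have dy : dig k s y < k by apply: ltn_dig.
  apply: fev_and.
    by apply: fev_imp; rewrite fev_eq ?fev_dig ?(fev_K c1) !fev_var.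
  rewrite fev_eq (fev_hadj c4 (x' := x) (y' := y)) //.
  rewrite (fev_hadj c4 (x' := Ordinal dx) (y' := Ordinal dy)) /=; first last.
  - by rewrite fev_dig (fev_K c1) !fev_var.
  - by rewrite fev_dig (fev_K c1) !fev_var.
  by rewrite /adjn !insubT /=; do 2 case: (adj _ _ _).
rewrite (sum_digits (F := fun g : {ffun 'I_k -> 'I_k} => nat_of_bool (g \in auts H))).
  by rewrite -sum1_card [RHS]big_mkcond; apply: eq_bigr => g _; case: (_ \in _).
move=> g; rewrite /P inE; congr nat_of_bool; apply/'forall_forallP/andP.
  move=> h; split.
    apply/injectiveP => x y E; apply: val_inj; apply/eqP.
    by have /andP [+ _] := h x y; rewrite !ffunE E eqxx.
  apply/'forall_forallP => x y; have /andP [_] := h x y.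
  by rewrite !ffunE /adjn !valK /=.
move=> [/injectiveP gi /'forall_forallP ga] x y; rewrite !ffunE /adjn !valK /= ga andbT.
by apply/implyP => /eqP /val_inj /gi ->.
Qed.

Variables (G : sgraph 'I_n) (rank : 'I_n -> nat).
Hypothesis out_adj : forall u v, adj G u v = outr u v || outr v u.
Hypothesis out_rank : forall u v, outr u v -> rank u < rank v.

Definition answer (mode : nat) : nat :=
  if mode is 0 then hom H G else if mode is 1 then Defs.sub H G else Defs.ind H G.

Lemma codeof0 : codeof ([ffun=> ord0] : map) = 0.
Proof. by rewrite /codeof big1 // => v _; rewrite ffunE mul0n. Qed.

Lemma fev_res mode m M st : mode < 3 -> IB d n H out mode m M (2 ^ (k * k + k * k)) 0 st ->
  fev st [::] (eRes mode) = answer mode.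
Proof.
move=> m3 [cs _ ts]; have [c1 c2 c3 c4 c5] := cs.
have tot (b : bool) : fev st [::] (eTot mode b) =
    \sum_(p | okOS H mode p.1 p.2 && (oddOS H p.1 p.2 == b)) countOS outr p.1 p.2.
  rewrite big_mkcond -(sum_codes (fun p => if okOS H mode p.1 p.2 && (oddOS H p.1 p.2 == b)
     then countOS outr p.1 p.2 else 0)).
  apply: fev_sumo; first by rewrite fev_pw fev_add fev_mul (fev_K c1).
  move=> q acc; rewrite fev_mul fev_rd (fev_addr cs) !fev_cst fev_var /=.
  have E := ts _ 0 [ffun=> ord0] (ltn_ord q) isT; rewrite codeof0 in E.
  rewrite E /spec_tab ltn_ord orTb andbT.
  rewrite (@fev_and _ _ _ _ (okOS H mode (Oset k q) (Sset k q))
     (oddOS H (Oset k q) (Sset k q) == b)); first last.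
  - rewrite fev_eq (fev_odd c1 c4) fev_cst fev_var /=.
    by case: oddOS; case: b.
  - by rewrite (fev_ok c1 c4).
  case: (boolP (okOS _ _ _ _)) => [okq|] //=; case: eqP => // _; rewrite ?mul0n // mul1n.
  by apply: T_count; have [] := bestP c1 c2 c3 (okOS_cert okq).
have cq := count_queries H out_adj out_rank m3.
rewrite /eRes fev_div fev_sub (tot false) (tot true).
rewrite (eq_bigl (fun p => okOS H mode p.1 p.2 && ~~ oddOS H p.1 p.2)); last first.
  by move=> p; case: oddOS; rewrite ?andbF ?andbT.
rewrite cq [X in _ - X](eq_bigl (fun p => okOS H mode p.1 p.2 && oddOS H p.1 p.2)); last first.
  by move=> p; case: oddOS; rewrite ?andbF ?andbT.
rewrite addKn; case: mode m3 {cq tot ts} => [|[|[|//]]] _ /=.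
- by rewrite fev_cst divn1.
- have -> : #|[set phi | good H G 1 phi]| = Defs.sub H G * #|auts H| := count_copies H G.
  by rewrite fev_aut // mulnK // auts_gt0.
- have -> : #|[set phi | good H G 2 phi]| = Defs.ind H G * #|auts H| := count_induced H G.
  by rewrite fev_aut // mulnK // auts_gt0.
Qed.

End Answer.

Lemma cden_put env a e1 e2 st :
  cden env (Put a e1 e2) st = update st a (fev st env e1) (fev st env e2).
Proof. by []. Qed.
Lemma cden_then env c1 c2 st : cden env (Then c1 c2) st = cden env c2 (cden env c1 st).
Proof. by []. Qed.
Arguments cden : simpl never.
Arguments cco : simpl never.
Arguments ctb : simpl never.
Arguments tb : simpl never.

Lemma bnd_update m M st a i x : bnd m M st -> x <= (if smallarr a then m else M) ->
  bnd m M (update st a i x).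
Proof.
by move=> h hx b j; rewrite updateE; case: andP => [[/eqP -> _] //|_]; apply: h.
Qed.

(** * Degeneracy and peeling *)

Section Degeneracy.
Variables (n : nat) (G : sgraph 'I_n).

Definition degin (A : {set 'I_n}) (u : 'I_n) : nat := #|[set v in A | adj G u v]|.

Lemma degeneracyP : degenerate G (degeneracy G).
Proof. by rewrite /degeneracy; case: ex_minnP. Qed.

Lemma degeneracy_le : degeneracy G <= n.
Proof.
rewrite /degeneracy; case: ex_minnP => d _; apply.
have [D DG] := acyclic_orientation_ex G.
apply/existsP; exists D; rewrite DG; apply/forallP => u.
by rewrite -[n in _ <= n]card_ord; apply: max_card.
Qed.

(** Every edge inside A is counted at both ends, once as an outgoing and once as an incoming arc of
    an optimal orientation. *)
Lemma sum_degin (A : {set 'I_n}) : \sum_(u in A) degin A u <= 2 * degeneracy G * #|A|.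
Proof.
have /existsP [D /andP [/andP [/'forall_forallP oD _] /forallP dD]] := degeneracyP.
set d := degeneracy G in dD *.
have adjD u v : adj G u v = Defs.arc D u v || Defs.arc D v u.
  by have /andP [/eqP] := oD u v.
have degE u : degin A u <= \sum_(v in A) Defs.arc D u v + \sum_(v in A) Defs.arc D v u.
  rewrite /degin -sum1_card -big_split /=.
  rewrite (eq_bigl (fun v => (v \in A) && adj G u v)); last by move=> v; rewrite inE.
  rewrite big_mkcondr; apply: leq_sum => v _; rewrite adjD.
  by case: (Defs.arc D u v); case: (Defs.arc D v u).
have outE u : \sum_(v in A) Defs.arc D u v <= d.
  apply: leq_trans (dD u); rewrite /outdeg -sum1_card.
  rewrite [leqRHS](eq_bigl (fun v => Defs.arc D u v)); last by move=> v; rewrite inE.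
  rewrite big_mkcond [leqRHS]big_mkcond; apply: leq_sum => v _.
  by case: (v \in A); case: (Defs.arc D u v).
apply: (@leq_trans (\sum_(u in A) (\sum_(v in A) Defs.arc D u v + \sum_(v in A) Defs.arc D v u))).
  by apply: leq_sum => u _; apply: degE.
rewrite big_split /= [X in _ + X]exchange_big /= addnn -mul2n -mulnA leq_mul2l /=.
rewrite mulnC -sum_nat_const; apply: leq_sum => u _; exact: outE.
Qed.

(** The average degree inside A is at most twice the degeneracy, so by Markov's inequality at most
    half of A exceeds four times the degeneracy. *)
Lemma halving (A B : {set 'I_n}) D : 4 * degeneracy G <= D -> B \subset A ->
  (forall u, u \in B -> D < degin A u) -> 2 * #|B| <= #|A|.
Proof.
move=> hD BA hB.
have h1 : D.+1 * #|B| <= \sum_(u in A) degin A u.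
  rewrite mulnC -sum_nat_const.
  apply: (@leq_trans (\sum_(u in B) degin A u)); first exact: leq_sum.
  by rewrite [leqRHS](big_setID B) /= (setIidPr BA) leq_addr.
have h2 := leq_trans h1 (sum_degin A).
have h3 : (4 * degeneracy G).+1 * #|B| <= D.+1 * #|B| by rewrite leq_mul2r ltnS hD orbT.
have {h1 h2 h3} h : (4 * degeneracy G).+1 * #|B| <= 2 * degeneracy G * #|A|.
  exact: leq_trans h3 h2.
have [d0|d0] := posnP (degeneracy G).
  by move: h; rewrite d0 !muln0 mul1n mul0n leqn0 => /eqP ->.
rewrite -(leq_pmul2l d0); clear -h; nia.
Qed.

Variable l : 'I_n -> seq 'I_n.
Hypothesis Gl : adjacency_lists G l.

Lemma sum_list (u : 'I_n) (F : 'I_n -> nat) :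
  \sum_(j < size (l u)) F (nth u (l u) j) = \sum_(v | adj G u v) F v.
Proof.
rewrite -(big_mkord xpredT (fun j => F (nth u (l u) j))) -(big_nth u xpredT).
rewrite (perm_big _ (Gl u)) /= big_enum_cond /=.
by apply: eq_bigl => v; rewrite inE andbT.
Qed.

Lemma sum_degrees : \sum_(u < n) size (l u) <= 2 * degeneracy G * n.
Proof.
apply: (@leq_trans (\sum_(u in [set: 'I_n]) degin setT u)).
  rewrite [leqRHS](eq_bigl xpredT); last by move=> u; rewrite inE.
  apply: leq_sum => u _; rewrite -[size _]card_ord -sum1_card.
  rewrite (sum_list u (fun=> 1)) sum1_card /degin leq_eqVlt; apply/orP; left.
  by apply/eqP; apply: eq_card => v; rewrite !inE.
by apply: leq_trans (sum_degin _) _; rewrite cardsT card_ord.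
Qed.

End Degeneracy.

(** * Peeling *)

Definition eNbr j u := Rd 0 (Bin Add (Bin Add (Rd 5 u) (Cst 1)) j).
Definition eZero a := Rd a (Cst 0).
Definition vCount := For (Rd 0 (Rd 5 (Var 0))) (Put 9 (Cst 0)
  (Bin Add (eZero 9) (fEq (Rd 6 (eNbr (Var 0) (Var 1))) (Cst 0)))).
Definition vReset := Put 9 (Cst 0) (Cst 0).
Definition vTest := Put 10 (Cst 0) (fAnd (fEq (Rd 6 (Var 0)) (Cst 0)) (fLe (eZero 9) eD)).
Definition vRank := Put 6 (Var 0) (fIf (eZero 10)
  (Bin Add (Bin Add (Bin Mul (Var 1) eN) (Var 0)) (Cst 1)) (Rd 6 (Var 0))).
Definition vRem := Put 7 (Cst 0) (Bin Defs.Sub (eZero 7) (eZero 10)).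
Definition vBody := Then vReset (Then vCount (Then vTest (Then vRank vRem))).
Definition pPass := For (Bin Mul (fMin (Cst 1) (eZero 7)) eN) vBody.
Definition rPrev := Put 8 (Cst 0) (eZero 7).
(* The threshold grows when less than half of the remaining nodes were removed. *)
Definition rNext := Put 3 (Cst 0) (Bin Add eD (fLt (eZero 8) (Bin Mul (Cst 2) (eZero 7)))).
Definition pRound := Then rPrev (Then pPass rNext).
(** A number of rounds that suffices for every graph: the threshold never exceeds 4n, so at least n
    + 1 rounds do not raise it. *)
Definition pPeel := For (Bin Add (Bin Mul (Cst 5) eN) (Cst 1)) pRound.

Section Peel.
Variables (k n : nat) (G : sgraph 'I_n) (l : 'I_n -> seq 'I_n).
Hypothesis Gl : adjacency_lists G l.
Variables (inp off : nat -> nat) (m M : nat).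
Hypothesis inp_size : forall u : 'I_n, inp (off u) = size (l u).
Hypothesis inp_nbr : forall (u : 'I_n) j, j < size (l u) ->
  inp (off u + 1 + j) = nth u (l u) j.

Definition stat (s : store) : Prop :=
  [/\ forall i, s 0 i = inp i, s 2 0 = k, s 4 0 = n,
      forall u : 'I_n, s 5 u = off u & forall a, s 13 a = 0].

Lemma stat_ext s s' : (forall a i, a \in [:: 0; 2; 4; 5; 13] -> s' a i = s a i) ->
  stat s -> stat s'.
Proof. by move=> h [h1 h2 h3 h4 h5]; split=> *; rewrite h. Qed.

Definition alive (s : store) : {set 'I_n} := [set u : 'I_n | s 6 u == 0].
Definition nalive (s : store) (u : 'I_n) : nat := degin G (alive s) u.

Hypotheses (M2 : 1 < M) (M_n : 5 * n * n + 6 * n + 1 <= M) (m_d : 4 * degeneracy G <= m).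
Let bl := bitlen M.

Lemma size_l u : size (l u) <= n.
Proof.
rewrite (perm_size (Gl u)) -cardE -[n in _ <= n]card_ord; exact: max_card.
Qed.

Lemma rank_le (u : 'I_n) r : r <= 5 * n -> r * n + u + 1 <= M.
Proof.
move=> rn; apply: leq_trans M_n; have := ltn_ord u; have : r * n <= 5 * n * n.
  by rewrite leq_mul2r rn orbT.
by move: (r * n) (5 * n * n) => a b; clear; lia.
Qed.

Lemma small_M x : x <= 5 * n + 1 -> x <= M.
Proof. by move=> h; apply: leq_trans M_n; move: (5 * n * n) => a; clear -h; lia. Qed.

Lemma env_ur (u : 'I_n) r : r <= 5 * n -> envok [:: false; false] [:: val u; r] m M.
Proof.
move=> rn; apply: envok_cons; first by apply: small_M; have := ltn_ord u; rewrite /=; lia.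
by apply: envok_cons; [apply: small_M; lia | move=> j; rewrite !nth_nil].
Qed.

Lemma vCount_ok (u : 'I_n) r s : stat s -> bnd m M s -> r <= 5 * n -> s 9 0 = 0 ->
  let s' := cden [:: val u; r] vCount s in
  [/\ s' 9 0 = nalive s u, forall a i, a != 9 -> s' a i = s a i, bnd m M s'
    & cco [:: val u; r] vCount s <= (size (l u)).+1 * (ctb vCount m * bl)].
Proof.
move=> ss bs rn z9 s'.
have [s0 s2 s4 s5 _] := ss.
have un := ltn_ord u.
have he := env_ur u rn.
have eb : fev s [:: val u; r] (Rd 0 (Rd 5 (Var 0))) = size (l u).
  by rewrite !fevE s5 s0 inp_size.
pose F v := nat_of_bool (s 6 (val (v : 'I_n)) == 0).
pose I j s1 := [/\ s1 9 0 = \sum_(i < j) F (nth u (l u) i),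
   forall a i, a != 9 -> s1 a i = s a i & bnd m M s1].
have [||[i9 ifr ib] cost] := @for_inv [:: false; false] [:: val u; r] m M s M2 bs he
  (Rd 0 (Rd 5 (Var 0))) (Put 9 (Cst 0)
     (Bin Add (eZero 9) (fEq (Rd 6 (eNbr (Var 0) (Var 1))) (Cst 0)))) I
  (fun=> ctb (Put 9 (Cst 0) (Bin Add (eZero 9) (fEq (Rd 6 (eNbr (Var 0) (Var 1))) (Cst 0)))) m * bl)
  isT.
- by split; rewrite ?big_ord0.
- move=> j s1; rewrite eb => jl [j9 jfr jb].
  have he' : envok [:: false; false; false] [:: j; val u; r] m M.
    by apply: (envok_cons (s := false) _ he); apply: small_M; have := size_l u; lia.
  split; last by apply: (put_cost M2 jb he').
  rewrite cden_put fev_cst fev_add fev_eq !fevE j9 [nth _ _ _]/= [nth _ _ 0]/=.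
  rewrite (jfr 5) // s5 (jfr 0) // s0 inp_nbr // (jfr 6) //.
  have E : \sum_(i < j) F (nth u (l u) i) + (s 6 (nth u (l u) j) == 0)
     = \sum_(i < j.+1) F (nth u (l u) i) by rewrite big_ord_recr.
  rewrite E; split.
  + by rewrite updateE !eqxx.
  + by move=> a i na; rewrite updateE (negbTE na) jfr.
  + apply: bnd_update jb _; rewrite /=.
    apply: (@leq_trans j.+1); last by apply: small_M; have := size_l u; lia.
    rewrite -[X in _ <= X]card_ord -sum1_card; apply: leq_sum => i _.
    by rewrite /F; case: eqP.
rewrite eb in i9 cost; split.
- rewrite /s' /vCount i9 (sum_list Gl u F) /nalive /degin -sum1_card.
  rewrite [RHS](eq_bigl (fun v => adj G u v && (v \in alive s))); last first.
    by move=> v; rewrite !inE andbC.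
  by rewrite [RHS]big_mkcondr; apply: eq_bigr => v _; rewrite inE /F; case: eqP.
- exact: ifr.
- exact: ib.
- apply: leq_trans cost _; rewrite sum_nat_const card_ord /vCount ctb_for /bl.
  rewrite [(10 * _ + _) * _]mulnDl mulnDr addnC leq_add2l.
  by rewrite leq_mul2r leqnSn orbT.
Qed.

Definition removes (s : store) (u : 'I_n) : bool :=
  (s 6 u == 0) && (nalive s u <= s 3 0).

Lemma vBody_ok (u : 'I_n) r s : stat s -> bnd m M s -> r <= 5 * n ->
  let s' := cden [:: val u; r] vBody s in
  [/\ forall i, s' 6 i = if (i == u) && removes s u then r * n + u + 1 else s 6 i,
      s' 7 0 = s 7 0 - removes s u,
      forall a i, a \notin [:: 6; 7; 9; 10] -> s' a i = s a i, bnd m M s'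
    & cco [:: val u; r] vBody s <= (size (l u)).+1 * (ctb vBody m * bl)].
Proof.
move=> ss bs rn s'; have un := ltn_ord u.
have he := env_ur u rn.
set s1 := cden [:: val u; r] vReset s.
have e1 a i : s1 a i = if (a == 9) && (i == 0) then 0 else s a i by [].
have b1 : bnd m M s1 by apply: bnd_update.
have ss1 : stat s1 by apply: stat_ext ss => a i ha; rewrite e1; case: (a =P 9) ha => // ->.
have [c9 cfr cb ccost] := vCount_ok u ss1 b1 rn (erefl : s1 9 0 = 0).
set s2 := cden [:: val u; r] vCount s1 in c9 cfr cb.
have na : nalive s1 u = nalive s u by [].
have e2 a i : a != 9 -> s2 a i = s a i by move=> na9; rewrite cfr // e1 (negbTE na9).
set s3 := cden [:: val u; r] vTest s2.
have e3 : s3 = update s2 10 0 (removes s u).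
  rewrite /s3 /vTest cden_put fev_cst; congr (update _ _ _ _).
  apply: fev_and; first by rewrite fev_eq !fevE e2.
  by rewrite fev_le !fevE c9 na e2.
have b3 : bnd m M s3 by rewrite e3; apply: bnd_update cb _; case: removes; rewrite /=; apply: small_M; lia.
set s4 := cden [:: val u; r] vRank s3.
have e4 : s4 = update s3 6 u (if removes s u then r * n + u + 1 else s 6 u).
  rewrite /s4 /vRank cden_put fev_var; congr (update _ _ _ _).
  rewrite (@fev_if _ _ _ _ _ (removes s u)); last by rewrite !fevE e3.
  have s34 : s3 4 0 = n by rewrite e3 updateE /= e2 //; have [] := ss.
  by rewrite !fevE s34 e3 updateE /= e2.
have b4 : bnd m M s4.
  rewrite e4; apply: bnd_update b3 _; rewrite /=; case: ifP => _; first exact: rank_le.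
  exact: (bs 6).
have es' : s' = update s4 7 0 (s 7 0 - removes s u).
  rewrite /s' /vBody !cden_then -/s1 -/s2 -/s3 -/s4 /vRem cden_put fev_cst.
  congr (update _ _ _ _); rewrite !fevE e4 !updateE /= e3 !updateE /=.
  by rewrite e2.
split.
- move=> i; rewrite es' e4 e3 !updateE /=; have [->|iu] := eqVneq i u.
    by case: removes.
  by rewrite e2.
- by rewrite es'.
- move=> a i; rewrite !inE !negb_or => /and4P [n6 n7 n9 n10].
  by rewrite es' e4 e3 !updateE (negbTE n6) (negbTE n7) (negbTE n10) e2.
- rewrite es'; apply: bnd_update b4 _; rewrite /=.
  by apply: leq_trans (leq_subr _ _) (bs 7 0).
have q1 : cco [:: val u; r] vReset s <= ctb vReset m * bl by apply: (put_cost M2 bs he).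
have q3 : cco [:: val u; r] vTest s2 <= ctb vTest m * bl by apply: (put_cost M2 cb he).
have q4 : cco [:: val u; r] vRank s3 <= ctb vRank m * bl by apply: (put_cost M2 b3 he).
have q5 : cco [:: val u; r] vRem s4 <= ctb vRem m * bl by apply: (put_cost M2 b4 he).
have -> : cco [:: val u; r] vBody s = cco [:: val u; r] vReset s +
    (cco [:: val u; r] vCount s1 + (cco [:: val u; r] vTest s2 +
    (cco [:: val u; r] vRank s3 + cco [:: val u; r] vRem s4))) by [].
have -> : ctb vBody m = ctb vReset m + (ctb vCount m + (ctb vTest m +
    (ctb vRank m + ctb vRem m))) by [].
move: (ctb vReset m) (ctb vCount m) (ctb vTest m) (ctb vRank m) (ctb vRem m)
  q1 ccost q3 q4 q5 => x1 x2 x3 x4 x5.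
have w x : x * bl <= (size (l u)).+1 * (x * bl) by rewrite leq_pmull.
move=> /leq_trans /(_ (w _)) q1 q2 /leq_trans /(_ (w _)) q3.
move=> /leq_trans /(_ (w _)) q4 /leq_trans /(_ (w _)) q5.
by rewrite 4!mulnDl 4!mulnDr; do ![apply: leq_add => //].
Qed.

(** The neighbours that come after u in the removal order; nodes still present belong to them, as
    their ranks will be larger. *)
Definition late (s : store) (u : 'I_n) : {set 'I_n} :=
  [set v : 'I_n | adj G u v && ((s 6 v == 0) || (s 6 u < s 6 v))].

(* The rank of a removed node u is congruent to u + 1 modulo n, so ranks are distinct. *)
Definition ranked (t : nat) (s : store) : Prop := forall u : 'I_n, 0 < s 6 u ->
  [/\ s 6 u <= t, (s 6 u).-1 %% n = u & #|late s u| <= s 3 0].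

(** Degrees among the remaining nodes only decrease, so a node that was below the threshold at the
    start [s0] of the pass is still below it when its turn comes, and is removed. *)
Definition IU (r : nat) (s0 : store) (j : nat) (s : store) : Prop :=
  [/\ stat s /\ bnd m M s, s 7 0 = #|alive s|, ranked (r * n + j) s,
      alive s \subset alive s0 /\ (forall v : 'I_n, v \in alive s0 -> v < j ->
        degin G (alive s0) v <= s0 3 0 -> v \notin alive s)
    & forall a i, a \notin [:: 6; 7; 9; 10] -> s a i = s0 a i].

Lemma degin_sub (A B : {set 'I_n}) u : A \subset B -> degin G A u <= degin G B u.
Proof.
move=> /subsetP AB; apply: subset_leq_card; apply/subsetP => v.
by rewrite !inE => /andP [/AB -> ->].
Qed.

Lemma IU_step r s0 (u : 'I_n) s : r <= 5 * n -> IU r s0 u s ->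
  IU r s0 u.+1 (cden [:: val u; r] vBody s).
Proof.
move=> rn [[ss bs] s7 rk [al hd] fr].
have [e6 e7 efr eb _] := vBody_ok u ss bs rn.
set s' := cden _ vBody s in e6 e7 efr eb *.
have e3 : s' 3 0 = s 3 0 by apply: efr.
have f3 : s 3 0 = s0 3 0 by apply: fr.
have alE : alive s' = if removes s u then alive s :\ u else alive s.
  apply/setP => v; rewrite inE e6; have [->|vu] := eqVneq v u.
    rewrite eqxx /=; case: removes; last by rewrite inE.
    by rewrite !inE eqxx addn1.
  by rewrite val_eqE (negbTE vu) /=; case: removes; rewrite !inE // vu.
have als : alive s' \subset alive s.
  by rewrite alE; case: ifP => // _; apply: subsetDl.
split.
- split=> //; apply: stat_ext ss => a i ha; apply: efr.
  by move: ha; rewrite !inE => /or4P [||| /orP []] /eqP ->.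
- rewrite e7 s7 alE; case: (boolP (removes s u)) => [/andP [z _]|_]; last by rewrite subn0.
  by rewrite (cardsD1 u (alive s)) inE z /= addKn.
- move=> v v0; have [vu|vu] := eqVneq v u.
    subst v; rewrite e6 eqxx /= in v0 *; case: (boolP (removes s u)) v0 => [rm|nrm] v0.
      split; first by rewrite addn1 addnS.
        by rewrite addn1 /= modnMDl modn_small.
      (* Earlier ranks are smaller than the new one, so every neighbour after u is still present
         when u is removed, and the test has bounded their number. *)
      rewrite e3; have /andP [_] := rm; apply: leq_trans; apply: subset_leq_card.
      apply/subsetP => w; rewrite !inE !e6 eqxx rm /= => /andP [a].
      have wu : w != u by apply: contraTneq a => ->; rewrite adj_irr.
      rewrite val_eqE (negbTE wu) /= a andbT => /orP [//|].
      have [-> //|w0] := posnP (s 6 w).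
      have [h _ _] := rk w w0; clear -h; lia.
    have [h1 h2 h3] := rk u v0.
    split=> //; first by apply: leq_trans h1 _; rewrite leq_add2l.
    rewrite e3; apply: leq_trans h3; apply: subset_leq_card.
    by apply/subsetP => w; rewrite !inE !e6 (negbTE nrm) !andbF.
  have e6v : s' 6 v = s 6 v by rewrite e6 val_eqE (negbTE vu).
  rewrite e6v in v0 *; have [h1 h2 h3] := rk v v0.
  split=> //; first by apply: leq_trans h1 _; rewrite leq_add2l.
  rewrite e3; apply: leq_trans h3; apply: subset_leq_card.
  apply/subsetP => w; rewrite !inE e6v e6 => /andP [-> /=].
  have [wu|wu] := eqVneq w u; last by rewrite val_eqE (negbTE wu).
  by subst w; rewrite eqxx /=; case: (boolP (removes s u)) => [/andP [-> _]|].
- split; first exact: subset_trans als al.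
  move=> v v0; rewrite ltnS leq_eqVlt => /orP [/eqP vu|vu] dv; last first.
    by apply: contra (hd v v0 vu dv); apply: (subsetP als).
  have {vu} vu : v = u by apply: val_inj.
  subst v; rewrite alE; case: (boolP (removes s u)) => [_|]; first by rewrite !inE eqxx.
  rewrite negb_and => /orP [h|]; first by rewrite inE.
  by rewrite /nalive f3 (leq_trans (degin_sub _ al) dv).
- move=> a i ha; rewrite efr // fr //.
Qed.

Let dg := degeneracy G.
(** Bounds the number of rounds that start with a node left: at most 4 * dg of them raise the
    threshold, and the others halve the remainder. *)
Let R := 4 * dg + bitlen n.
Let pass_bound := 2 * dg * n + n + 2.

Lemma sum_sizes : \sum_(u < n) (size (l u)).+1 <= 2 * dg * n + n.
Proof.
rewrite (eq_bigr (fun u => size (l u) + 1)); last by move=> u _; rewrite addn1.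
rewrite big_split /= sum_nat_const card_ord muln1 leq_add2r; exact: sum_degrees.
Qed.

Lemma pPass_ok r s : r <= 5 * n -> stat s -> bnd m M s -> s 7 0 = #|alive s| ->
  ranked (r * n) s ->
  IU r s ((0 < s 7 0) * n) (cden [:: r] pPass s) /\
  cco [:: r] pPass s <= (if 0 < s 7 0 then 2 * dg * n + n + 1 else 1) * (ctb pPass m * bl).
Proof.
move=> rn ss bs s7 rk.
have he : envok [:: false] [:: r] m M.
  by apply: envok_cons; [apply: small_M; lia | move=> j; rewrite !nth_nil].
have eb : fev s [:: r] (Bin Mul (fMin (Cst 1) (eZero 7)) eN) = (0 < s 7 0) * n.
  have [_ _ s4 _ _] := ss; rewrite fev_mul fev_min !fevE s4; congr (_ * _).
  by case: (s 7 0) => // x; rewrite minnSS min0n.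
pose Y j := oapp (fun u : 'I_n => (size (l u)).+1 * (ctb vBody m * bl)) 0 (insub j).
have I0 : IU r s 0 s by split=> //; rewrite ?addn0.
have [|i1 cost] := for_inv (c := vBody) (I := IU r s) (Y := Y) M2 bs he
   (isT : wfs [:: false] (Bin Mul (fMin (Cst 1) (eZero 7)) eN)) I0.
  move=> j s1; rewrite eb => jb; have jn : j < n by move: jb; case: (0 < _); lia.
  move=> I1; split; first exact: (IU_step (u := Ordinal jn) rn I1).
  have [[ss1 bs1] _ _ _ _] := I1; rewrite /Y insubT /=.
  by have [_ _ _ _] := vBody_ok (Ordinal jn) ss1 bs1 rn.
rewrite eb in i1 cost; split; first exact: i1.
apply: leq_trans cost _; rewrite /pPass ctb_for /bl.
set t := 10 * _; set c := ctb vBody m.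
case: (0 < s 7 0); last by rewrite big_ord0 !mul1n mulnDl; apply: leq_addr.
rewrite mul1n (eq_bigr (fun u : 'I_n => (size (l u)).+1 * (c * bitlen M))); last first.
  by move=> u _; rewrite /Y valK.
rewrite -big_distrl /= [(t + c) * _]mulnDl mulnDr addnC; apply: leq_add.
  by rewrite leq_mul2r addn1 ltnS leq_addl orbT.
by rewrite leq_mul2r (leq_trans sum_sizes) ?leq_addr ?orbT.
Qed.

(** The threshold starts at 0 and rises by at most one per round, so [r - s 3 0] counts the rounds
    that did not raise it, in each of which at least half of the nodes went. *)
Definition IR (r : nat) (s : store) : Prop :=
  [/\ stat s /\ bnd m M s, s 7 0 = #|alive s|, ranked (r * n) s,
      s 3 0 <= 4 * dg /\ s 3 0 <= r
    & (0 < #|alive s| -> #|alive s| * 2 ^ (r - s 3 0) <= n) /\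
      forall a i, a \in [:: 11; 12] -> s a i = 0].

Lemma IR_active r s : IR r s -> 0 < s 7 0 -> r < R.
Proof.
move=> [_ -> _ [d1 d2] [h _]] /[dup] a0 /h {}h.
have : 2 ^ (r - s 3 0) <= n by apply: leq_trans h; rewrite leq_pmull.
move=> /leq_ltn_trans /(_ (ltn_bitlen n)); rewrite ltn_exp2l // => h2.
by rewrite /R; clear -h2 d1; lia.
Qed.

Lemma pRound_ok r s : r <= 5 * n -> IR r s ->
  IR r.+1 (cden [:: r] pRound s) /\
  cco [:: r] pRound s <= (if r < R then pass_bound else 1) * (ctb pRound m * bl).
Proof.
move=> rn ir; have [[ss bs] s7 rk [d1 d2] [hal z11]] := ir.
have he : envok [:: false] [:: r] m M.
  by apply: envok_cons; [apply: small_M; lia | move=> j; rewrite !nth_nil].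
set s1 := cden [:: r] rPrev s.
have e1 : s1 = update s 8 0 (s 7 0) by [].
have b1 : bnd m M s1 by rewrite e1; apply: (bnd_update _ bs); apply: (bs 7).
have ss1 : stat s1.
  by apply: stat_ext ss => a i; rewrite !inE e1 => /or4P [||| /orP []] /eqP ->.
have [[[ss2 b2] i7 rk2 [al2 hd2] fr2] cost2] := pPass_ok rn ss1 b1 s7 rk.
set s2 := cden [:: r] pPass s1 in ss2 b2 i7 rk2 al2 hd2 fr2.
set s3 := cden [:: r] rNext s2.
have f28 : s2 8 0 = #|alive s| by rewrite fr2 // e1 /= s7.
have f23 : s2 3 0 = s 3 0 by rewrite fr2.
have alE : alive s1 = alive s by [].
have e3 : s3 = update s2 3 0 (s 3 0 + (#|alive s| < 2 * #|alive s2|)).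
  rewrite /s3 /rNext cden_put fev_cst fev_add fev_lt; congr (update _ _ _ (_ + _)).
    by rewrite !fevE.
  by rewrite !fevE f28 i7.
have z1 : s1 7 0 = s 7 0 by [].
have cle : #|alive s2| <= #|alive s| by apply: subset_leq_card.
have hlow (u : 'I_n) : u \in alive s2 -> s 3 0 < degin G (alive s) u.
  move=> u2; rewrite ltnNge; apply/negP => du.
  have u1 : u \in alive s by apply: (subsetP al2).
  have a0 : 0 < #|alive s| by apply/card_gt0P; exists u.
  have := hd2 u u1 _ du; rewrite z1 s7 a0 mul1n => /(_ (ltn_ord u)).
  by rewrite u2.
set D' := s 3 0 + (#|alive s| < 2 * #|alive s2|) in e3.
(* Either the threshold rises, which [halving] excludes once it has reached 4 * dg, or at least half
   of the nodes were removed. *)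
have key : [/\ D' <= 4 * dg, D' <= r.+1
    & 0 < #|alive s2| -> #|alive s2| * 2 ^ (r.+1 - D') <= n].
  rewrite /D'; case: (ltnP (#|alive s|) (2 * #|alive s2|)) => hlt.
    rewrite addn1 subSS; split=> //.
      rewrite ltnNge; apply/negP => dge.
      by move: hlt; rewrite ltnNge (halving dge al2 hlow).
    move=> a2; apply: leq_trans (hal (leq_trans a2 cle)).
    by rewrite leq_mul2r cle orbT.
  rewrite addn0 subSn // expnS mulnA; split=> //; first exact: leqW.
  move=> a2; apply: leq_trans (hal (leq_trans a2 cle)).
  by rewrite leq_mul2r mulnC hlt orbT.
have [k1 k2 k3] := key.
have al3 : alive s3 = alive s2 by rewrite e3.
have ss3 : stat s3.
  by apply: stat_ext ss2 => a i; rewrite !inE e3 => /or4P [||| /orP []] /eqP ->.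
have b3 : bnd m M s3.
  by rewrite e3; apply: bnd_update b2 _; apply: leq_trans k1 m_d.
split.
  have -> : cden [:: r] pRound s = s3 by [].
  split; [by [] | by rewrite al3 -i7 e3 | | by rewrite e3 | ].
    move=> u u0; have u0' : 0 < s2 6 u by move: u0; rewrite e3.
    have [h1 h2 h3] := rk2 u u0'; split.
    - rewrite e3 updateE /=; apply: leq_trans h1 _.
      by rewrite mulSn addnC leq_add2r; case: (0 < _); rewrite ?mul1n ?mul0n.
    - by rewrite e3.
    - rewrite e3 updateE /=; apply: (@leq_trans #|late s2 u|).
        by apply: eq_leq; apply: eq_card => v; rewrite !inE.
      by apply: leq_trans h3 _; rewrite f23 /D' leq_addr.
  split; first by rewrite al3 e3.
  by move=> a i; rewrite !inE e3 => /orP [] /eqP ->; rewrite updateE /= fr2 // e1 updateE /= z11.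
have q1 : cco [:: r] rPrev s <= ctb rPrev m * bl by apply: (put_cost M2 bs he).
have q3 : cco [:: r] rNext s2 <= ctb rNext m * bl by apply: (put_cost M2 b2 he).
have -> : cco [:: r] pRound s = cco [:: r] rPrev s +
  (cco [:: r] pPass s1 + cco [:: r] rNext s2) by [].
have -> : ctb pRound m = ctb rPrev m + (ctb pPass m + ctb rNext m) by [].
set B := if r < R then _ else _.
have B0 : 0 < B by rewrite /B; case: ifP => // _; rewrite /pass_bound addn2.
have BP : (if 0 < s1 7 0 then 2 * dg * n + n + 1 else 1) <= B.
  rewrite z1; case: ifP => [/(IR_active ir)|_]; last exact: B0.
  by rewrite /B => ->; rewrite /pass_bound leq_add2l.
have {}cost2 := leq_trans cost2 (leq_mul BP (leqnn _)).
have w x : x * bl <= B * (x * bl) by rewrite leq_pmull.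
have {}q1 := leq_trans q1 (w _); have {}q3 := leq_trans q3 (w _).
by rewrite 2!mulnDl 2!mulnDr; do ![apply: leq_add => //].
Qed.

Lemma pPeel_ok s : IR 0 s ->
  let s' := cden [::] pPeel s in
  [/\ IR (5 * n + 1) s', forall u : 'I_n, 0 < s' 6 u
    & cco [::] pPeel s <= (R * pass_bound + 10 * n + 4) * (ctb pPeel m * bl)].
Proof.
move=> ir s'; have [[ss bs] _ _ _ _] := ir.
have he : envok [::] [::] m M by move=> i; rewrite !nth_nil.
have eb : fev s [::] (Bin Add (Bin Mul (Cst 5) eN) (Cst 1)) = 5 * n + 1.
  by have [_ _ s4 _ _] := ss; rewrite !fevE s4.
pose Y r := (if r < R then pass_bound else 1) * (ctb pRound m * bl).
have [|ir' cost] := for_inv (c := pRound) (I := IR) (Y := Y) M2 bs he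
   (isT : wfs [::] (Bin Add (Bin Mul (Cst 5) eN) (Cst 1))) ir.
  move=> r s1; rewrite eb addn1 ltnS => rn; exact: pRound_ok.
rewrite eb in ir' cost; split; first exact: ir'.
  have [_ s7 _ [d1 d2] [hal _]] := ir'; rewrite -/pPeel -/s' in s7 d1 d2 hal.
  have [a0|a0] := posnP #|alive s'|.
    move=> u; rewrite lt0n; apply/negP => z.
    by move/card0_eq: a0 => /(_ u); rewrite inE z.
  (* If a node were left, more than n halvings would have taken place, although [2 ^ n] already
     exceeds n. *)
  have := hal a0; rewrite leqNgt => /negP; case.
  have dn : s' 3 0 <= 4 * n by apply: leq_trans d1 _; rewrite leq_mul2l degeneracy_le.
  apply: (@leq_trans (2 ^ (5 * n + 1 - s' 3 0))); last by rewrite leq_pmull.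
  apply: (leq_trans (ltn_expl n (isT : 1 < 2))); rewrite leq_exp2l //.
  by clear -dn; lia.
apply: leq_trans cost _; rewrite /pPeel ctb_for /bl.
set t := 10 * _; set c := ctb pRound m.
have S : \sum_(r < 5 * n + 1) Y r <= (R * pass_bound + (5 * n + 1)) * (c * bitlen M).
  rewrite -big_distrl leq_mul2r; apply/orP; right.
  (* Every round is charged 1, and the first R rounds a full pass in addition. *)
  apply: (@leq_trans (\sum_(r < 5 * n + 1) ((if r < R then pass_bound else 0) + 1))).
    by apply: leq_sum => r _; case: ifP => _; rewrite ?leq_addr.
  rewrite big_split /= sum_nat_const card_ord muln1 leq_add2r.
  have -> : R * pass_bound = \sum_(r < R) pass_bound by rewrite sum_nat_const card_ord.
  pose F r := if r < R then pass_bound else 0.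
  have -> : \sum_(r < R) pass_bound = \sum_(r < R) F r.
    by apply: eq_bigr => r _; rewrite /F ltn_ord.
  have [le|lt] := leqP (5 * n + 1) R; first exact: (leq_sum_ord F le).
  rewrite -(subnKC (ltnW lt)) big_split_ord /=.
  rewrite [X in _ + X]big1 ?addn0 // => i _; by rewrite ltnNge leq_addr.
apply: leq_trans (leq_add S (leqnn _)) _.
rewrite [(t + c) * _]mulnDl mulnDr addnC; apply: leq_add; rewrite leq_mul2r; apply/orP; right.
  by clear; lia.
by clear; lia.
Qed.

End Peel.

(** * Rows of out-neighbours *)

Definition oLate := Put 10 (Cst 0) (fLt (Rd 6 (Var 1)) (Rd 6 (eNbr (Var 0) (Var 1)))).
(** Without a conditional, a neighbour of lower rank causes a 0 to be written into the first free
    cell, and the length is not advanced. With D + 1 cells per row this cell exists even when the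
    row is full, and the last one stays empty. *)
Definition oPut := Put 11 (Bin Add (Bin Mul (Var 1) eD1) (eZero 12))
  (Bin Mul (eZero 10) (Bin Add (eNbr (Var 0) (Var 1)) (Cst 1))).
Definition oCnt := Put 12 (Cst 0) (Bin Add (eZero 12) (eZero 10)).
Definition oBody := Then oLate (Then oPut oCnt).
Definition oReset := Put 12 (Cst 0) (Cst 0).
Definition oLoop := For (Rd 0 (Rd 5 (Var 0))) oBody.
Definition oRow := Then oReset oLoop.
Definition pOut := For eN oRow.

Section Rows.
Variables (k n : nat) (G : sgraph 'I_n) (l : 'I_n -> seq 'I_n).
Hypothesis Gl : adjacency_lists G l.
Variables (inp off : nat -> nat) (m M : nat).
Hypothesis inp_size : forall u : 'I_n, inp (off u) = size (l u).
Hypothesis inp_nbr : forall (u : 'I_n) j, j < size (l u) ->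
  inp (off u + 1 + j) = nth u (l u) j.
Hypotheses (M2 : 1 < M) (M_n : 5 * n * n + 6 * n + 1 <= M).
Let bl := bitlen M.

Local Notation stat := (stat k n inp off).

Variables (sA : store) (t : nat).
Hypotheses (statA : stat sA) (bndA : bnd m M sA) (rkA : ranked G t sA).
Hypothesis (posA : forall u : 'I_n, 0 < sA 6 u).
Hypothesis (zA : forall a i, a \in [:: 11; 12] -> sA a i = 0).
Let D := sA 3 0.

Definition rowl (u : 'I_n) (j : nat) : seq nat :=
  [seq (val v).+1 | v : 'I_n <- [seq v : 'I_n <- take j (l u) | sA 6 u < sA 6 v]].
Definition row (u : 'I_n) : seq nat := rowl u (size (l u)).

Lemma uniq_l u : uniq (l u).
Proof. by rewrite (perm_uniq (Gl u)) enum_uniq. Qed.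

Lemma mem_l u v : (v \in l u) = adj G u v.
Proof. by rewrite (perm_mem (Gl u)) mem_enum inE. Qed.

Lemma size_row u : size (row u) <= D.
Proof.
have [_ _ h] := rkA (posA u); apply: leq_trans h.
rewrite /row /rowl take_size size_map.
have /card_uniqP <- : uniq [seq v : 'I_n <- l u | sA 6 u < sA 6 v] by rewrite filter_uniq ?uniq_l.
apply: subset_leq_card; apply/subsetP => v.
by rewrite mem_filter mem_l inE => /andP [-> ->]; rewrite orbT.
Qed.

Lemma size_rowl u j : size (rowl u j) <= D.
Proof.
apply: leq_trans (size_row u); rewrite /row /rowl take_size !size_map !size_filter.
by rewrite -[X in _ <= count _ X](cat_take_drop j (l u)) count_cat leq_addr.
Qed.

Lemma rowlS u j : j < size (l u) -> rowl u j.+1 =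
  if sA 6 u < sA 6 (nth u (l u) j) then rcons (rowl u j) (val (nth u (l u) j)).+1
  else rowl u j.
Proof.
move=> jl; rewrite /rowl (take_nth u jl) filter_rcons; case: ifP => // _.
by rewrite map_rcons.
Qed.

Lemma row_addr x y x' y' : y <= D -> y' <= D -> x * D.+1 + y = x' * D.+1 + y' ->
  x = x' /\ y = y'.
Proof.
move=> yD yD' E; have := congr1 (divn^~ D.+1) E; have := congr1 (modn^~ D.+1) E.
by rewrite !modnMDl !divnMDl // !modn_small // !divn_small // !addn0.
Qed.

Definition IJ (u : 'I_n) (s0 : store) (j : nat) (s : store) : Prop :=
  [/\ s 12 0 = size (rowl u j),
      forall x y, y <= D -> s 11 (x * D.+1 + y) =
        if x == u then nth 0 (rowl u j) y else s0 11 (x * D.+1 + y),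
      forall a i, a \notin [:: 10; 11; 12] -> s a i = sA a i & bnd m M s].

Lemma nM x : x <= n -> x <= M.
Proof. by move=> h; apply: leq_trans M_n; move: (5 * n * n) => a; clear -h; lia. Qed.

Lemma oBody_ok (u : 'I_n) s0 j s : j < size (l u) -> IJ u s0 j s ->
  IJ u s0 j.+1 (cden [:: j; val u] oBody s) /\
  cco [:: j; val u] oBody s <= ctb oBody m * bl.
Proof.
move=> jl [i12 i11 fr bs]; have [a0 a2 a4 a5 _] := statA.
have he : envok [:: false; false] [:: j; val u] m M.
  apply: envok_cons; first by apply: nM; have := size_l Gl u; lia.
  by apply: envok_cons; [apply: nM (ltnW (ltn_ord u)) | move=> i; rewrite !nth_nil].
set v := nth u (l u) j; set X := sA 6 u < sA 6 v.
have nb st' : (forall a i, a \notin [:: 10; 11; 12] -> st' a i = sA a i) ->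
    fev st' [:: j; val u] (eNbr (Var 0) (Var 1)) = v.
  by move=> f; rewrite !fevE /= (f 0) // (f 5) // a0 a5 inp_nbr.
set s1 := cden [:: j; val u] oLate s.
have e1 : s1 = update s 10 0 X.
  rewrite /s1 /oLate cden_put fev_cst fev_lt; congr (update _ _ _ (nat_of_bool _)).
  rewrite /X [fev _ _ (Rd 6 (Var 1))]fev_rd [fev _ _ (Rd 6 _)]fev_rd (nb s fr).
  by rewrite fev_var /= !fr.
have b1 : bnd m M s1 by rewrite e1; apply: (bnd_update _ bs); apply: leq_trans (leq_b1 _) _; exact: ltnW.
have f1 a i : a \notin [:: 10; 11; 12] -> s1 a i = sA a i.
  by move=> ha; rewrite e1 updateE; case: (a =P 10) ha => [-> //|_] ha; rewrite fr.
set s2 := cden [:: j; val u] oPut s1.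
have e2 : s2 = update s1 11 (u * D.+1 + size (rowl u j)) (X * v.+1).
  rewrite /s2 /oPut cden_put !fev_add !fev_mul (fev_D1 (d := D)); last exact: f1.
  rewrite fev_add (nb s1 f1) !fevE addn1 e1 !updateE /= i12.
  by [].
have b2 : bnd m M s2.
  rewrite e2; apply: (bnd_update _ b1); rewrite /=; apply: nM.
  by case: (X); rewrite ?mul1n ?mul0n.
set s3 := cden [:: j; val u] oBody s.
have e3 : s3 = update s2 12 0 (size (rowl u j) + X).
  have -> : s3 = cden [:: j; val u] oCnt s2 by [].
  rewrite /oCnt cden_put fev_cst fev_add; congr (update _ _ _ (_ + _)).
    by rewrite !fevE e2 e1 !updateE /= i12.
  by rewrite !fevE e2 e1 !updateE.
split.
  split.
  - by rewrite e3 updateE /= rowlS // -/v -/X; case: (X); rewrite ?size_rcons ?addn1 ?addn0.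
  - move=> x y yD; rewrite e3 e2 !updateE /=; case: eqP => [E|nE].
      have [-> ->] := row_addr yD (size_rowl u j) E; rewrite eqxx rowlS // -/v -/X.
      case: (X); first by rewrite nth_rcons ltnn eqxx mul1n.
      by rewrite nth_default.
    rewrite e1 updateE /= i11 //; case: eqP => // xu; rewrite rowlS // -/v -/X.
    case: (X) => //; rewrite nth_rcons; case: ltngtP => // [lt|ey].
      by rewrite nth_default // ltnW.
    by case: nE; rewrite xu ey.
  - move=> a i ha; rewrite e3 e2 !updateE.
    by case: (a =P 12) ha => [-> //|_] ha; case: (a =P 11) ha => [-> //|_] ha; rewrite f1.
  - rewrite e3; apply: (bnd_update _ b2); rewrite /=.
    have -> : size (rowl u j) + X = size (rowl u j.+1).
      by rewrite rowlS // -/v -/X; case: (X); rewrite ?size_rcons ?addn1 ?addn0.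
    apply: nM; apply: leq_trans (size_l Gl u); rewrite /rowl size_map size_filter.
    by apply: leq_trans (count_size _ _) _; rewrite size_take; case: ifP => // /ltnW.
have q1 : cco [:: j; val u] oLate s <= ctb oLate m * bl by apply: (put_cost M2 bs he).
have q2 : cco [:: j; val u] oPut s1 <= ctb oPut m * bl by apply: (put_cost M2 b1 he).
have q3 : cco [:: j; val u] oCnt s2 <= ctb oCnt m * bl by apply: (put_cost M2 b2 he).
have -> : cco [:: j; val u] oBody s = cco [:: j; val u] oLate s +
  (cco [:: j; val u] oPut s1 + cco [:: j; val u] oCnt s2) by [].
have -> : ctb oBody m = ctb oLate m + (ctb oPut m + ctb oCnt m) by [].
rewrite 2!mulnDl; exact: leq_add q1 (leq_add q2 q3).
Qed.

Definition rown (x y : nat) : nat := oapp (fun u => nth 0 (row u) y) 0 (insub x).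

Definition IO (u : nat) (s : store) : Prop :=
  [/\ forall x y, y <= D -> s 11 (x * D.+1 + y) = if x < u then rown x y else 0,
      forall a i, a \notin [:: 10; 11; 12] -> s a i = sA a i & bnd m M s].

Lemma oRow_ok (u : 'I_n) s : IO u s ->
  IO u.+1 (cden [:: val u] oRow s) /\
  cco [:: val u] oRow s <= (size (l u)).+1 * (ctb oRow m * bl).
Proof.
move=> [i11 fr bs]; have [a0 a2 a4 a5 _] := statA.
have he : envok [:: false] [:: val u] m M.
  by apply: envok_cons; [apply: nM (ltnW (ltn_ord u)) | move=> i; rewrite !nth_nil].
set s1 := cden [:: val u] oReset s.
have e1 : s1 = update s 12 0 0 by [].
have b1 : bnd m M s1 by rewrite e1; apply: (bnd_update _ bs).
have f1 a i : a \notin [:: 10; 11; 12] -> s1 a i = sA a i.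
  by move=> ha; rewrite e1 updateE; case: (a =P 12) ha => [-> //|_] ha; rewrite fr.
have eb : fev s1 [:: val u] (Rd 0 (Rd 5 (Var 0))) = size (l u).
  by rewrite !fevE /= !f1 // a5 a0 inp_size.
have J0 : IJ u s 0 s1.
  split.
  - by rewrite e1 /rowl take0.
  - move=> x y yD; rewrite e1 updateE /=; case: eqP => // ->.
    by rewrite i11 // ltnn /rowl take0 nth_nil.
  - exact: f1.
  - exact: b1.
have [|[j12 j11 jfr jb] cost] := for_inv (c := oBody) (I := IJ u s)
   (Y := fun=> ctb oBody m * bl) M2 b1 he
   (isT : wfs [:: false] (Rd 0 (Rd 5 (Var 0)))) J0.
  by move=> j s2; rewrite eb => jl; apply: oBody_ok.
rewrite eb in j12 j11 cost; split.
  have -> : cden [:: val u] oRow s = cden [:: val u] oLoop s1 by [].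
  split; [|exact: jfr|exact: jb].
  move=> x y yD; rewrite j11 //; case: eqP => [->|/eqP xu].
    by rewrite ltnSn /rown valK.
  by rewrite i11 // [RHS]/= [x < u.+1]ltnS [x <= u]leq_eqVlt (negbTE xu).
have q1 : cco [:: val u] oReset s <= ctb oReset m * bl by apply: (put_cost M2 bs he).
have -> : cco [:: val u] oRow s = cco [:: val u] oReset s + cco [:: val u] oLoop s1 by [].
have -> : ctb oRow m = ctb oReset m + ctb oLoop m by [].
rewrite mulnDl mulnDr; apply: leq_add; first by apply: leq_trans q1 _; rewrite leq_pmull.
apply: leq_trans cost _; rewrite sum_nat_const card_ord /oLoop ctb_for /bl.
rewrite [(10 * _ + _) * _]mulnDl mulnDr addnC leq_add2l.
by rewrite leq_mul2r leqnSn orbT.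
Qed.

Lemma pOut_ok : let s' := cden [::] pOut sA in
  [/\ IO n s' & cco [::] pOut sA <= (2 * degeneracy G * n + n + 1) * (ctb pOut m * bl)].
Proof.
have [a0 a2 a4 a5 _] := statA.
have he : envok [::] [::] m M by move=> i; rewrite !nth_nil.
have eb : fev sA [::] eN = n by rewrite (fev_N a4).
have O0 : IO 0 sA by split=> //; move=> x y _; rewrite zA.
pose Y j := oapp (fun u : 'I_n => (size (l u)).+1 * (ctb oRow m * bl)) 0 (insub j).
have [|io cost] := for_inv (c := oRow) (I := IO) (Y := Y) M2 bndA he (isT : wfs [::] eN) O0.
  move=> j s; rewrite eb => jn ij; rewrite /Y insubT /=.
  exact: (oRow_ok (u := Ordinal jn)).
rewrite eb in io cost; split; first exact: io.
apply: leq_trans cost _; rewrite /pOut ctb_for /bl.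
set T := 10 * _; set c := ctb oRow m.
rewrite (eq_bigr (fun u : 'I_n => (size (l u)).+1 * (c * bitlen M))); last first.
  by move=> u _; rewrite /Y valK.
rewrite -big_distrl /= [(T + c) * _]mulnDl mulnDr addnC; apply: leq_add.
  by rewrite leq_mul2r addn1 ltnS leq_addl orbT.
by rewrite leq_mul2r (leq_trans (sum_sizes Gl)) ?leq_addr ?orbT.
Qed.

Section Final.
Variable s' : store.
Hypothesis io : IO n s'.

Lemma rown_le x y : rown x y <= n.
Proof.
rewrite /rown; case: insubP => //= u _ _.
have [lt|ge] := ltnP y (size (row u)); last by rewrite nth_default.
have /mapP [v _ ->] := mem_nth 0 lt; exact: ltn_ord.
Qed.

Lemma out_rows a : s' 11 a <= n.
Proof.
have [h _ _] := io; rewrite (divn_eq a D.+1) h; last by rewrite -ltnS ltn_mod.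
by case: ifP => // _; apply: rown_le.
Qed.

Lemma out_last_row u : u < n -> s' 11 (u * D.+1 + D) = 0.
Proof.
have [h _ _] := io => un; rewrite h // un /rown insubT /=.
by rewrite nth_default // size_row.
Qed.

Lemma isout_rows (u v : 'I_n) : isout D (s' 11) u.+1 v.+1 = adj G u v && (sA 6 u < sA 6 v).
Proof.
have [h _ _] := io; rewrite /isout /outw subn1 /=.
have E (j : 'I_D.+1) : s' 11 (u * D.+1 + j) = nth 0 (row u) j.
  rewrite h; last by rewrite -ltnS ltn_ord.
  by rewrite ltn_ord /rown valK.
transitivity (v.+1 \in row u).
  apply/existsP/idP => [[j]|]; rewrite ?E.
    move=> /eqP Ej; rewrite -Ej mem_nth // ltnNge; apply/negP => ge.
    by move: Ej; rewrite nth_default.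
  move=> /(nthP 0) [j jr Ej]; have jD : j < D.+1 by rewrite ltnS ltnW // (leq_trans jr (size_row u)).
  by exists (Ordinal jD); rewrite E /= Ej.
rewrite /row /rowl take_size; apply/mapP/andP => [[w]|[a r]].
  by rewrite mem_filter mem_l => /andP [r a] [] /val_inj ->.
by exists v => //; rewrite mem_filter r mem_l.
Qed.

End Final.
End Rows.

(** * Reading the input *)

Definition skip (inp : nat -> nat) (p u : nat) : nat :=
  iter u (fun acc => acc + (inp acc + 1)) p.

Lemma skip_rows (inp : nat -> nat) (rows : seq (seq nat)) p :
  let data := flatten [seq size r :: r | r <- rows] in
  (forall i, i < size data -> inp (p + i) = nth 0 data i) ->
  skip inp p (size rows) = p + size data /\
  forall i, i < size rows -> inp (skip inp p i) = size (nth [::] rows i) /\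
    forall j, j < size (nth [::] rows i) ->
      inp (skip inp p i + 1 + j) = nth 0 (nth [::] rows i) j.
Proof.
elim: rows p => [|r rows IH] p data h; first by rewrite addn0.
have p0 : inp p = size r by rewrite -[p]addn0 h.
have skS i : skip inp p i.+1 = skip inp (p + (size r).+1) i.
  by rewrite /skip iterSr p0 addn1.
have [|h1 h2] := IH (p + (size r).+1).
  move=> i il; rewrite -addnA h; last by rewrite /data /= size_cat addSn ltnS ltn_add2l.
  by rewrite /data /= nth_cat addKn ltnNge leq_addr.
split; first by rewrite -[size (r :: rows)]/(size rows).+1 skS h1 /data /= size_cat -addnA.
case=> [|i] il; last by rewrite skS; apply: h2.
split; first exact: p0.
move=> j jr; rewrite /= -addnA add1n h; last by rewrite /data /= size_cat ltnS ltn_addr.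
by rewrite /data /= nth_cat jr.
Qed.

Lemma skip_encode (inp : nat -> nat) n (l : 'I_n -> seq 'I_n) b :
  (forall i, i < size (encode l) -> inp (b + i) = nth 0 (encode l) i) ->
  [/\ inp b = n, skip inp (b + 1) n = b + size (encode l)
    & forall u : 'I_n, inp (skip inp (b + 1) u) = size (l u) /\
      forall j, j < size (l u) -> inp (skip inp (b + 1) u + 1 + j) = nth u (l u) j].
Proof.
move=> h; pose rows := [seq [seq val v | v <- l u] | u <- enum 'I_n].
have rowE : flatten [seq size r :: r | r <- rows] =
    flatten [seq size (l u) :: [seq val v | v <- l u] | u <- enum 'I_n].
  by rewrite /rows -map_comp; congr flatten; apply: eq_map => u /=; rewrite size_map.
have szr : size rows = n by rewrite size_map size_enum_ord.
have nthr (u : 'I_n) : nth [::] rows u = [seq val v | v <- l u].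
  by rewrite (nth_map u) ?size_enum_ord // nth_ord_enum.
have [|h1 h2] := @skip_rows inp rows (b + 1).
  by move=> i; rewrite rowE => il; rewrite -addnA h.
split.
- by rewrite -{1}[b]addn0 h.
- by rewrite -{1}szr h1 rowE /encode /= -addnA add1n.
- move=> u; have := h2 u; rewrite szr nthr size_map => /(_ (ltn_ord u)) [-> h3].
  by split=> // j jl; rewrite h3 // (nth_map u).
Qed.

Definition oOff := Put 5 (Bin Add (Var 0) (Cst 1))
  (Bin Add (Rd 5 (Var 0)) (Bin Add (Rd 0 (Rd 5 (Var 0))) (Cst 1))).
Definition pOff := For eN oOff.
Definition iK := Put 2 (Cst 0) (Rd 0 (Cst 0)).
(* If H is empty then G is not read at all: the time bound does not allow it. *)
Definition iN := Put 4 (Cst 0) (Bin Mul (fMin (Cst 1) eK) (Rd 0 (ePos eK))).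
Definition iOff := Put 5 (Cst 0) (Bin Add (ePos eK) (Cst 1)).
Definition iRem := Put 7 (Cst 0) eN.
Definition oRes mode := Put 1 (Cst 0) (eRes mode).
Definition prog mode := Then iK (Then iN (Then iOff (Then iRem (Then pOff
  (Then pPeel (Then pOut (Then (pB mode) (oRes mode)))))))).

Lemma wf_prog mode : mode < 3 -> wfac (prog mode).
Proof. by case: mode => [|[|[|//]]] _; vm_compute. Qed.

Lemma pr_ctb c : pr (ctb c).
Proof.
elim: c => [a e1 e2|c1 IH1 c2 IH2|e c IH].
- by apply: pr_add (pr_cst 2); apply: pr_mul (pr_cst 2) _; apply: pr_add; apply: pr_tb.
- exact: pr_add.
- by apply: pr_add IH; apply: pr_mul (pr_cst 10) (pr_tb e).
Qed.

Lemma fev_pos st inp env u : (forall i, st 0 i = inp i) ->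
  fev st env (ePos u) = skip inp 1 (fev st env u).
Proof.
move=> h; rewrite /ePos; fcall; rewrite /dPos fev_iter fev_var fev_cst /skip /=.
by elim: (fev st env u) => //= i ->; rewrite !fevE /= h.
Qed.

Lemma hadj_ok st inp k (H : sgraph 'I_k) lH : (forall i, st 0 i = inp i) -> st 2 0 = k ->
  adjacency_lists H lH ->
  (forall x : 'I_k, inp (skip inp 1 x) = size (lH x) /\
     forall j, j < size (lH x) -> inp (skip inp 1 x + 1 + j) = nth x (lH x) j) ->
  forall x y : 'I_k, fev st [:: val x; val y; 0; 0] dHadj = adj H x y.
Proof.
move=> h stK Hl hl x y; have [hs hn] := hl x.
have E : fev st [:: val x; val y; 0; 0] dHadj =
    [exists j : 'I_(size (lH x)), val (nth x (lH x) j) == y].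
  apply: fev_exo.
    rewrite fev_min (fev_K stK) fev_rd (fev_pos _ _ h) h fev_var /= hs.
    by apply/minn_idPr; apply: size_l.
  move=> j acc; rewrite fev_eq fev_rd fev_add (fev_pos _ _ h) h !fevE /=.
  by rewrite [j + 1]addnC addnA hn.
rewrite E -(mem_l Hl); congr nat_of_bool; apply/existsP/(nthP x) => [[j /eqP /val_inj E']|[j jl E']].
  by exists (val j); first exact: ltn_ord.
by exists (Ordinal jl); rewrite /= E'.
Qed.

(** * The whole program *)

Section Run.
Variables (k n : nat) (H : sgraph 'I_k) (G : sgraph 'I_n).
Variables (lH : 'I_k -> seq 'I_k) (l : 'I_n -> seq 'I_n).
Hypotheses (Hl : adjacency_lists H lH) (Gl : adjacency_lists G l).
Variables (inp : nat -> nat) (st0 : store) (m M mode : nat).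
Hypothesis mode3 : mode < 3.
Hypotheses (st0_inp : forall i, st0 0 i = inp i) (st0_0 : forall a i, a != 0 -> st0 a i = 0).
Let p := skip inp 1 k.
Let off := skip inp (p + 1).
Hypothesis inp0 : inp 0 = k.
Hypothesis inpH : forall x : 'I_k, inp (skip inp 1 x) = size (lH x) /\
     forall j, j < size (lH x) -> inp (skip inp 1 x + 1 + j) = nth x (lH x) j.
(** Here n is the size that the program works with: for k = 0 it is 0, whatever graph is in the
    input. *)
Hypothesis inpN : minn 1 k * inp p = n.
Hypothesis inpG : forall u : 'I_n, inp (off u) = size (l u) /\
     forall j, j < size (l u) -> inp (off u + 1 + j) = nth u (l u) j.
Let dg := degeneracy G.
Hypotheses (inp_le : forall i, inp i <= M) (off_le : forall u, u <= n -> off u <= M).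
Hypotheses (M2 : 1 < M) (M_n : 5 * n * n + 6 * n + 1 <= M).
Hypothesis m_d : 2 ^ (k * k + k * k) + k.+1 + 4 * dg <= m.
Hypothesis Mtab : Tbound k n <= M.
Hypothesis MZ : (n.+1 * (4 * dg).+1 ^ k) ^ k <= M.
Let bl := bitlen M.
Let w := taum mode H.
Let Zmax := maxn 1 n ^ w * ((4 * dg).+1 ^ k) ^ k.
Let R := 4 * dg + bitlen n.
Let pass_bound := 2 * dg * n + n + 2.

Lemma pOff_ok s : bnd m M s -> s 4 0 = n -> (forall i, s 0 i = inp i) -> s 5 0 = p + 1 ->
  let s' := cden [::] pOff s in
  [/\ forall u, u <= n -> s' 5 u = off u, forall a i, a != 5 -> s' a i = s a i, bnd m M s'
    & cco [::] pOff s <= n.+1 * (ctb pOff m * bl)].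
Proof.
move=> bs s4 s0 s5; have he : envok [::] [::] m M by move=> i; rewrite !nth_nil.
have eb : fev s [::] eN = n by rewrite (fev_N s4).
pose I j s1 := [/\ forall u, u <= j -> s1 5 u = off u,
  forall a i, a != 5 -> s1 a i = s a i & bnd m M s1].
have I0 : I 0 s by split=> //; move=> u; rewrite leqn0 => /eqP ->.
have [|[i5 ifr ib] cost] := for_inv (c := oOff) (I := I) (Y := fun=> ctb oOff m * bl)
    M2 bs he (isT : wfs [::] eN) I0.
  move=> j s1; rewrite eb => jn [j5 jfr jb].
  have he' : envok [:: false] [:: j] m M.
    apply: envok_cons; last by move=> i; rewrite !nth_nil.
    by apply: leq_trans M_n; move: (5 * n * n) => a; clear -jn; lia.
  split; last by apply: (put_cost M2 jb he').
  have E : cden [:: j] oOff s1 = update s1 5 j.+1 (off j.+1).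
    rewrite /oOff cden_put fev_add fev_var fev_cst /= addn1; congr (update _ _ _ _).
    by rewrite !fevE /= j5 // (jfr 0) // s0.
  rewrite E; split.
  - move=> u; rewrite updateE eqxx /= leq_eqVlt => /orP [/eqP ->|uj]; first by rewrite eqxx.
    by rewrite ltn_eqF //; apply: j5.
  - by move=> a i na; rewrite updateE (negbTE na) jfr.
  - by apply: (bnd_update _ jb); apply: off_le.
rewrite eb in i5 cost; split; [exact: i5 | exact: ifr | exact: ib |].
apply: leq_trans cost _; rewrite sum_nat_const card_ord /pOff ctb_for /bl.
rewrite [(10 * _ + _) * _]mulnDl mulnDr addnC leq_add2l.
by rewrite leq_mul2r leqnSn orbT.
Qed.

Definition time_bound := n + (R * pass_bound + 10 * n) + (2 * dg * n + n)
  + (2 ^ (k * k + k * k)).+1 * (k.+2 * Zmax.+1) + 12.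

Lemma run_ok : cden [::] (prog mode) st0 1 0 = answer H G mode /\
  cco [::] (prog mode) st0 <= time_bound * (ctb (prog mode) m * bl).
Proof.
have he : envok [::] [::] m M by move=> i; rewrite !nth_nil.
have km : k <= m by clear -m_d; lia.
have dm : 4 * dg <= m by clear -m_d; lia.
have nM : n <= M by apply: leq_trans M_n; move: (5 * n * n) => a; clear; lia.
have b0 : bnd m M st0.
  move=> a i; case: (altP (a =P 0)) => [->|na]; first by rewrite st0_inp; apply: inp_le.
  by rewrite st0_0.
set s1 := cden [::] iK st0.
have e1 : s1 = update st0 2 0 k.
  by rewrite /s1 /iK cden_put !fevE st0_inp inp0.
have b1 : bnd m M s1 by rewrite e1; apply: (bnd_update _ b0).
have c12 : s1 2 0 = k by rewrite e1.
have c10 i : s1 0 i = inp i by rewrite e1 updateE /= st0_inp.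
set s2 := cden [::] iN s1.
have e2 : s2 = update s1 4 0 n.
  rewrite /s2 /iN cden_put fev_cst fev_mul fev_min fev_cst fev_rd (fev_K c12).
  by rewrite (fev_pos _ _ c10) (fev_K c12) c10 inpN.
have b2 : bnd m M s2 by rewrite e2; apply: (bnd_update _ b1).
set s3 := cden [::] iOff s2.
have e3 : s3 = update s2 5 0 (p + 1).
  have c20 i : s2 0 i = inp i by rewrite e2 updateE /= c10.
  have c22 : s2 2 0 = k by rewrite e2 updateE /= c12.
  rewrite /s3 /iOff cden_put fev_cst fev_add fev_cst (fev_pos _ _ c20).
  by rewrite (fev_K c22).
have b3 : bnd m M s3 by rewrite e3; apply: (bnd_update _ b2); apply: (off_le (leq0n n)).
set s4 := cden [::] iRem s3.
have e4 : s4 = update s3 7 0 n.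
  by rewrite /s4 /iRem cden_put fev_cst (fev_N (n := n)) // e3 e2.
have b4 : bnd m M s4 by rewrite e4; apply: (bnd_update _ b3).
have z4 a i : a \notin [:: 0; 2; 4; 5; 7] -> s4 a i = 0.
  rewrite !inE !negb_or => /and5P [n0 n2 n4 n5 n7]; rewrite e4 e3 e2 e1 !updateE.
  by rewrite (negbTE n2) (negbTE n4) (negbTE n5) (negbTE n7) st0_0.
have c40 i : s4 0 i = inp i by rewrite e4 e3 e2 !updateE /= c10.
have c42 : s4 2 0 = k by rewrite e4 e3 e2 !updateE /= c12.
have c44 : s4 4 0 = n by rewrite e4 e3 e2.
have c45 : s4 5 0 = p + 1 by rewrite e4 e3.
have c47 : s4 7 0 = n by rewrite e4.
have [o5 ofr b5 q5] := pOff_ok b4 c44 c40 c45.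
set s5 := cden [::] pOff s4 in o5 ofr b5.
have st5 : stat k n inp off s5.
  split.
  - by move=> i; rewrite ofr.
  - by rewrite ofr.
  - by rewrite ofr.
  - by move=> u; apply: o5; apply: ltnW.
  - by move=> a; rewrite ofr // z4.
have al5 : alive n s5 = setT.
  by apply/setP => u; rewrite !inE ofr // z4.
have ir5 : IR k G inp off m M 0 s5.
  split.
  - by [].
  - by rewrite al5 cardsT card_ord ofr.
  - by move=> u; rewrite ofr // z4.
  - by rewrite ofr // z4.
  - split; first by rewrite ofr // z4 // subnn muln1 al5 cardsT card_ord.
    by move=> a i; rewrite !inE => /orP [] /eqP ->; rewrite ofr // z4.
have inpS u := proj1 (inpG u); have inpB u := proj2 (inpG u).
have [ir6 pos6 q6] := pPeel_ok Gl inpS inpB M2 M_n dm ir5.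
set s6 := cden [::] pPeel s5 in ir6 pos6.
have [[st6 b6] _ rk6 [d6 _] [_ z6]] := ir6.
have [io7 q7] := pOut_ok Gl inpS inpB M2 M_n st6 b6 rk6 pos6 z6.
set s7 := cden [::] pOut s6 in io7.
have [_ f7 b7] := io7.
have [a60 a62 a64 a65 a613] := st6.
set D := s6 3 0 in d6 io7.
have cx7 : ctx D n H (s7 11) s7.
  split.
  - by rewrite f7.
  - by rewrite f7.
  - by rewrite f7.
  - apply: (hadj_ok (inp := inp) (lH := lH)) => //; last by rewrite f7.
    by move=> i; rewrite f7.
  - by [].
have out_le := out_rows io7.
have out_last := out_last_row Gl rk6 pos6 io7.
have [c1 c2 c3 _ _] := cx7.
have widq q i : okOS H mode (Oset k q) (Sset k q) -> i < k.+1 ->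
    #|Bset k (best k q) i| <= w.
  by move=> okq; have [_] := bestP c1 c2 c3 (okOS_cert okq); apply.
have DN : D <= 4 * dg by apply: d6.
have Zle q i : okOS H mode (Oset k q) (Sset k q) -> i < k.+1 -> Zsize k D n q i <= M.
  move=> okq ik; apply: leq_trans MZ; rewrite expnMn; apply: leq_mul.
    apply: (@leq_trans (n.+1 ^ #|Bset k (best k q) i|)); first exact: leq_exp2rW.
    by rewrite leq_pexp2l // -[k in _ <= k]card_ord max_card.
  by rewrite /CW; do 2 apply: leq_exp2rW; rewrite ltnS.
have mQ : 2 ^ (k * k + k * k) + k.+1 <= m by clear -m_d; lia.
have z713 a : s7 13 a = 0 by rewrite f7.
have [ib8 q8] := pB_ok out_le out_last M2 Mtab mQ Zle widq cx7 b7 z713.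
set s8 := cden [::] (pB mode) s7 in ib8.
have b8 : bnd m M s8 by have [_] := ib8.
have res : fev s8 [::] (eRes mode) = answer H G mode.
  apply: (fev_res (outr := fun u v => adj G u v && (s6 6 u < s6 6 v)) (rank := fun u => s6 6 u)
     _ _ _ mode3 ib8).
  - by move=> u v; rewrite (isout_rows Gl rk6 pos6 io7).
  - move=> u v; rewrite (adj_sym G v u); case: (boolP (adj G u v)) => //= a.
    (* The residue of a rank modulo n identifies its node, so adjacent nodes have different ranks
       and every edge gets a direction. *)
    have nuv : s6 6 u != s6 6 v.
      apply/eqP => E; move: a; have [_ hu _] := rk6 u (pos6 u); have [_ hv _] := rk6 v (pos6 v).
      suff -> : u = v by rewrite adj_irr.
      by apply: val_inj; rewrite /= -hu -hv E.
    by move: nuv; rewrite neq_ltn => ->.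
  - by move=> u v /andP [].
have -> : cden [::] (prog mode) st0 = cden [::] (oRes mode) s8 by [].
split; first by rewrite /oRes cden_put fev_cst res.
have p1 : cco [::] iK st0 <= ctb iK m * bl by apply: (put_cost M2 b0 he).
have p2 : cco [::] iN s1 <= ctb iN m * bl by apply: (put_cost M2 b1 he).
have p3 : cco [::] iOff s2 <= ctb iOff m * bl by apply: (put_cost M2 b2 he).
have p4 : cco [::] iRem s3 <= ctb iRem m * bl by apply: (put_cost M2 b3 he).
have p9 : cco [::] (oRes mode) s8 <= ctb (oRes mode) m * bl.
  rewrite /oRes; apply: (put_cost M2 b8 he).
  by case: (mode) mode3 => [|[|[|//]]] _; vm_compute.
have -> : cco [::] (prog mode) st0 = cco [::] iK st0 + (cco [::] iN s1 + (cco [::] iOff s2 +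
  (cco [::] iRem s3 + (cco [::] pOff s4 + (cco [::] pPeel s5 + (cco [::] pOut s6 +
  (cco [::] (pB mode) s7 + cco [::] (oRes mode) s8))))))) by [].
have -> : ctb (prog mode) m = ctb iK m + (ctb iN m + (ctb iOff m + (ctb iRem m +
  (ctb pOff m + (ctb pPeel m + (ctb pOut m + (ctb (pB mode) m + ctb (oRes mode) m))))))) by [].
have {}q8 : cco [::] (pB mode) s7 <= (2 ^ (k * k + k * k)).+1 * (k.+2 * Zmax.+1) * (ctb (pB mode) m * bl).
  apply: leq_trans q8 _; rewrite -!mulnA; do 2 (apply: leq_mul => //).
  rewrite leq_mul2r; apply/orP; right; rewrite ltnS leq_mul2l; apply/orP; right.
  by rewrite /CW; do 2 apply: leq_exp2rW; rewrite ltnS.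
move: p1 p2 p3 p4 q5 q6 q7 q8 p9.
rewrite /time_bound; move: (cco [::] iK _) (cco [::] iN _) (cco [::] iOff _) (cco [::] iRem _)
  (cco [::] pOff _) (cco [::] pPeel _) (cco [::] pOut _) (cco [::] (pB mode) _)
  (cco [::] (oRes mode) _) => y1 y2 y3 y4 y5 y6 y7 y8 y9.
rewrite -/bl -/R -/pass_bound -/dg.
move: (ctb iK m) (ctb iN m) (ctb iOff m) (ctb iRem m)
  (ctb pOff m) (ctb pPeel m) (ctb pOut m) (ctb (pB mode) m)
  (ctb (oRes mode) m) => x1 x2 x3 x4 x5 x6 x7 x8 x9.
move: (_.+1 * (k.+2 * _)) (R * _) (2 * dg * n) => A B C.
clear => h1 h2 h3 h4 h5 h6 h7 h8 h9.
have grow c c' x y : y <= c * (x * bl) -> c <= c' -> y <= c' * (x * bl).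
  by move=> h cc; apply: leq_trans h _; rewrite leq_mul2r cc orbT.
set t := n + _ + _ + A + 12.
have {}h1 := grow 1 t x1 y1 ltac:(by rewrite mul1n) ltac:(rewrite /t; lia).
have {}h2 := grow 1 t x2 y2 ltac:(by rewrite mul1n) ltac:(rewrite /t; lia).
have {}h3 := grow 1 t x3 y3 ltac:(by rewrite mul1n) ltac:(rewrite /t; lia).
have {}h4 := grow 1 t x4 y4 ltac:(by rewrite mul1n) ltac:(rewrite /t; lia).
have {}h5 := grow _ t x5 y5 h5 ltac:(rewrite /t; lia).
have {}h6 := grow _ t x6 y6 h6 ltac:(rewrite /t; lia).
have {}h7 := grow _ t x7 y7 h7 ltac:(rewrite /t; lia).
have {}h8 := grow _ t x8 y8 h8 ltac:(rewrite /t; lia).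
have {}h9 := grow 1 t x9 y9 ltac:(by rewrite mul1n) ltac:(rewrite /t; lia).
by rewrite 8!mulnDl 8!mulnDr; do ![apply: leq_add => //].
Qed.

End Run.

(** * The time bound *)

Lemma okOS_exists mode k (H : sgraph 'I_k) : exists O, okOS H mode O set0.
Proof.
have [O /andP [/'forall_forallP oO /'forall_forallP aO]] := acyclic_orientation_ex H.
exists O; apply/'forall_forallP => x y.
have /andP [/eqP xy _] := oO x y.
have E : connect (stepOS O set0) =2 connect (Defs.arc O).
  by apply: eq_connect => a b; rewrite /stepOS !inE !orbF.
rewrite E inE implyFb andbT; apply/and3P; split; first exact: aO.
- by apply/implyP; rewrite xy.
- by apply/implyP => _; apply/implyP => h; rewrite xy /Defs.arc h.
Qed.

(** Bags of size 0 reach nothing and cannot cover a node. Positivity of the exponent lets [n ^ taum]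
    absorb the linear time of the peeling. *)
Lemma taum_gt0 mode k (H : sgraph 'I_k) : 0 < k -> 0 < taum mode H.
Proof.
move=> k0; have [O okO] := okOS_exists mode H.
have [B [cov _] Bw] := okOS_cert okO.
rewrite lt0n; apply/negP => /eqP w0.
have : Ordinal k0 \in [set: 'I_k] by rewrite inE.
rewrite -cov => /bigcupP [i _]; have := Bw i; rewrite w0 leqn0 cards_eq0 => /eqP ->.
by rewrite reachD0 inE.
Qed.

(** There is exactly one map from the empty set. For k = 0 this allows G to be replaced by the graph
    without nodes. *)
Lemma answer_empty n (H : sgraph 'I_0) (G : sgraph 'I_n) mode : answer H G mode = 1.
Proof.
have all1 (P : pred {ffun 'I_0 -> 'I_n}) : (forall f, P f) -> #|[set f | P f]| = 1.
  move=> h; transitivity #|[set: {ffun 'I_0 -> 'I_n}]|.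
    by apply: eq_card => f; rewrite !inE h.
  by rewrite cardsT card_ffun !card_ord expn0.
have inj (f : {ffun 'I_0 -> 'I_n}) : injectiveb f by apply/injectiveP => -[].
case: mode => [|[|mode]] /=.
- by apply: all1 => f; apply/forallP => -[].
- have := count_copies H G; rewrite all1; last first.
    by move=> f; rewrite /ihom inj; apply/forallP => -[].
  by move/esym/eqP; rewrite muln_eq1 => /andP [/eqP].
have := count_induced H G; rewrite all1; last first.
  by move=> f; rewrite /iemb inj; apply/forallP => -[].
by move/esym/eqP; rewrite muln_eq1 => /andP [/eqP].
Qed.

Lemma size_encode n (l : 'I_n -> seq 'I_n) : (forall u, size (l u) <= n) ->
  size (encode l) <= n * n.+1 + 1.
Proof.
move=> h; rewrite /encode /= size_flatten addn1 ltnS /shape -map_comp sumnE big_map.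
rewrite big_enum /= -[n in n * _]card_ord -sum_nat_const; apply: leq_sum => u _.
by rewrite /= size_map ltnS h.
Qed.

Lemma encode_le n (l : 'I_n -> seq 'I_n) i : (forall u, size (l u) <= n) ->
  nth 0 (encode l) i <= n.
Proof.
move=> h; have [il|] := ltnP i (size (encode l)); last by move=> ?; rewrite nth_default.
have := mem_nth 0 il; rewrite /encode inE => /predU1P [-> //|/flattenP [r /mapP [u _ ->]]].
by rewrite inE => /predU1P [-> //|/mapP [v _ ->]]; exact: ltnW (ltn_ord v).
Qed.

Lemma leq_skip inp p u v : u <= v -> skip inp p u <= skip inp p v.
Proof.
move=> uv; rewrite -(subnK uv) /skip iterD; elim: (v - u) => //= r IH.
by apply: leq_trans IH _; apply: leq_addr.
Qed.

(** * Collecting the bounds *)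

(** The exponent of n + k + 2 in the bound [M] on all values: 10 for ranks and positions, the next
    summand for table entries ([Tbound]), the last for the numbers of candidates. *)
Definition expo (x : nat) : nat := 10 + (x * x.+2 ^ x.+1 + (x + 2 * (x * x))).
Definition small (x : nat) : nat := 2 ^ (x * x + x * x) + (x.+1 + 4 * x).
Definition load (x : nat) : nat := 40 + (20 * (x + 1) * (x + 1)
  + ((2 ^ (x * x + x * x)).+1 * (x.+2 * (2 * (4 * x).+1 ^ (x * x))))).
Definition budget (mode x : nat) : nat :=
  ctb (prog mode) (small x) * (2 * expo x) * load x.

Lemma pr_succ g : pr g -> pr (fun x => (g x).+1).
Proof. by move=> h; apply: pr_ext (pr_add h (pr_cst 1)) => x; rewrite addn1. Qed.

Lemma pr_square : pr (fun x => x * x).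
Proof. exact: pr_mul pr_id pr_id. Qed.

Lemma pr_double_square : pr (fun x => 2 ^ (x * x + x * x)).
Proof. exact: pr_exp (pr_cst 2) (pr_add pr_square pr_square). Qed.

Lemma pr_succ_quadruple : pr (fun x => (4 * x).+1).
Proof. exact: pr_succ (pr_mul (pr_cst 4) pr_id). Qed.

Lemma pr_expo : pr expo.
Proof.
exact: pr_add (pr_cst 10) (pr_add
  (pr_mul pr_id (pr_exp (pr_succ (pr_succ pr_id)) (pr_succ pr_id)))
  (pr_add pr_id (pr_mul (pr_cst 2) pr_square))).
Qed.

Lemma pr_small : pr small.
Proof.
exact: pr_add pr_double_square (pr_add (pr_succ pr_id) (pr_mul (pr_cst 4) pr_id)).
Qed.

Lemma pr_load : pr load.
Proof.
have h : pr (fun x => x + 1) by exact: pr_add pr_id (pr_cst 1).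
exact: pr_add (pr_cst 40) (pr_add (pr_mul (pr_mul (pr_cst 20) h) h)
  (pr_mul (pr_succ pr_double_square) (pr_mul (pr_succ (pr_succ pr_id))
  (pr_mul (pr_cst 2) (pr_exp pr_succ_quadruple pr_square))))).
Qed.

Lemma pr_budget mode : pr (budget mode).
Proof.
by rewrite /budget; move: (prog mode) => c;
  apply: (pr_mul (pr_mul (pr_comp (pr_ctb c) pr_small) (pr_mul (pr_cst 2) pr_expo)) pr_load).
Qed.

Lemma leq_pow a a' b b' : 0 < a' -> a <= a' -> b <= b' -> a ^ b <= a' ^ b'.
Proof.
by move=> a0 aa bb; apply: leq_trans (leq_exp2rW b aa) _; rewrite leq_pexp2l.
Qed.

Lemma leq_expo x y : x <= y -> expo x <= expo y.
Proof.
move=> xy; have := leq_mul xy xy => xx; rewrite /expo leq_add2l; apply: leq_add; last by lia.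
by apply: leq_mul => //; apply: leq_pow => //; lia.
Qed.

Lemma bitlen_double x : bitlen (2 * x) <= bitlen x + 1.
Proof.
apply: bitlen_leq; first by rewrite addn1.
by rewrite addn1 expnS ltn_mul2l ltn_bitlen.
Qed.

Section Bounds.
(** [n] and [d] belong to the input graph, [n1] and [dg] to the graph that is actually read, which
    is empty when k = 0. *)
Variables (k n d n1 dg w : nat).
Hypotheses (nn : n1 <= n) (dd : dg <= d) (dn : dg <= n1) (w0 : 0 < n1 -> 0 < w).
Let x := d + k.
Let b := n + k + 2.
Let M := b ^ expo k.
Let L := bitlen (n.+1 * d.+1 * k.+1).

Lemma b_gt1 : 1 < b. Proof. by rewrite /b; lia. Qed.

Lemma leq_bpow e : e <= expo k -> b ^ e <= M.
Proof. by move=> h; rewrite leq_exp2l // b_gt1. Qed.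

Lemma M_gt1 : 1 < M.
Proof. by apply: leq_trans b_gt1 (leq_bpow (e := 1) _); rewrite /expo; lia. Qed.

Lemma M_poly : 7 * b ^ 3 <= M.
Proof.
apply: leq_trans (leq_bpow (e := 6) _); last by rewrite /expo; lia.
rewrite (expnD b 3 3) leq_mul2r; apply/orP; right.
by apply: (@leq_trans (2 ^ 3)) => //; rewrite leq_exp2r // b_gt1.
Qed.

Lemma M_rank : 5 * n1 * n1 + 6 * n1 + 1 <= M.
Proof.
apply: leq_trans M_poly; have h : n1 <= b by rewrite /b; lia.
by have := b_gt1; rewrite !expnS expn0 muln1; move: b h => c; clear; nia.
Qed.

Lemma M_tab : Tbound k n1 <= M.
Proof.
rewrite /Tbound -expnM; apply: (@leq_trans (b ^ (k * k.+2 ^ k.+1))).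
  by apply: leq_exp2rW; rewrite /b; lia.
by apply: leq_bpow; rewrite /expo; lia.
Qed.

Lemma M_enum : (n1.+1 * (4 * dg).+1 ^ k) ^ k <= M.
Proof.
(* The base 4 * dg + 1 is below the square of dg + 2, which is at most b. *)
apply: (@leq_trans ((b * (b ^ 2) ^ k) ^ k)).
  apply: leq_exp2rW; apply: leq_mul; first by rewrite /b; lia.
  apply: leq_exp2rW; rewrite !expnS expn0 muln1.
  have : dg.+2 <= b by rewrite /b; lia.
  by move: b => c; clear; nia.
rewrite -expnM -expnS -expnM; apply: leq_bpow; rewrite /expo.
by rewrite mulSn -mulnA; lia.
Qed.

Lemma bitlen_M : bitlen M <= 2 * expo x * L.
Proof.
apply: leq_trans (bitlen_exp _ _) _; first by rewrite /expo.
have e : expo k <= expo x by apply: leq_expo; rewrite /x; lia.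
rewrite -[2 * _ * _]mulnA [2 * _]mulnCA; apply: leq_mul => //.
apply: (@leq_trans (bitlen (2 * (n.+1 * d.+1 * k.+1)))).
  by apply: bitlen_mono; rewrite /b; nia.
apply: leq_trans (bitlen_double _) _; rewrite -/L.
by have := bitlen_gt0 (n.+1 * d.+1 * k.+1); rewrite -/L; lia.
Qed.

Lemma small_x : 2 ^ (k * k + k * k) + k.+1 + 4 * dg <= small x.
Proof.
have kx : k <= x by rewrite /x; lia.
have := leq_mul kx kx => xx; rewrite /small -addnA; apply: leq_add.
  by apply: leq_pow => //; lia.
by rewrite /x; lia.
Qed.

Lemma time_x :
  n1 + ((4 * dg + bitlen n1) * (2 * dg * n1 + n1 + 2) + 10 * n1) + (2 * dg * n1 + n1)
  + (2 ^ (k * k + k * k)).+1 * (k.+2 * (maxn 1 n1 ^ w * ((4 * dg).+1 ^ k) ^ k).+1) + 12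
  <= load x * L * maxn 1 n ^ w.
Proof.
set P := maxn 1 n ^ w; have P0 : 0 < P by rewrite expn_gt0 leq_max.
have L0 : 0 < L by apply: bitlen_gt0.
(* Absorbs the linear terms: the exponent is positive unless the graph read is empty. *)
have nP : n1 <= P.
  have [->|n10] := posnP n1; first by [].
  apply: (@leq_trans (maxn 1 n ^ 1)); first by rewrite expn1 leq_max nn orbT.
  by rewrite leq_pexp2l ?leq_max ?w0.
have bL : bitlen n1 <= L.
  by apply: bitlen_mono; move: nn; rewrite /L; clear; nia.
have dx : dg <= x by rewrite /x; move: dd; clear; lia.
have kx : k <= x by rewrite /x; clear; lia.
have Q0 : 0 < (4 * x).+1 ^ (x * x) by rewrite expn_gt0.
have h1 : (maxn 1 n1 ^ w * ((4 * dg).+1 ^ k) ^ k).+1 <= 2 * (4 * x).+1 ^ (x * x) * P.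
  have h : maxn 1 n1 ^ w * ((4 * dg).+1 ^ k) ^ k <= P * (4 * x).+1 ^ (x * x).
    apply: leq_mul; first by apply: leq_exp2rW; move: nn; clear; lia.
    rewrite -expnM; apply: leq_pow => //; last exact: leq_mul.
    by rewrite ltnS leq_mul2l.
  by rewrite -mulnA (mulnC _ P) mul2n -addnn -addn1; apply: leq_add => //; rewrite muln_gt0 P0.
have h2 : (2 ^ (k * k + k * k)).+1 * (k.+2 * (maxn 1 n1 ^ w * ((4 * dg).+1 ^ k) ^ k).+1)
   <= (2 ^ (x * x + x * x)).+1 * (x.+2 * (2 * (4 * x).+1 ^ (x * x))) * (L * P).
  apply: (@leq_trans ((2 ^ (x * x + x * x)).+1 * (x.+2 * (2 * (4 * x).+1 ^ (x * x) * P)))).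
    apply: leq_mul; last by apply: leq_mul.
    by rewrite ltnS; apply: leq_pow => //; apply: leq_add; apply: leq_mul.
  rewrite -!mulnA; do 4 (apply: leq_mul => //); exact: leq_pmull.
have h3 : (4 * dg + bitlen n1) * (2 * dg * n1 + n1 + 2) <= (4 * x + 1) * (2 * x + 3) * (L * P).
  apply: (@leq_trans (((4 * x + 1) * L) * ((2 * x + 3) * P))); last by rewrite mulnACA.
  apply: leq_mul; first by move: bL dx L0; clear; nia.
  by move: nP P0 (leq_mul dx nP); clear; nia.
rewrite -[load x * L * P]mulnA /load.
have LP : P <= L * P by apply: leq_pmull.
have := leq_trans (leq_mul dx nP) (leq_mul (leqnn x) LP) => h4.
move: h2 h3 h4 (leq_trans nP LP) (leq_trans P0 LP).
move: (_.+1 * (k.+2 * _)) (_.+1 * (x.+2 * _)) (L * P) (_ * (_ + n1 + 2)).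
by clear => A B T C; rewrite -!mulnA !mulnDl !mulnDr; move: (dg * n1) (x * T) => u v; lia.
Qed.

End Bounds.

Section Input.
Variables (mode k n d n1 : nat) (H : sgraph 'I_k) (G : sgraph 'I_n1).
Variables (lH : 'I_k -> seq 'I_k) (l : 'I_n1 -> seq 'I_n1) (w : seq nat).
Let inp i := nth 0 w i.
Let p := skip inp 1 k.
Let off := skip inp (p + 1).
Hypotheses (mode3 : mode < 3) (Hl : adjacency_lists H lH) (Gl : adjacency_lists G l).
Hypotheses (nn : n1 <= n) (dd : degeneracy G <= d) (k0 : 0 < n1 -> 0 < k).
Hypothesis inp0 : inp 0 = k.
Hypothesis inpH : forall x : 'I_k, inp (skip inp 1 x) = size (lH x) /\
  forall j, j < size (lH x) -> inp (skip inp 1 x + 1 + j) = nth x (lH x) j.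
Hypothesis inpN : minn 1 k * inp p = n1.
Hypothesis inpG : forall u : 'I_n1, inp (off u) = size (l u) /\
  forall j, j < size (l u) -> inp (off u + 1 + j) = nth u (l u) j.
Hypotheses (inp_le : forall i, inp i <= n + k) (off_le : off n1 <= 7 * (n + k + 2) ^ 3).

Lemma run_bound :
  cden [::] (prog mode) (init w) 1 0 = answer H G mode /\
  cco [::] (prog mode) (init w) <=
    budget mode (d + k) * (bitlen (n.+1 * d.+1 * k.+1) ^ 2 * maxn 1 n ^ taum mode H).
Proof.
have dn := degeneracy_le G.
have w0 : 0 < n1 -> 0 < taum mode H by move=> /k0; apply: taum_gt0.
set M := (n + k + 2) ^ expo k.
have MP : 7 * (n + k + 2) ^ 3 <= M := M_poly k nn dd dn w0.
have leM i : inp i <= M.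
  apply: leq_trans (inp_le i) (leq_trans _ MP); move: (n + k) => a.
  by rewrite !expnS expn0 muln1; clear; nia.
have le_off u : u <= n1 -> off u <= M.
  by move=> un; apply: leq_trans (leq_skip _ _ un) (leq_trans off_le MP).
have st0 i : init w 0 i = inp i by [].
have st1 a i : a != 0 -> init w a i = 0 by rewrite /init => /negbTE ->.
have [-> q] := run_ok Hl Gl mode3 st0 st1 inp0 inpH inpN inpG leM le_off
  (M_gt1 k nn dd dn w0) (M_rank k nn dd dn w0) (small_x k nn dd dn w0) (M_tab k nn dd dn w0)
  (M_enum k nn dd dn w0).
split=> //; apply: leq_trans q _.
have tx : time_bound H G mode <= load (d + k) * bitlen (n.+1 * d.+1 * k.+1) * maxn 1 n ^ taum mode H
  := time_x k nn dd w0.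
have bx := bitlen_M k nn dd dn w0.
apply: leq_trans (leq_mul tx (leq_mul (leqnn _) bx)) _.
rewrite /budget; move: (ctb _ _) (load _) (2 * expo _) (bitlen (_ * _)) (_ ^ taum _ _).
by clear => a b c e f; rewrite leq_eqVlt; apply/orP; left; apply/eqP; nia.
Qed.

End Input.

Lemma counts_in_time_mono f f' e cnt : (forall d k, f d k <= f' d k) ->
  counts_in_time f e cnt -> counts_in_time f' e cnt.
Proof.
move=> ff [p [C [c h]]]; exists p, C, c => k H n G lH lG hH hG d.
have [t ot tt] := h k H n G lH lG hH hG; exists t => //.
by apply: leq_trans tt _; apply: leq_mul.
Qed.

Lemma counts_in_time_prog mode : mode < 3 ->
  counts_in_time (fun d k => budget mode (d + k)) (fun k H => taum mode H)
    (fun k n H G => answer H G mode).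
Proof.
(* The exponent 2 stands for two logarithms: one from the number of peeling rounds and one from the
   bit lengths of values. *)
move=> mode3; exists (program (prog mode)), 1, 2 => k H n G lH lG hH hG d.
set w := encode lH ++ encode lG.
suff [den co] : cden [::] (prog mode) (init w) 1 0 = answer H G mode /\
    cco [::] (prog mode) (init w) <=
      budget mode (d + k) * (bitlen (n.+1 * d.+1 * k.+1) ^ 2 * maxn 1 n ^ taum mode H).
  have [t ot tt] := program_outputs w (wf_prog mode3); exists t; first by rewrite -den.
  apply: leq_trans tt (leq_trans co _).
  by rewrite mul1n leq_mul2l leq_mul2r leq_pmull ?expn_gt0 ?orbT.
pose inp i := nth 0 w i.
have eH i : i < size (encode lH) -> inp (0 + i) = nth 0 (encode lH) i.
  by rewrite /inp nth_cat => ->.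
have eG i : i < size (encode lG) -> inp (size (encode lH) + i) = nth 0 (encode lG) i.
  by move=> _; rewrite /inp nth_cat ltnNge leq_addr addKn.
have [inp0 pE inpH] := skip_encode eH.
have [inpn offE inpG] := skip_encode eG.
rewrite !add0n in pE.
have kl := size_l hH; have nl := size_l hG.
have inp_le i : inp i <= n + k.
  rewrite /inp nth_cat; case: ifP => _.
    by apply: leq_trans (encode_le _ kl) (leq_addl _ _).
  by apply: leq_trans (encode_le _ nl) (leq_addr _ _).
have sH := size_encode kl; have sG := size_encode nl.
have cube : k * k.+1 + 1 + (n * n.+1 + 1) <= 7 * (n + k + 2) ^ 3.
  by rewrite !expnS expn0 muln1; clear; nia.
case: (posnP k) => [k0|k0].
  have E : size (encode lH) + 1 <= 7 * (n + k + 2) ^ 3.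
    by apply: leq_trans cube; apply: leq_add sH _; rewrite addn1.
  (* The run does not look at G, so it is analysed as a run on the graph without nodes, which has
     the same answer. *)
  pose G0 : sgraph 'I_0 := graph_of_rel (fun _ _ => false).
  have l0 : adjacency_lists G0 (fun _ => [::]) by case.
  have dd : degeneracy G0 <= d := leq_trans (degeneracy_le G0) (leq0n d).
  have -> : answer H G mode = answer H G0 mode.
    by clear -k0; move: H; rewrite k0 => H'; rewrite !answer_empty.
  apply: (run_bound (lH := lH) mode3 hH l0 (leq0n n) dd) => //.
  - by rewrite k0.
  - by case.
  - by rewrite pE.
apply: (run_bound (lH := lH) mode3 hH hG (leqnn n) (leqnn d)) => //.
- by rewrite pE -[nth _ _ _]/(inp _) inpn (minn_idPl k0) mul1n.
- by rewrite pE.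
by rewrite pE offE; apply: leq_trans cube; apply: leq_add.
Qed.

Theorem theorem3p7 :
  exists f : nat -> nat -> nat,
    computable2 f /\
    counts_in_time f (fun (k : nat) (H : sgraph 'I_k) => tau1 H)
      (fun (k n : nat) (H : sgraph 'I_k) (G : sgraph 'I_n) => hom H G) /\
    counts_in_time f (fun (k : nat) (H : sgraph 'I_k) => tau2 H)
      (fun (k n : nat) (H : sgraph 'I_k) (G : sgraph 'I_n) => sub H G) /\
    counts_in_time f (fun (k : nat) (H : sgraph 'I_k) => tau3 H)
      (fun (k n : nat) (H : sgraph 'I_k) (G : sgraph 'I_n) => ind H G).
Proof.
(* The same f has to serve all three problems, hence the sum of the three budgets. *)
exists (fun d k => budget 0 (d + k) + (budget 1 (d + k) + budget 2 (d + k))).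
split; first exact: (computable_pr (pr_add (pr_budget 0) (pr_add (pr_budget 1) (pr_budget 2)))).
split; [|split].
- apply: counts_in_time_mono (counts_in_time_prog (mode := 0) isT) => d k.
  exact: leq_addr.
- apply: counts_in_time_mono (counts_in_time_prog (mode := 1) isT) => d k.
  exact: leq_trans (leq_addr _ _) (leq_addl _ _).
- apply: counts_in_time_mono (counts_in_time_prog (mode := 2) isT) => d k.
  exact: leq_trans (leq_addl _ _) (leq_addl _ _).
Qed.
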